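(* Let $k\ge1$ be an integer. For $\varphi\in\mathcal{O}^k(\overline{\mathbb{C}}\setminus[0,1])$, integers $n\ge1$, $m_1,\dots,m_n\ge1$ and $z_0\in D(m_1,\dots,m_n)\setminus\mathbb{R}$, define $R_k^{[n]}\varphi(z_0)$ by $$T_k^n\varphi(z_0)=(-1)^{n(k+1)}(p_{n-1}-q_{n-1}z_0)^k\left(\varphi(z_n)+\varphi(z_n-1)+\varepsilon_n\varphi(z_n+1)\right)$$ $$-(-1)^{(n-1)(k+1)}(p_{n-2}-q_{n-2}z_0)^k(1+z_{n-1})^k\varepsilon_{n-1}\,\varphi\left(-\frac{z_{n-1}}{1+z_{n-1}}\right)+R_k^{[n]}\varphi(z_0).$$ Then $R_k^{[n]}\varphi$ extends to a function that is continuous on $D(m_1,\dots,m_n)$ and holomorphic in its interior, and there exists $C_k>0$, depending only on $k$, such that for all such $\varphi$, $n$, $m_1,\dots,m_n$ and all $z_0\in D(m_1,\dots,m_n)$, $$\left|R_k^{[n]}\varphi(z_0)\right|\le C_k\,n\left(\frac{\sqrt5-1}2\right)^{nk}\sup_{D_\infty}|\varphi|.$$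
   Context: For a compact interval $J$ and integer $k\ge1$, $\mathcal{O}^k(\overline{\mathbb{C}}\setminus J)$ is the space of functions holomorphic on $\overline{\mathbb{C}}\setminus J$ with a zero at infinity of order at least $k$. On $\mathcal{O}^1(\overline{\mathbb{C}}\setminus[0,1])$, $T_k$ is the operator (mapping this space to itself) $$T_k\varphi(z)=-\sum_{m=1}^\infty z^k\left(\varphi\left(\frac1z-m\right)-\varphi(-m)\right)+\sum_{m=1}^\infty\sum_{j=1}^k\frac{z^{k-j}}{j!}\varphi^{(j)}(-m)$$ (the $m$-th summands being taken together). Sets: $D=\{|z|\le1,\ |z-i|\ge1,\ |z+i|\ge1,\ \operatorname{Re}z>0\}$; $\Delta=\{|z|\le1,\ |z+1|\ge1,\ |\operatorname{Im}z|\le\frac12\}$; $D_\infty=\{|\operatorname{Im}z|>\frac12\}\cup\{\operatorname{Re}z<\frac{\sqrt3}2-1\}\cup\{\operatorname{Re}z>\frac{\sqrt3}2,\ |z-\frac{\sqrt3}3|>\frac{\sqrt3}3\}\cup\{\infty\}\subset\overline{\mathbb{C}}$. Complex continued fraction: $D(m_1,\dots,m_n)$ is the set of $z_0\in D$ such that, with $z_{i+1}=\frac1{z_i}-m_{i+1}$ for $0\le i<n$, one has $z_i\in D$ for $i<n$ and $z_n\in\Delta$. $p_\ell/q_\ell=[0;m_1,\dots,m_\ell]$ are given by $p_\ell=m_\ell p_{\ell-1}+p_{\ell-2}$, $q_\ell=m_\ell q_{\ell-1}+q_{\ell-2}$, with $q_0=p_{-1}=1$, $p_0=q_{-1}=0$.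 For $1\le i\le n$, $\varepsilon_i=0$ if $m_i=1$ and $\varepsilon_i=1$ otherwise; for $n=1$ the second term (the one with $\varepsilon_{n-1}$) is absent, i.e. $\varepsilon_0:=0$ here. *)

(* Defs.v *)
From Stdlib Require Import Reals Factorial.
From Coquelicot Require Import Coquelicot.

Open Scope R_scope.

(** ** Holomorphic functions *)

Definition C_differentiable (f : C -> C) (z : C) : Prop :=
  @ex_derive C_AbsRing C_NormedModule f z.

Definition C_derive_n (f : C -> C) (j : nat) : C -> C := Nat.iter j C_derive f.

Definition C_Series (a : nat -> C) : C :=
  (Series (fun i => Re (a i)), Series (fun i => Im (a i))).

Definition segment (a b : R) (z : C) : Prop := Im z = 0 /\ a <= Re z <= b.

(** With the local coordinate [w = 1/z] at infinity, [f] is [w ^ k] times a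
    function holomorphic near [w = 0]. *)
Definition zero_at_infinity (k : nat) (f : C -> C) : Prop :=
  exists (g : C -> C) (r : R), 0 < r /\
    (forall w : C, Cmod w < r -> C_differentiable g w) /\
    (forall w : C, w <> 0 -> Cmod w < r -> f (/ w)%C = (w ^ k * g w)%C).

(** [O_space k J f]: the function on the Riemann sphere minus [J] which is [f]
    at finite points and [0] at infinity belongs to [O^k].  For [k >= 1] the
    value at infinity is necessarily [0], hence only finite points are
    recorded.  The values of [f] on [J] are irrelevant. *)
Definition O_space (k : nat) (J : C -> Prop) (f : C -> C) : Prop :=
  (forall z : C, ~ J z -> C_differentiable f z) /\ zero_at_infinity k f.

(** ** The operator [T_k] *)

Definition T_term (k : nat) (f : C -> C) (z : C) (m : nat) : C :=
  (- (z ^ k * (f (/ z - INR m) - f (- INR m)))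
   + sum_n_m (fun j => z ^ (k - j) / INR (fact j) * C_derive_n f j (- INR m))
       1 k)%C.

(** The index [m] of the summand runs over [m >= 1].  Values at points of
    [0, 1] are meaningless and are never used by iterates evaluated outside
    [0, 1]. *)
Definition T_op (k : nat) (f : C -> C) (z : C) : C :=
  C_Series (fun i => T_term k f z (S i)).

(** ** Domains *)

Definition D_set (z : C) : Prop :=
  Cmod z <= 1 /\ 1 <= Cmod (z - Ci) /\ 1 <= Cmod (z + Ci) /\ 0 < Re z.

Definition Delta_set (z : C) : Prop :=
  Cmod z <= 1 /\ 1 <= Cmod (z + 1) /\ Rabs (Im z) <= 1 / 2.

(** The finite points of [D_infinity]. *)
Definition Dinf (z : C) : Prop :=
  1 / 2 < Rabs (Im z)
  \/ Re z < sqrt 3 / 2 - 1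
  \/ (sqrt 3 / 2 < Re z /\ sqrt 3 / 3 < Cmod (z - RtoC (sqrt 3 / 3))).

(** The value [0] is the one taken at infinity, which belongs to
    [D_infinity]. *)
Definition sup_Dinf (f : C -> C) : Rbar :=
  Lub_Rbar (fun x => x = 0 \/ exists z : C, Dinf z /\ x = Cmod (f z)).

(** ** Continued fractions

    A finite sequence [m_1, ..., m_n] is given by a function [m : nat -> nat]
    of which only the values at [1, ..., n] are used. *)

Fixpoint cf_orbit (m : nat -> nat) (z0 : C) (i : nat) : C :=
  match i with
  | O => z0
  | S i' => (/ cf_orbit m z0 i' - INR (m (S i')))%C
  end.

Definition D_cyl (n : nat) (m : nat -> nat) (z0 : C) : Prop :=
  (forall i : nat, (i < n)%nat -> D_set (cf_orbit m z0 i))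
  /\ Delta_set (cf_orbit m z0 n).

(** Indices are shifted by one so as to start at [-1]:
    [cf_num m i] is [p_(i-1)] and [cf_den m i] is [q_(i-1)]. *)
Fixpoint cf_num (m : nat -> nat) (i : nat) : nat :=
  match i with
  | O => 1
  | S O => 0
  | S (S i'' as i') => m i' * cf_num m i' + cf_num m i''
  end.

Fixpoint cf_den (m : nat -> nat) (i : nat) : nat :=
  match i with
  | O => 0
  | S O => 1
  | S (S i'' as i') => m i' * cf_den m i' + cf_den m i''
  end.

(** [epsilon_0] is [0] by convention. *)
Definition eps (m : nat -> nat) (i : nat) : R :=
  match i with
  | O => 0
  | S _ => if Nat.eqb (m i) 1 then 0 else 1
  end.

(** ** The remainder [R_k^[n]] *)

(** [p_(l-1) - q_(l-1) z0] *)
Definition cf_form (m : nat -> nat) (l : nat) (z0 : C) : C :=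
  (INR (cf_num m l) - INR (cf_den m l) * z0)%C.

Definition main_term (k n : nat) (m : nat -> nat) (f : C -> C) (z0 : C) : C :=
  let zn := cf_orbit m z0 n in
  ((RtoC (-1)) ^ (n * (k + 1)) * cf_form m n z0 ^ k
   * (f zn + f (zn - 1) + eps m n * f (zn + 1)))%C.

Definition second_term (k n : nat) (m : nat -> nat) (f : C -> C) (z0 : C) : C :=
  let z' := cf_orbit m z0 (n - 1) in
  ((RtoC (-1)) ^ ((n - 1) * (k + 1)) * cf_form m (n - 1) z0 ^ k
   * (1 + z') ^ k * eps m (n - 1) * f (- (z' / (1 + z'))))%C.

Definition remainder (k n : nat) (m : nat -> nat) (f : C -> C) (z0 : C) : C :=
  (Nat.iter n (T_op k) f z0
   - (main_term k n m f z0 - second_term k n m f z0))%C.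

(* Main.v *)
Require Import Defs.
From Stdlib Require Import Reals Lra Lia Psatz ClassicalEpsilon FunctionalExtensionality Factorial.
From Coquelicot Require Import Coquelicot.

Open Scope R_scope.

(** Why the estimate holds.

    The summand of index [m] of [T_k f (z)] is [- z ^ k] times the Taylor
    remainder of order [k] of [f] at [-m] for the displacement [1 / z].  For
    [z] in [D] with [z1 = 1 / z - m1], the summands of index [m1 - 1], [m1],
    [m1 + 1] are the only ones that evaluate [f] close to [[0, 1]].  Keeping
    the three values of [f] apart ([T_split_near3]) leaves a series [T_rest]
    that is holomorphic near every point of the cylinder and bounded by the
    size of [f] away from [[0, 1]].  Iterating along the orbit
    [z_0, ..., z_n] gives the main terms, with the factor
    [prod (- z_i ^ k) = (-1) ^ (n (k + 1)) (p_(n-1) - q_(n-1) z_0) ^ k], and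
    an error that is a sum over [i < n - 1] of [prod_(l < i) (- z_l ^ k)] times
    a [transit] built from [T_k ^ (n-1-i) phi], plus one last [T_rest] of [phi].
    Let [g = (sqrt 5 - 1) / 2].  The product is at most a constant times
    [g ^ (i k)] ([cf_form_bound]) and the transit at most a constant times
    [g ^ ((n-1-i) k)] ([transit_bound]).  The [n] contributions of size
    [g ^ ((n-1) k)] make up the bound [n g ^ (n k)].

    Decay of the iterates.  By Bol's identity ([Bol]), derivation of order
    [k + 1] turns [T_k] into a transfer operator: up to signs,
    [D^(k+1) (T_k f) (z)] is the sum of the
    [z ^ (-k-2) D^(k+1) f (1 / z - m)].  In the coordinate [u = - 1 / z] the
    weight [1 / ((1 + Re u) |u + 1 + g| ^ k)] is contracted by the factor [g ^ k]:
    its first factor is the Gauss density, which telescopes, and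
    [|m + u| |1 / (m + u) + 1 + g| = (1 + g) |u + m + g| >= (1 + g) |u + 1 + g|].
    Cauchy's estimates bound [D^(k+1) f] by the size of [f] on a left
    half-plane and Taylor's formula goes back, so that the contraction passes
    to the functions themselves ([decays_iter]).

    The neighbours [m1 - 1] and [m1 + 1].  In a transit they evaluate
    [f = T_k ^ j phi], [j >= 1], at [z1 + 1] and [z1 - 1].  The point [z1 - 1]
    lies in the closed left half-plane, where [f] is bounded and, at [0],
    continuous, although not holomorphic at [0] ([T_cont_0]).  At [z1 + 1] the
    summand of index [1] of [f] is singular when [z1] tends to [0]; it is
    [- (1 + z1) ^ k] times the value of [T_k ^ (j-1) phi] at
    [- z1 / (1 + z1)].  For [j = 1] this is the second explicit term of the
    statement; for [j >= 2] it is bounded by the previous remark.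

    The complex analysis rests on Goursat's theorem for rectangles, applied to
    the periodic function [(f (c + exp xi) - f c) / exp xi]: the mean of
    [(f (c + w) - f c) / w] over a small circle [|w| = r] is [f' (c)]
    ([derive_circle]).  Cauchy's estimates and the holomorphy of [f'] follow
    from this formula alone. *)

(** * Complex differentiability *)

Notation CD := (@is_derive C_AbsRing C_NormedModule).

(** All later limits are handled in this form, with [Cmod], which avoids
    passing between the product uniform structure of the complex plane and the
    one of its absolute value. *)
Lemma CD_eps (f : C -> C) (z l : C) :
  CD f z l <->
  forall eps, 0 < eps -> exists d, 0 < d /\ forall w, Cmod (w - z) < d ->
     Cmod (f w - f z - (w - z) * l) <= eps * Cmod (w - z).
Proof.
  split.
  - intros [_ H] eps He.
    specialize (H z (fun P HP => HP) (mkposreal eps He)).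
    destruct H as [d H].
    exists d. split; [apply cond_pos|]. intros w Hw.
    apply (H w). exact Hw.
  - intros H. split. apply is_linear_scal_l.
    intros x Hx.
    assert (Ex : z = x) by exact (@is_filter_lim_locally_unique C_AbsRing (AbsRing_NormedModule C_AbsRing) z x Hx).
    subst x. intros eps. destruct (H eps (cond_pos eps)) as [d [Hd H']].
    exists (mkposreal d Hd). intros w Hw. apply H'. exact Hw.
Qed.

Lemma Cmod_sub_sym (a b : C) : Cmod (a - b) = Cmod (b - a).
Proof. rewrite <- Cmod_opp. f_equal. ring. Qed.

Lemma Cmod_sub_le (a b : C) : Cmod (a - b) <= Cmod a + Cmod b.
Proof. rewrite <- (Cmod_opp b). apply Cmod_triangle. Qed.

Lemma Cmod_sub_diag (a : C) : Cmod (a - a) = 0.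
Proof. replace (a - a)%C with (RtoC 0) by ring. apply Cmod_0. Qed.

Lemma C_diff_iff (f : C -> C) z : C_differentiable f z <-> CD f z (C_derive f z).
Proof.
  split.
  - intros H. apply C_derive_correct. exact z. exact H.
  - intros H. exists (C_derive f z). exact H.
Qed.

Lemma CD_diff (f : C -> C) z l : CD f z l -> C_differentiable f z.
Proof. intros H; exists l; exact H. Qed.

Lemma CD_derive (f : C -> C) z l : CD f z l -> C_derive f z = l.
Proof. apply is_C_derive_unique. Qed.

(** The chain and product rules are available for the module structure that a
    ring with absolute value carries over itself; it has the same norm as the
    normed module of complex numbers. *)
Lemma CD_self (f : C -> C) (z l : C) :
  CD f z l <-> @is_derive C_AbsRing (AbsRing_NormedModule C_AbsRing) f z l.
Proof.
  split.
  - intros [_ H]. split. apply is_linear_scal_l. intros x Hx eps. exact (H x Hx eps).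
  - intros [_ H]. split. apply is_linear_scal_l. intros x Hx eps. exact (H x Hx eps).
Qed.

Lemma CD_const (a z : C) : CD (fun _ => a) z (RtoC 0).
Proof. exact (is_derive_const (K:=C_AbsRing) (V:=C_NormedModule) a z). Qed.

Lemma CD_id (z : C) : CD (fun w => w) z (RtoC 1).
Proof. apply CD_self. exact (is_derive_id (K:=C_AbsRing) z). Qed.

Lemma CD_plus (f g : C -> C) z a b : CD f z a -> CD g z b -> CD (fun w => (f w + g w)%C) z (a + b)%C.
Proof. exact (is_derive_plus (K:=C_AbsRing) (V:=C_NormedModule) f g z a b). Qed.

Lemma CD_opp (f : C -> C) z a : CD f z a -> CD (fun w => (- f w)%C) z (- a)%C.
Proof. exact (is_derive_opp (K:=C_AbsRing) (V:=C_NormedModule) f z a). Qed.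

Lemma CD_minus (f g : C -> C) z a b : CD f z a -> CD g z b -> CD (fun w => (f w - g w)%C) z (a - b)%C.
Proof. exact (is_derive_minus (K:=C_AbsRing) (V:=C_NormedModule) f g z a b). Qed.

Lemma CD_mult (f g : C -> C) z a b : CD f z a -> CD g z b -> CD (fun w => (f w * g w)%C) z (a * g z + f z * b)%C.
Proof.
  rewrite !CD_self. intros Hf Hg. refine (is_derive_mult (K:=C_AbsRing) f g z a b Hf Hg _).
  intros; apply Cmult_comm.
Qed.

Lemma CD_val (f : C -> C) z a b : CD f z a -> a = b -> CD f z b.
Proof. intros H <-; exact H. Qed.

Lemma CD_comp (f g : C -> C) z a b : CD f (g z) a -> CD g z b -> CD (fun w => f (g w)) z (b * a)%C.
Proof. intros H. rewrite CD_self. exact (is_derive_comp (K:=C_AbsRing) (V:=C_NormedModule) f g z a b H). Qed.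

Lemma CD_loc (f g : C -> C) z l d : 0 < d -> (forall w, Cmod (w - z) < d -> f w = g w) ->
  CD f z l -> CD g z l.
Proof.
  intros Hd He H. apply (is_derive_ext_loc (K:=C_AbsRing) (V:=C_NormedModule) f g z l).
  exists (mkposreal d Hd). intros w Hw. apply He. exact Hw. exact H.
Qed.

Lemma CD_ext (f g : C -> C) z l : (forall w, f w = g w) -> CD f z l -> CD g z l.
Proof. intros He. apply (CD_loc f g z l 1); auto; lra. Qed.

Lemma CD_inv_id (z : C) : z <> RtoC 0 -> CD (fun w => (/ w)%C) z (- (/ (z * z)))%C.
Proof.
  intros Hz. apply CD_eps. intros eps He.
  assert (Hm : 0 < Cmod z) by (apply Cmod_gt_0; exact Hz).
  set (d := Rmin (Cmod z / 2) (eps * (Cmod z * Cmod z * Cmod z) / 2)).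
  exists d. split.
  { unfold d. apply Rmin_case; [lra|]. assert (0 < Cmod z * Cmod z * Cmod z) by (repeat apply Rmult_lt_0_compat; lra).
    assert (0 < eps * (Cmod z * Cmod z * Cmod z)) by (apply Rmult_lt_0_compat; lra). lra. }
  intros w Hw.
  assert (H1 : Cmod (w - z) < Cmod z / 2) by (eapply Rlt_le_trans; [exact Hw|apply Rmin_l]).
  assert (H2 : Cmod (w - z) < eps * (Cmod z * Cmod z * Cmod z) / 2) by (eapply Rlt_le_trans; [exact Hw|apply Rmin_r]).
  assert (H3 : Cmod z / 2 <= Cmod w).
  { assert (Cmod z <= Cmod w + Cmod (z - w)).
    { replace z with (w + (z - w))%C at 1 by ring. apply Cmod_triangle. }
    rewrite Cmod_sub_sym in H. lra. }
  assert (Hw0 : w <> RtoC 0) by (intros ->; rewrite Cmod_0 in H3; lra).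
  replace (/ w - / z - (w - z) * - / (z * z))%C with ((w - z) * (w - z) * / (w * (z * z)))%C
    by (field; split; assumption).
  rewrite !Cmod_mult, Cmod_inv, !Cmod_mult by (apply Cmult_neq_0; [assumption|apply Cmult_neq_0; assumption]).
  rewrite Rmult_assoc. rewrite Rmult_comm. apply Rmult_le_compat_r; [apply Cmod_ge_0|].
  assert (0 < Cmod w * (Cmod z * Cmod z)) by (repeat apply Rmult_lt_0_compat; lra).
  apply (Rmult_le_reg_r (Cmod w * (Cmod z * Cmod z))); [assumption|].
  rewrite Rmult_assoc, Rinv_l by lra.
  assert (Cmod z / 2 * (Cmod z * Cmod z) <= Cmod w * (Cmod z * Cmod z)).
  { apply Rmult_le_compat_r; [|assumption]. apply Rmult_le_pos; lra. }
  assert (eps * (Cmod z / 2 * (Cmod z * Cmod z)) <= eps * (Cmod w * (Cmod z * Cmod z))).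
  { apply Rmult_le_compat_l; lra. }
  lra.
Qed.

Lemma CD_inv (f : C -> C) z a : f z <> RtoC 0 -> CD f z a -> CD (fun w => (/ f w)%C) z (- (a / (f z * f z)))%C.
Proof.
  intros H0 H. eapply CD_val. apply (CD_comp (fun w => / w)%C f z). apply CD_inv_id; exact H0. exact H.
  change (a * - / (f z * f z) = - (a / (f z * f z)))%C. field. exact H0.
Qed.

Lemma CD_pow (f : C -> C) z a n : CD f z a -> CD (fun w => (f w ^ n)%C) z (INR n * f z ^ (pred n) * a)%C.
Proof.
  intros H. induction n as [|n IH].
  - eapply CD_val. exact (CD_const (RtoC 1) z). change (RtoC 0 = 0 * f z ^ 0 * a)%C. ring.
  - eapply CD_val. apply (CD_mult f (fun w => (f w ^ n)%C) z _ _ H IH).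
    rewrite S_INR, RtoC_plus. simpl pred. destruct n as [|n].
    + change (a * f z ^ 0 + f z * (0 * f z ^ 0 * a) = (0 + 1) * f z ^ 0 * a)%C. ring.
    + simpl pred. change (a * f z ^ S n + f z * (INR (S n) * f z ^ n * a) = (INR (S n) + 1) * f z ^ S n * a)%C.
      rewrite !Cpow_S. ring.
Qed.

Lemma diff_cont (f : C -> C) z : C_differentiable f z ->
  forall eps, 0 < eps -> exists d, 0 < d /\ forall w, Cmod (w - z) < d -> Cmod (f w - f z) < eps.
Proof.
  intros [l H] eps He. pose proof (proj1 (CD_eps f z l) H) as H0. destruct (H0 1 Rlt_0_1) as [d [Hd H']].
  set (L := 1 + Cmod l). assert (HL : 0 < L) by (unfold L; generalize (Cmod_ge_0 l); lra).
  exists (Rmin d (eps / L)). split. apply Rmin_case; [lra|]. apply Rdiv_lt_0_compat; lra.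
  intros w Hw. assert (H1 := Rlt_le_trans _ _ _ Hw (Rmin_l _ _)). assert (H2 := Rlt_le_trans _ _ _ Hw (Rmin_r _ _)).
  specialize (H' w H1).
  replace (f w - f z)%C with ((f w - f z - (w - z) * l) + (w - z) * l)%C by ring.
  eapply Rle_lt_trans. apply Cmod_triangle. rewrite Cmod_mult.
  apply (Rmult_lt_compat_r L) in H2; [|lra]. unfold Rdiv in H2. rewrite Rmult_assoc, Rinv_l in H2 by lra.
  unfold L in H2. lra.
Qed.

Lemma diff_const a z : C_differentiable (fun _ => a) z.
Proof. eapply CD_diff, CD_const. Qed.

Lemma diff_id z : C_differentiable (fun w => w) z.
Proof. eapply CD_diff, CD_id. Qed.

Lemma diff_plus f g z : C_differentiable f z -> C_differentiable g z -> C_differentiable (fun w => f w + g w)%C z.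
Proof. intros [a Ha] [b Hb]. eapply CD_diff, CD_plus; eassumption. Qed.

Lemma diff_minus f g z : C_differentiable f z -> C_differentiable g z -> C_differentiable (fun w => f w - g w)%C z.
Proof. intros [a Ha] [b Hb]. eapply CD_diff, CD_minus; eassumption. Qed.

Lemma diff_opp f z : C_differentiable f z -> C_differentiable (fun w => - f w)%C z.
Proof. intros [a Ha]. eapply CD_diff, CD_opp; eassumption. Qed.

Lemma diff_mult f g z : C_differentiable f z -> C_differentiable g z -> C_differentiable (fun w => f w * g w)%C z.
Proof. intros [a Ha] [b Hb]. eapply CD_diff, CD_mult; eassumption. Qed.

Lemma diff_pow f z n : C_differentiable f z -> C_differentiable (fun w => f w ^ n)%C z.
Proof. intros [a Ha]. eapply CD_diff, CD_pow; eassumption. Qed.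

Lemma diff_inv f z : f z <> RtoC 0 -> C_differentiable f z -> C_differentiable (fun w => / f w)%C z.
Proof. intros H [a Ha]. eapply CD_diff, CD_inv; eassumption. Qed.

Lemma diff_comp f g z : C_differentiable f (g z) -> C_differentiable g z -> C_differentiable (fun w => f (g w)) z.
Proof. intros [a Ha] [b Hb]. eapply CD_diff, CD_comp; eassumption. Qed.

Lemma diff_loc f g z d : 0 < d -> (forall w, Cmod (w - z) < d -> f w = g w) ->
  C_differentiable f z -> C_differentiable g z.
Proof. intros Hd H [a Ha]. eapply CD_diff, CD_loc; eassumption. Qed.

Lemma diff_ext f g z : (forall w, f w = g w) -> C_differentiable f z -> C_differentiable g z.
Proof. intros H. apply (diff_loc f g z 1); auto; lra. Qed.

Lemma Cmod_le_ReIm (z : C) : Cmod z <= Rabs (Re z) + Rabs (Im z).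
Proof.
  replace z with (RtoC (Re z) + Ci * RtoC (Im z))%C at 1
    by (destruct z; unfold Ci, RtoC, Re, Im, Cmult, Cplus; simpl; f_equal; ring).
  eapply Rle_trans. apply Cmod_triangle. rewrite Cmod_mult, Cmod_Ci, !Cmod_R. lra.
Qed.

Lemma Im_le_Cmod (z : C) : Rabs (Im z) <= Cmod z.
Proof. eapply Rle_trans; [|apply Rmax_Cmod]. apply Rmax_r. Qed.

Lemma CD_along_line (f : C -> C) (z h l : C) (t : R) : CD f (z + t * h)%C l ->
  is_derive (fun s : R => Re (f (z + s * h)%C)) t (Re (h * l)%C) /\
  is_derive (fun s : R => Im (f (z + s * h)%C)) t (Im (h * l)%C).
Proof.
  intros H. rewrite CD_eps in H.
  assert (G : forall eps, 0 < eps -> exists d, 0 < d /\ forall s : R, Rabs (s - t) < d ->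
    Cmod (f (z + s * h)%C - f (z + t * h)%C - (s - t)%R * (h * l)) <= eps * Rabs (s - t)).
  { intros eps He. set (N := 1 + Cmod h). assert (HN : 0 < N) by (unfold N; generalize (Cmod_ge_0 h); lra).
    destruct (H (eps / N)) as [d [Hd H']]. apply Rdiv_lt_0_compat; lra.
    exists (d / N). split. apply Rdiv_lt_0_compat; lra.
    intros s Hs.
    assert (E : (z + s * h - (z + t * h))%C = ((s - t)%R * h)%C) by (rewrite RtoC_minus; ring).
    specialize (H' (z + s * h)%C). rewrite E in H'. rewrite Cmod_mult, Cmod_R in H'.
    assert (H1 : Rabs (s - t) * Cmod h <= Rabs (s - t) * N).
    { apply Rmult_le_compat_l. apply Rabs_pos. unfold N; lra. }
    assert (H2 : Rabs (s - t) * N < d).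
    { apply (Rmult_lt_compat_r N) in Hs; [|lra]. unfold Rdiv in Hs. rewrite Rmult_assoc, Rinv_l in Hs; lra. }
    specialize (H' (Rle_lt_trans _ _ _ H1 H2)).
    rewrite Cmult_assoc. eapply Rle_trans. exact H'.
    replace (eps * Rabs (s - t)) with (eps / N * (Rabs (s - t) * N)) by (field; lra).
    apply Rmult_le_compat_l; [|exact H1]. apply Rlt_le, Rdiv_lt_0_compat; lra. }
  split; (split; [apply is_linear_scal_l|]); intros x Hx;
    (assert (Ex : t = x) by exact (@is_filter_lim_locally_unique R_AbsRing (AbsRing_NormedModule R_AbsRing) t x Hx)); subst x; intros eps;
    destruct (G eps (cond_pos eps)) as [d [Hd G']]; exists (mkposreal d Hd); intros s Hs; specialize (G' s Hs);
    (eapply Rle_trans; [|exact G']).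
  - eapply Rle_trans; [|apply re_le_Cmod]. apply Req_le. unfold norm; simpl. unfold abs; simpl. f_equal.
    unfold minus, plus, opp, scal; simpl; unfold mult; simpl.
    generalize (f (z + s * h)%C) (f (z + t * h)%C) (h * l)%C. intros [a1 a2] [b1 b2] [c1 c2].
    unfold Cminus, Cplus, Copp, Cmult, RtoC, Re, Im; simpl. ring.
  - eapply Rle_trans; [|apply Im_le_Cmod]. apply Req_le. unfold norm; simpl. unfold abs; simpl. f_equal.
    unfold minus, plus, opp, scal; simpl; unfold mult; simpl.
    generalize (f (z + s * h)%C) (f (z + t * h)%C) (h * l)%C. intros [a1 a2] [b1 b2] [c1 c2].
    unfold Cminus, Cplus, Copp, Cmult, RtoC, Re, Im; simpl. ring.
Qed.

Lemma mvt_unit (u u' : R -> R) (B : R) : (forall t, 0 <= t <= 1 -> is_derive u t (u' t)) ->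
  (forall t, 0 <= t <= 1 -> Rabs (u' t) <= B) -> Rabs (u 1 - u 0) <= B.
Proof.
  intros D H. destruct (MVT_gen u 0 1 u') as [c [Hc Ec]].
  - rewrite Rmin_left, Rmax_right by lra. intros t Ht. apply D; lra.
  - rewrite Rmin_left, Rmax_right by lra. intros t Ht. apply derivable_continuous_pt.
    exists (u' t). apply is_derive_Reals, D, Ht.
  - rewrite Rmin_left, Rmax_right in Hc by lra. rewrite Ec, Rminus_0_r, Rmult_1_r. apply H, Hc.
Qed.

(** The factor 2 comes from applying the real mean value theorem separately to
    real and imaginary parts; constants are immaterial throughout. *)
Lemma mvt_ineq (f : C -> C) (z h : C) (B : R) :
  (forall t, 0 <= t <= 1 -> C_differentiable f (z + t * h)%C /\ Cmod (C_derive f (z + t * h)) <= B) ->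
  Cmod (f (z + h)%C - f z) <= 2 * B * Cmod h.
Proof.
  intros H.
  assert (D : forall t, 0 <= t <= 1 -> CD f (z + t * h)%C (C_derive f (z + t * h))).
  { intros t Ht. apply C_diff_iff. apply H; exact Ht. }
  assert (HB : forall t, 0 <= t <= 1 -> Cmod (h * C_derive f (z + t * h)) <= B * Cmod h).
  { intros t Ht. rewrite Cmod_mult, Rmult_comm. apply Rmult_le_compat_r. apply Cmod_ge_0. apply H, Ht. }
  assert (K1 := mvt_unit (fun t => Re (f (z + t * h)%C)) (fun t => Re (h * C_derive f (z + t * h))%C) (B * Cmod h)
    (fun t Ht => proj1 (CD_along_line f z h _ t (D t Ht))) (fun t Ht => Rle_trans _ _ _ (re_le_Cmod _) (HB t Ht))).
  assert (K2 := mvt_unit (fun t => Im (f (z + t * h)%C)) (fun t => Im (h * C_derive f (z + t * h))%C) (B * Cmod h)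
    (fun t Ht => proj2 (CD_along_line f z h _ t (D t Ht))) (fun t Ht => Rle_trans _ _ _ (Im_le_Cmod _) (HB t Ht))).
  cbv beta in K1, K2. replace (z + 1 * h)%C with (z + h)%C in K1, K2 by ring. replace (z + 0 * h)%C with z in K1, K2 by ring.
  eapply Rle_trans. apply Cmod_le_ReIm.
  change (Re (f (z + h)%C - f z)) with (Re (f (z + h)%C) - Re (f z)).
  change (Im (f (z + h)%C - f z)) with (Im (f (z + h)%C) - Im (f z)). lra.
Qed.

(** * Bisection and Goursat's theorem for rectangles *)

Definition bisect_next (P : R -> R -> R -> R -> Prop) (q : (R * R) * (R * R)) : (R * R) * (R * R) :=
  let '((a, b), (c, d)) := q in
  let m := (a + b) / 2 in let n := (c + d) / 2 in
  if excluded_middle_informative (P a m c n) then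
    if excluded_middle_informative (P m b c n) then
      if excluded_middle_informative (P a m n d) then ((m, b), (n, d)) else ((a, m), (n, d))
    else ((m, b), (c, n))
  else ((a, m), (c, n)).

Lemma nested_limit (a b : nat -> R) (w : R) :
  (forall n, a n <= a (S n)) -> (forall n, b (S n) <= b n) -> (forall n, b n - a n = w / 2 ^ n) -> 0 <= w ->
  exists x, forall n, a n <= x <= b n.
Proof.
  intros Ha Hb Hw w0.
  assert (Hab : forall n, a n <= b n).
  { intros n. assert (0 <= w / 2 ^ n). apply Rdiv_le_0_compat; [lra|apply pow_lt; lra]. rewrite <- Hw in H. lra. }
  assert (Ma : forall n p, a n <= a (n + p)%nat).
  { intros n p; induction p. rewrite Nat.add_0_r; lra. rewrite Nat.add_succ_r. generalize (Ha (n + p)%nat). lra. }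
  assert (Mb : forall n p, b (n + p)%nat <= b n).
  { intros n p; induction p. rewrite Nat.add_0_r; lra. rewrite Nat.add_succ_r. generalize (Hb (n + p)%nat). lra. }
  assert (X : forall n m, a n <= b m).
  { intros n m. generalize (Ma n m) (Mb m n) (Hab (n + m)%nat). rewrite (Nat.add_comm m n). lra. }
  destruct (completeness (fun x => exists n, x = a n)) as [x [U L]].
  - exists (b O). intros x [n ->]. apply X.
  - exists (a O), O; reflexivity.
  - exists x. intros n. split. apply U; exists n; reflexivity.
    apply L. intros y [m ->]. apply X.
Qed.

Lemma small_half (w d : R) : 0 < d -> exists n, w / 2 ^ n < d.
Proof.
  intros Hd. destruct (pow_lt_1_zero (1/2)) with (y := d / (1 + Rabs w)) as [N HN].
  rewrite Rabs_pos_eq; lra. apply Rdiv_lt_0_compat; [lra|generalize (Rabs_pos w); lra].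
  exists N. specialize (HN N (le_n _)). rewrite Rabs_pos_eq in HN by (apply pow_le; lra).
  assert (0 < 1 + Rabs w) by (generalize (Rabs_pos w); lra).
  assert (0 < (1/2) ^ N) by (apply pow_lt; lra).
  apply (Rmult_lt_compat_r (1 + Rabs w)) in HN; [|lra]. unfold Rdiv in HN at 2. rewrite Rmult_assoc, Rinv_l in HN by lra.
  replace (w / 2 ^ N) with (w * (1/2) ^ N).
  - assert (w * (1/2)^N <= Rabs w * (1/2)^N) by (apply Rmult_le_compat_r; [lra|apply Rle_abs]). lra.
  - unfold Rdiv. rewrite Rmult_1_l. rewrite pow_inv. reflexivity.
Qed.

(** A property that holds on all small rectangles around each point and passes
    from the four quarters of a rectangle to the rectangle holds everywhere:
    otherwise nested quarters on which it fails would shrink to a point. It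
    serves for Goursat's theorem and, in place of compactness, for local
    boundedness. *)
Lemma bisection (P : R -> R -> R -> R -> Prop) (a0 b0 c0 d0 : R) :
  a0 <= b0 -> c0 <= d0 ->
  (forall a b c d, a <= b -> c <= d ->
     P a ((a + b) / 2) c ((c + d) / 2) -> P ((a + b) / 2) b c ((c + d) / 2) ->
     P a ((a + b) / 2) ((c + d) / 2) d -> P ((a + b) / 2) b ((c + d) / 2) d -> P a b c d) ->
  (forall x y, a0 <= x <= b0 -> c0 <= y <= d0 -> exists dl, 0 < dl /\
     forall a b c d, a0 <= a -> a <= x <= b -> b <= b0 -> c0 <= c -> c <= y <= d -> d <= d0 ->
       b - a < dl -> d - c < dl -> P a b c d) ->
  P a0 b0 c0 d0.
Proof.
  intros Hab Hcd Hsplit Hloc. apply NNPP. intros HN.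
  set (q := fun n => Nat.iter n (bisect_next P) ((a0, b0), (c0, d0))).
  set (A := fun n => fst (fst (q n))). set (B := fun n => snd (fst (q n))).
  set (Cc := fun n => fst (snd (q n))). set (D := fun n => snd (snd (q n))).
  assert (Inv : forall n, ~ P (A n) (B n) (Cc n) (D n) /\ B n - A n = (b0 - a0) / 2 ^ n /\ D n - Cc n = (d0 - c0) / 2 ^ n
     /\ (A n <= A (S n) /\ B (S n) <= B n) /\ (Cc n <= Cc (S n) /\ D (S n) <= D n)).
  { assert (Step : forall n, ~ P (A n) (B n) (Cc n) (D n) -> A n <= B n -> Cc n <= D n ->
       ~ P (A (S n)) (B (S n)) (Cc (S n)) (D (S n)) /\ B (S n) - A (S n) = (B n - A n) / 2 /\ D (S n) - Cc (S n) = (D n - Cc n) / 2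
        /\ (A n <= A (S n) /\ B (S n) <= B n) /\ (Cc n <= Cc (S n) /\ D (S n) <= D n)).
    { intros n. unfold A, B, Cc, D. change (q (S n)) with (bisect_next P (q n)).
      destruct (q n) as [[a b] [c d]]. cbn [fst snd]. intros HP H1 H2. unfold bisect_next.
      destruct (excluded_middle_informative _) as [p1|p1]; [|cbn [fst snd]; repeat split; auto; lra].
      destruct (excluded_middle_informative _) as [p2|p2]; [|cbn [fst snd]; repeat split; auto; lra].
      destruct (excluded_middle_informative _) as [p3|p3]; [|cbn [fst snd]; repeat split; auto; lra].
      cbn [fst snd]. repeat split; try lra. intros p4. apply HP. apply Hsplit; auto. }
    assert (I0 : forall n, ~ P (A n) (B n) (Cc n) (D n) /\ B n - A n = (b0 - a0) / 2 ^ n /\ D n - Cc n = (d0 - c0) / 2 ^ n).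
    { induction n as [|n [I1 [I2 I3]]].
      - unfold A, B, Cc, D; simpl. split; [exact HN|]. split; field.
      - assert (0 < 2 ^ n) by (apply pow_lt; lra).
        destruct (Step n I1) as [S1 [S2 [S3 _]]].
        + assert (0 <= (b0 - a0) / 2 ^ n) by (apply Rdiv_le_0_compat; lra). lra.
        + assert (0 <= (d0 - c0) / 2 ^ n) by (apply Rdiv_le_0_compat; lra). lra.
        + split; [exact S1|]. rewrite S2, S3, I2, I3. simpl. split; field; lra. }
    intros n. destruct (I0 n) as [I1 [I2 I3]]. split; [exact I1|]. split; [exact I2|]. split; [exact I3|].
    assert (0 < 2 ^ n) by (apply pow_lt; lra).
    apply Step. exact I1.
    - assert (0 <= (b0 - a0) / 2 ^ n) by (apply Rdiv_le_0_compat; lra). lra.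
    - assert (0 <= (d0 - c0) / 2 ^ n) by (apply Rdiv_le_0_compat; lra). lra. }
  destruct (nested_limit A B (b0 - a0)) as [x Hx]; try (intros n; apply Inv); [lra|].
  destruct (nested_limit Cc D (d0 - c0)) as [y Hy]; try (intros n; apply Inv); [lra|].
  destruct (Hloc x y) as [dl [Hdl Hl]]. apply (Hx O). apply (Hy O).
  destruct (small_half ((b0 - a0) + (d0 - c0)) dl Hdl) as [n Hn].
  assert (0 < 2 ^ n) by (apply pow_lt; lra).
  assert (E : ((b0 - a0) + (d0 - c0)) / 2 ^ n = (b0 - a0) / 2 ^ n + (d0 - c0) / 2 ^ n) by (field; lra).
  assert (0 <= (b0 - a0) / 2 ^ n) by (apply Rdiv_le_0_compat; lra).
  assert (0 <= (d0 - c0) / 2 ^ n) by (apply Rdiv_le_0_compat; lra).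
  destruct (Inv n) as [I1 [I2 [I3 _]]].
  assert (M : forall j, a0 <= A j /\ B j <= b0 /\ c0 <= Cc j /\ D j <= d0).
  { induction j. unfold A, B, Cc, D; simpl; lra. generalize (Inv j). lra. }
  apply I1. apply Hl; try apply Hx; try apply Hy; try apply M; lra.
Qed.

Definition CInt (u : R -> C) (a b : R) : C := @RInt C_R_CompleteNormedModule u a b.
Notation is_CInt := (@is_RInt C_R_NormedModule).
Notation ex_CInt := (@ex_RInt C_R_NormedModule).

Lemma CInt_correct u a b : ex_CInt u a b -> is_CInt u a b (CInt u a b).
Proof. apply (RInt_correct (V := C_R_CompleteNormedModule)). Qed.

Lemma CInt_unique u a b l : is_CInt u a b l -> CInt u a b = l.
Proof. apply (is_RInt_unique (V := C_R_CompleteNormedModule)). Qed.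

Definition cont_at (u : R -> C) (t : R) :=
  forall eps, 0 < eps -> exists d, 0 < d /\ forall s, Rabs (s - t) < d -> Cmod (u s - u t) < eps.

Lemma ex_CInt_cont (u : R -> C) a b : a <= b -> (forall t, a <= t <= b -> cont_at u t) -> ex_CInt u a b.
Proof.
  intros Hab H. apply (ex_RInt_continuous (V := C_R_CompleteNormedModule)).
  rewrite Rmin_left, Rmax_right by lra. intros z Hz.
  apply filterlim_locally. intros eps. destruct (H z Hz (eps / 2)) as [d [Hd H']].
  generalize (cond_pos eps); lra.
  exists (mkposreal d Hd). intros s Hs. specialize (H' s Hs).
  apply (C_NormedModule_mixin_compat1). unfold minus, plus, opp; simpl.
  change (Cmod (u s - u z) < eps). generalize (cond_pos eps); lra.
Qed.

Lemma CInt_bound (u : R -> C) a b M : a <= b -> ex_CInt u a b ->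
  (forall t, a <= t <= b -> Cmod (u t) <= M) -> Cmod (CInt u a b) <= (b - a) * M.
Proof.
  intros Hab He HM.
  rewrite Cmod_norm. apply (norm_RInt_le_const (V := C_R_NormedModule) u a b (CInt u a b) M Hab).
  - intros x Hx. eapply Rle_trans; [|exact (HM x Hx)]. rewrite (Cmod_norm (u x)). apply Rle_refl.
  - apply CInt_correct, He.
Qed.

Lemma CInt_Chasles u a b c : ex_CInt u a b -> ex_CInt u b c -> (CInt u a b + CInt u b c = CInt u a c)%C.
Proof. exact (RInt_Chasles (V := C_R_CompleteNormedModule) u a b c). Qed.

Lemma CInt_minus u v a b : ex_CInt u a b -> ex_CInt v a b ->
  CInt (fun t => u t - v t)%C a b = (CInt u a b - CInt v a b)%C.
Proof. exact (RInt_minus (V := C_R_CompleteNormedModule) u v a b). Qed.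

Lemma ex_CInt_minus u v a b : ex_CInt u a b -> ex_CInt v a b -> ex_CInt (fun t => u t - v t)%C a b.
Proof. exact (ex_RInt_minus (V := C_R_NormedModule) u v a b). Qed.

Lemma CInt_const (l : C) a b : CInt (fun _ => l) a b = (RtoC (b - a) * l)%C.
Proof.
  unfold CInt. rewrite (RInt_const (V := C_R_CompleteNormedModule) a b l).
  destruct l as [l1 l2]. unfold scal; simpl. unfold prod_scal, scal; simpl. unfold mult; simpl.
  unfold RtoC, Cmult; simpl. f_equal; ring.
Qed.

Lemma CInt_ext u v a b : a <= b -> (forall t, a <= t <= b -> u t = v t) -> CInt u a b = CInt v a b.
Proof.
  intros Hab H. apply (RInt_ext (V := C_R_CompleteNormedModule)). rewrite Rmin_left, Rmax_right by lra.
  intros t Ht. apply H. lra.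
Qed.

Lemma is_CInt_scal (l : C) u a b I : is_CInt u a b I -> is_CInt (fun t => l * u t)%C a b (l * I)%C.
Proof.
  intros H.
  pose proof (is_RInt_fct_extend_fst (U := R_NormedModule) (V := R_NormedModule) u a b I H) as H1.
  pose proof (is_RInt_fct_extend_snd (U := R_NormedModule) (V := R_NormedModule) u a b I H) as H2.
  apply (is_RInt_fct_extend_pair (U := R_NormedModule) (V := R_NormedModule) (fun t => l * u t)%C a b
    (fst l * fst I - snd l * snd I) (fst l * snd I + snd l * fst I)).
  - apply (is_RInt_minus (V := R_NormedModule) (fun t => fst l * fst (u t)) (fun t => snd l * snd (u t)));
      apply (is_RInt_scal (V := R_NormedModule)); assumption.
  - apply (is_RInt_plus (V := R_NormedModule) (fun t => fst l * snd (u t)) (fun t => snd l * fst (u t)));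
      apply (is_RInt_scal (V := R_NormedModule)); assumption.
Qed.

Lemma CInt_scal (l : C) u a b : ex_CInt u a b -> CInt (fun t => l * u t)%C a b = (l * CInt u a b)%C.
Proof. intros H. apply CInt_unique, is_CInt_scal, CInt_correct, H. Qed.

(** The integral of [g] along the boundary, counterclockwise from the corner
    [(a, c)]. *)
Definition rect_int (g : C -> C) a b c d : C :=
  (CInt (fun x => g (x, c)) a b - CInt (fun x => g (x, d)) a b
   + Ci * (CInt (fun y => g (b, y)) c d - CInt (fun y => g (a, y)) c d))%C.

Lemma cont_hor g x c : C_differentiable g (x, c) -> cont_at (fun t => g (t, c)) x.
Proof.
  intros H eps He. destruct (diff_cont g (x, c) H eps He) as [d [Hd H']]. exists d. split; [exact Hd|].
  intros s Hs. apply H'. replace ((s, c) - (x, c))%C with (RtoC (s - x)).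
  rewrite Cmod_R; exact Hs. unfold RtoC, Cminus, Cplus, Copp; simpl. f_equal; ring.
Qed.

Lemma cont_ver g x c : C_differentiable g (x, c) -> cont_at (fun t => g (x, t)) c.
Proof.
  intros H eps He. destruct (diff_cont g (x, c) H eps He) as [d [Hd H']]. exists d. split; [exact Hd|].
  intros s Hs. apply H'. replace ((x, s) - (x, c))%C with (Ci * RtoC (s - c))%C.
  rewrite Cmod_mult, Cmod_Ci, Cmod_R, Rmult_1_l; exact Hs.
  unfold Ci, RtoC, Cmult, Cminus, Cplus, Copp; simpl. f_equal; ring.
Qed.

(** Affine functions have zero integral along the boundary, so only the
    deviation of [g] from an affine function contributes. *)
Lemma rect_int_small g a b c d p l eps :
  a <= b -> c <= d ->
  (forall x y, a <= x <= b -> c <= y <= d -> C_differentiable g (x, y)) ->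
  (forall x y, a <= x <= b -> c <= y <= d -> Cmod (g (x, y) - g p - ((x, y) - p) * l)%C <= eps) ->
  Cmod (rect_int g a b c d) <= 2 * eps * ((b - a) + (d - c)).
Proof.
  intros Hab Hcd Hd He. unfold rect_int.
  assert (EX : forall y, c <= y <= d -> ex_CInt (fun x => g (x, y)) a b).
  { intros y Hy. apply ex_CInt_cont; [lra|]. intros t Ht. apply cont_hor, Hd; lra. }
  assert (EY : forall x, a <= x <= b -> ex_CInt (fun y => g (x, y)) c d).
  { intros x Hx. apply ex_CInt_cont; [lra|]. intros t Ht. apply cont_ver, Hd; lra. }
  rewrite <- CInt_minus, <- CInt_minus by (apply EX || apply EY; lra).
  assert (EC : forall (l : C) a b, ex_CInt (fun _ => l) a b).
  { intros. apply (ex_RInt_const (V := C_R_NormedModule)). }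
  set (u := fun t : R => ((g (t, c) - g (t, d)) - (Ci * RtoC (c - d)) * l)%C).
  set (v := fun t : R => ((g (b, t) - g (a, t)) - (RtoC (b - a)) * l)%C).
  assert (E : (CInt (fun t => g (t, c) - g (t, d)) a b + Ci * CInt (fun t => g (b, t) - g (a, t)) c d
     = CInt u a b + Ci * CInt v c d)%C).
  { unfold u, v.
    rewrite (CInt_minus (fun t => g (t, c) - g (t, d))%C (fun _ => (Ci * RtoC (c - d)) * l)%C).
    2: apply ex_CInt_minus; apply EX; lra. 2: apply EC.
    rewrite (CInt_minus (fun t => g (b, t) - g (a, t))%C (fun _ => (RtoC (b - a)) * l)%C).
    2: apply ex_CInt_minus; apply EY; lra. 2: apply EC.
    rewrite !CInt_const. rewrite !RtoC_minus. ring. }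
  rewrite E.
  assert (B1 : Cmod (CInt u a b) <= (b - a) * (2 * eps)).
  { apply CInt_bound; [lra| |].
    - apply ex_CInt_minus; [apply ex_CInt_minus; apply EX; lra|apply EC].
    - intros t Ht. unfold u.
      replace (g (t, c) - g (t, d) - Ci * RtoC (c - d) * l)%C with
        ((g (t, c) - g p - ((t, c) - p) * l) - (g (t, d) - g p - ((t, d) - p) * l))%C.
      + eapply Rle_trans. apply Cmod_sub_le.
        generalize (He t c) (He t d). intros. lra.
      + replace ((t, c) : C) with ((t, d) + Ci * RtoC (c - d))%C. ring.
        unfold Ci, RtoC, Cmult, Cminus, Cplus, Copp; simpl. f_equal; ring. }
  assert (B2 : Cmod (CInt v c d) <= (d - c) * (2 * eps)).
  { apply CInt_bound; [lra| |].
    - apply ex_CInt_minus; [apply ex_CInt_minus; apply EY; lra|apply EC].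
    - intros t Ht. unfold v.
      replace (g (b, t) - g (a, t) - RtoC (b - a) * l)%C with
        ((g (b, t) - g p - ((b, t) - p) * l) - (g (a, t) - g p - ((a, t) - p) * l))%C.
      + eapply Rle_trans. apply Cmod_sub_le.
        generalize (He b t) (He a t). intros. lra.
      + replace ((b, t) : C) with ((a, t) + RtoC (b - a))%C. ring.
        unfold Ci, RtoC, Cmult, Cminus, Cplus, Copp; simpl. f_equal; ring. }
  eapply Rle_trans. apply Cmod_triangle. rewrite Cmod_mult, Cmod_Ci. lra.
Qed.

Lemma Cmod_pair_le x y : Cmod (x, y) <= Rabs x + Rabs y.
Proof. apply (Cmod_le_ReIm (x, y)). Qed.

(** The bound [eps * (half-perimeter) ^ 2] passes from the quarters to the
    whole because the squares of their half-perimeters add up to that of the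
    whole; near each point it holds by differentiability. *)
Theorem Goursat (g : C -> C) a0 b0 c0 d0 : a0 <= b0 -> c0 <= d0 ->
  (forall x y, a0 <= x <= b0 -> c0 <= y <= d0 -> C_differentiable g (x, y)) ->
  rect_int g a0 b0 c0 d0 = RtoC 0.
Proof.
  intros Hab Hcd Hd. apply Cmod_eq_0. apply Rle_antisym; [|apply Cmod_ge_0].
  apply le_epsilon. intros e0 He0. rewrite Rplus_0_l.
  set (W := (b0 - a0) + (d0 - c0)). assert (HW : 0 <= W) by (unfold W; lra).
  (* [1 + W * W] instead of [W * W] covers degenerate rectangles. *)
  set (eps := e0 / (1 + W * W)).
  assert (HWW : 0 <= W * W) by (apply Rmult_le_pos; lra).
  assert (Heps : 0 < eps) by (apply Rdiv_lt_0_compat; lra).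
  set (P := fun a b c d => a0 <= a -> b <= b0 -> c0 <= c -> d <= d0 ->
     Cmod (rect_int g a b c d) <= eps * (((b - a) + (d - c)) * ((b - a) + (d - c)))).
  assert (HP : P a0 b0 c0 d0).
  { apply bisection; [exact Hab|exact Hcd| |].
    - intros a b c d H1 H2 P1 P2 P3 P4 Ha Hb Hc Hdd.
      set (m := (a + b) / 2) in *. set (n := (c + d) / 2) in *.
      assert (Hm : a <= m <= b) by (unfold m; lra). assert (Hn : c <= n <= d) by (unfold n; lra).
      assert (E : (rect_int g a b c d = rect_int g a m c n + rect_int g m b c n + rect_int g a m n d + rect_int g m b n d)%C).
      { assert (EX : forall y u v, c <= y <= d -> a <= u -> u <= v -> v <= b -> ex_CInt (fun x => g (x, y)) u v).
        { intros y u v Hy Hu Huv Hv. apply ex_CInt_cont; [lra|]. intros t Ht. apply cont_hor, Hd; lra. }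
        assert (EY : forall x u v, a <= x <= b -> c <= u -> u <= v -> v <= d -> ex_CInt (fun y => g (x, y)) u v).
        { intros x u v Hx Hu Huv Hv. apply ex_CInt_cont; [lra|]. intros t Ht. apply cont_ver, Hd; lra. }
        unfold rect_int.
        rewrite <- (CInt_Chasles (fun x => g (x, c)) a m b) by (apply EX; lra).
        rewrite <- (CInt_Chasles (fun x => g (x, d)) a m b) by (apply EX; lra).
        rewrite <- (CInt_Chasles (fun y => g (b, y)) c n d) by (apply EY; lra).
        rewrite <- (CInt_Chasles (fun y => g (a, y)) c n d) by (apply EY; lra).
        ring. }
      rewrite E.
      assert (Q : forall x y, (x = m - a \/ x = b - m) -> (y = n - c \/ y = d - n) ->
        eps * ((x + y) * (x + y)) = eps * (((b - a) + (d - c)) * ((b - a) + (d - c))) / 4).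
      { intros x y Hx Hy. assert (x = (b - a) / 2) by (unfold m in Hx; lra).
        assert (y = (d - c) / 2) by (unfold n in Hy; lra). subst x y. field. }
      specialize (P1 ltac:(lra) ltac:(lra) ltac:(lra) ltac:(lra)). specialize (P2 ltac:(lra) ltac:(lra) ltac:(lra) ltac:(lra)).
      specialize (P3 ltac:(lra) ltac:(lra) ltac:(lra) ltac:(lra)). specialize (P4 ltac:(lra) ltac:(lra) ltac:(lra) ltac:(lra)).
      rewrite Q in P1, P2, P3, P4 by auto.
      eapply Rle_trans. apply Cmod_triangle. eapply Rle_trans. apply Rplus_le_compat_r. apply Cmod_triangle.
      eapply Rle_trans. apply Rplus_le_compat_r. apply Rplus_le_compat_r. apply Cmod_triangle. lra.
    - intros x y Hx Hy. destruct (Hd x y Hx Hy) as [l Hl].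
      destruct (proj1 (CD_eps g (x, y) l) Hl (eps / 2)) as [dl [Hdl H']]; [lra|].
      exists (dl / 2). split; [lra|].
      intros a b c d H1 H2 H3 H4 H5 H6 H7 H8 _ _ _ _.
      set (w := (b - a) + (d - c)).
      assert (Hw : 0 <= w) by (unfold w; lra).
      replace (eps * (w * w)) with (2 * (eps / 2 * w) * w) by field.
      apply (rect_int_small g a b c d (x, y) l); [lra|lra| |].
      + intros s t Hs Ht. apply Hd; lra.
      + intros s t Hs Ht.
        assert (Hle : Cmod ((s, t) - (x, y)) <= w).
        { unfold Cminus, Cplus, Copp; simpl. eapply Rle_trans. apply Cmod_pair_le.
          unfold w. apply Rplus_le_compat; apply Rabs_le; lra. }
        eapply Rle_trans. apply H'. eapply Rle_lt_trans. exact Hle. unfold w; lra.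
        apply Rmult_le_compat_l; lra. }
  specialize (HP ltac:(lra) ltac:(lra) ltac:(lra) ltac:(lra)). fold W in HP.
  eapply Rle_trans. exact HP. unfold eps.
  apply (Rmult_le_reg_r (1 + W * W)); [lra|]. unfold Rdiv.
  replace (e0 * / (1 + W * W) * (W * W) * (1 + W * W)) with (e0 * (W * W)) by (field; lra).
  apply Rmult_le_compat_l; lra.
Qed.

(** * The derivative as a mean over a circle *)

Lemma derivable_eps (f : R -> R) x l : derivable_pt_lim f x l -> forall eps, 0 < eps ->
  exists d, 0 < d /\ forall h, Rabs h < d -> Rabs (f (x + h) - f x - l * h) <= eps * Rabs h.
Proof.
  intros H eps He. destruct (H eps He) as [d Hd]. exists d. split. apply cond_pos.
  intros h Hh. destruct (Req_dec h 0) as [->|Hn].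
  - rewrite Rplus_0_r. replace (f x - f x - l * 0) with 0 by ring. rewrite Rabs_R0. lra.
  - specialize (Hd h Hn Hh). replace (f (x + h) - f x - l * h) with (((f (x + h) - f x) / h - l) * h) by (field; exact Hn).
    rewrite Rabs_mult. apply Rmult_le_compat_r. apply Rabs_pos. lra.
Qed.

Definition Cexp (z : C) : C := (exp (Re z) * cos (Im z), exp (Re z) * sin (Im z)).

Lemma Cexp_plus z w : Cexp (z + w) = (Cexp z * Cexp w)%C.
Proof.
  destruct z as [a b], w as [c d]. unfold Cexp, Cmult, Cplus, Re, Im; simpl.
  rewrite exp_plus, cos_plus, sin_plus. f_equal; ring.
Qed.

Lemma Cmod_Cexp z : Cmod (Cexp z) = exp (Re z).
Proof.
  unfold Cexp, Cmod; simpl. replace (exp (Re z) * cos (Im z) * (exp (Re z) * cos (Im z) * 1) + exp (Re z) * sin (Im z) * (exp (Re z) * sin (Im z) * 1))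
   with (Rsqr (exp (Re z)) * (Rsqr (sin (Im z)) + Rsqr (cos (Im z)))) by (unfold Rsqr; ring).
  rewrite sin2_cos2, Rmult_1_r, sqrt_Rsqr. reflexivity. apply Rlt_le, exp_pos.
Qed.

Lemma Cexp_neq_0 z : Cexp z <> RtoC 0.
Proof. apply Cmod_gt_0. rewrite Cmod_Cexp. apply exp_pos. Qed.

Lemma Re_Cexp_1 v : Re (Cexp v - 1 - v)%C = exp (Re v) * cos (Im v) - 1 - Re v.
Proof. destruct v as [a b]. unfold Cexp, Cminus, Cplus, Copp, RtoC, Re, Im; simpl. ring. Qed.

Lemma Im_Cexp_1 v : Im (Cexp v - 1 - v)%C = exp (Re v) * sin (Im v) - Im v.
Proof. destruct v as [a b]. unfold Cexp, Cminus, Cplus, Copp, RtoC, Re, Im; simpl. ring. Qed.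

Lemma CD_Cexp z : CD Cexp z (Cexp z).
Proof.
  apply CD_eps. intros eps He. set (N := Cmod (Cexp z)).
  assert (HN : 0 < N) by (unfold N; rewrite Cmod_Cexp; apply exp_pos).
  set (e := eps / (7 * N)). assert (He' : 0 < e) by (apply Rdiv_lt_0_compat; lra).
  destruct (derivable_eps exp 0 1 derivable_pt_lim_exp_0 e He') as [d1 [Hd1 E1]].
  destruct (derivable_eps sin 0 1 derivable_pt_lim_sin_0 e He') as [d2 [Hd2 E2]].
  destruct (derivable_eps cos 0 (- sin 0) (derivable_pt_lim_cos 0) e He') as [d3 [Hd3 E3]].
  set (d := Rmin (Rmin d1 d2) (Rmin d3 (Rmin e 1))).
  exists d. split. { unfold d. repeat apply Rmin_case; lra. }
  intros w Hw.
  assert (Hd' : d <= d1 /\ d <= d2 /\ d <= d3 /\ d <= e /\ d <= 1).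
  { unfold d. repeat split.
    - eapply Rle_trans; apply Rmin_l.
    - eapply Rle_trans; [apply Rmin_l|apply Rmin_r].
    - eapply Rle_trans; [apply Rmin_r|apply Rmin_l].
    - eapply Rle_trans; [apply Rmin_r|]. eapply Rle_trans; [apply Rmin_r|apply Rmin_l].
    - eapply Rle_trans; [apply Rmin_r|]. eapply Rle_trans; [apply Rmin_r|apply Rmin_r]. }
  set (v := (w - z)%C). fold v in Hw.
  replace w with (z + v)%C by (unfold v; ring). rewrite Cexp_plus.
  replace (Cexp z * Cexp v - Cexp z - v * Cexp z)%C with (Cexp z * (Cexp v - 1 - v))%C by ring.
  rewrite Cmod_mult. fold N.
  assert (Hh := re_le_Cmod v). assert (Hk := Im_le_Cmod v). set (m := Cmod v) in *.
  assert (Hm0 : 0 <= m) by apply Cmod_ge_0.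
  set (h := Re v) in *. set (k := Im v) in *.
  assert (F1 := E1 h ltac:(lra)). assert (F2 := E2 k ltac:(lra)). assert (F3 := E3 k ltac:(lra)).
  rewrite Rplus_0_l, exp_0 in F1. rewrite Rplus_0_l, sin_0 in F2. rewrite Rplus_0_l, cos_0, sin_0 in F3.
  assert (Hr : Re (Cexp v - 1 - v)%C = (exp h - 1 - 1 * h) * cos k + (1 + h) * (cos k - 1 - -0 * k)).
  { unfold h, k. rewrite Re_Cexp_1. ring. }
  assert (Hi : Im (Cexp v - 1 - v)%C = (exp h - 1 - 1 * h) * sin k + (1 + h) * (sin k - 0 - 1 * k) + h * k).
  { unfold h, k. rewrite Im_Cexp_1. ring. }
  assert (em : e * Rabs h <= e * m) by (apply Rmult_le_compat_l; lra).
  assert (em' : e * Rabs k <= e * m) by (apply Rmult_le_compat_l; lra).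
  assert (Hc : Rabs (cos k) <= 1) by (apply Rabs_le; apply COS_bound).
  assert (Hs : Rabs (sin k) <= 1) by (apply Rabs_le; apply SIN_bound).
  assert (H1h : Rabs (1 + h) <= 2). { eapply Rle_trans. apply Rabs_triang. rewrite Rabs_R1. lra. }
  assert (M : forall a b A B, Rabs a <= A -> Rabs b <= B -> Rabs (a * b) <= A * B).
  { intros. rewrite Rabs_mult. apply Rmult_le_compat; auto; apply Rabs_pos. }
  assert (B1 : Rabs (Re (Cexp v - 1 - v)%C) <= 3 * (e * m)).
  { rewrite Hr. eapply Rle_trans. apply Rabs_triang.
    eapply Rle_trans. apply Rplus_le_compat. apply (M (exp h - 1 - 1 * h) (cos k) (e * m) 1); lra. apply (M (1 + h) (cos k - 1 - - 0 * k) 2 (e * m)); lra. lra. }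
  assert (B2 : Rabs (Im (Cexp v - 1 - v)%C) <= 4 * (e * m)).
  { rewrite Hi. eapply Rle_trans. apply Rabs_triang. eapply Rle_trans. apply Rplus_le_compat_r. apply Rabs_triang.
    eapply Rle_trans. apply Rplus_le_compat. apply Rplus_le_compat.
    apply (M (exp h - 1 - 1 * h) (sin k) (e * m) 1); lra. apply (M (1 + h) (sin k - 0 - 1 * k) 2 (e * m)); lra. apply (M h k e m); lra. lra. }
  assert (B3 := Cmod_le_ReIm (Cexp v - 1 - v)%C).
  apply Rle_trans with (N * (7 * (e * m))). apply Rmult_le_compat_l; lra.
  unfold e. apply Req_le. field. lra.
Qed.

Definition circ (r t : R) : C := (r * cos t, r * sin t).

Lemma circ_Cexp r t : 0 < r -> circ r t = Cexp (ln r, t).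
Proof. intros Hr. unfold circ, Cexp, Re, Im; simpl. rewrite exp_ln; auto. Qed.

Lemma Cmod_circ r t : 0 < r -> Cmod (circ r t) = r.
Proof. intros Hr. rewrite circ_Cexp by exact Hr. rewrite Cmod_Cexp. simpl. apply exp_ln, Hr. Qed.

Lemma circ_neq_0 r t : 0 < r -> circ r t <> RtoC 0.
Proof. intros Hr. rewrite circ_Cexp by exact Hr. apply Cexp_neq_0. Qed.

Definition hol_ball (f : C -> C) (c : C) (R0 : R) := forall w, Cmod (w - c) < R0 -> C_differentiable f w.

Lemma slope_diff f c R0 xi : hol_ball f c R0 -> exp (Re xi) < R0 ->
  C_differentiable (fun z => (f (c + Cexp z) - f c) / Cexp z)%C xi.
Proof.
  intros H Hx. unfold Cdiv. apply diff_mult.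
  - apply diff_minus; [|apply diff_const]. apply (diff_comp f (fun z => c + Cexp z)%C).
    + apply H. replace (c + Cexp xi - c)%C with (Cexp xi) by ring. rewrite Cmod_Cexp. exact Hx.
    + apply diff_plus. apply diff_const. eapply CD_diff, CD_Cexp.
  - apply diff_inv. apply Cexp_neq_0. eapply CD_diff, CD_Cexp.
Qed.

Lemma slope_circ_cont f c R0 r t : 0 < r < R0 -> hol_ball f c R0 ->
  cont_at (fun t => (f (c + circ r t) - f c) / circ r t)%C t.
Proof.
  intros Hr H.
  assert (D := slope_diff f c R0 (ln r, t) H). simpl in D. rewrite exp_ln in D by lra. specialize (D (proj2 Hr)).
  intros eps He. destruct (cont_ver _ _ _ D eps He) as [d [Hd H']]. exists d. split; [exact Hd|].
  intros s Hs. specialize (H' s Hs). rewrite !circ_Cexp by lra. exact H'.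
Qed.

(** Write [w = exp xi]. The slope of [f] at [c] becomes a function of [xi]
    with period [2 i PI], so the horizontal sides of a rectangle of height [2
    PI] cancel and its mean over the circle of radius [r] does not depend on
    [r]. As [r] tends to [0] the slope tends to the derivative. *)
Theorem derive_circle f c R0 r : 0 < r < R0 -> hol_ball f c R0 ->
  CInt (fun t => (f (c + circ r t) - f c) / circ r t)%C 0 (2 * PI) = (RtoC (2 * PI) * C_derive f c)%C.
Proof.
  intros Hr H. assert (Hpi := PI_RGT_0).
  set (g := fun z => ((f (c + Cexp z) - f c) / Cexp z)%C).
  assert (G : forall s, s <= ln r -> CInt (fun y => g (s, y)) 0 (2 * PI) = CInt (fun y => g (ln r, y)) 0 (2 * PI)).
  { intros s Hs. assert (Z := Goursat g s (ln r) 0 (2 * PI) Hs ltac:(lra)).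
    unfold rect_int in Z.
    rewrite (CInt_ext (fun x => g (x, 0)) (fun x => g (x, 2 * PI))) in Z.
    - assert (Z' : (Ci * (CInt (fun y : R => g (ln r, y)) 0 (2 * PI) - CInt (fun y : R => g (s, y)) 0 (2 * PI)))%C = RtoC 0).
      { rewrite <- Z. ring. intros x y Hx Hy. apply (slope_diff f c R0). exact H. simpl.
        apply Rle_lt_trans with (exp (ln r)). destruct (Req_dec x (ln r)) as [->|]; [lra|]. left; apply exp_increasing; lra.
        rewrite exp_ln; lra. }
      assert (Z2 : Cmod (CInt (fun y : R => g (ln r, y)) 0 (2 * PI) - CInt (fun y : R => g (s, y)) 0 (2 * PI)) = 0).
      { rewrite <- (Rmult_1_l (Cmod _)). rewrite <- Cmod_Ci. rewrite <- Cmod_mult. rewrite Z'. apply Cmod_0. }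
      apply Cmod_eq_0 in Z2. symmetry.
      replace (CInt (fun y : R => g (ln r, y)) 0 (2 * PI)) with
       ((CInt (fun y : R => g (ln r, y)) 0 (2 * PI) - CInt (fun y : R => g (s, y)) 0 (2 * PI)) + CInt (fun y : R => g (s, y)) 0 (2 * PI))%C by ring.
      rewrite Z2. ring.
    - exact Hs.
    - intros t _. unfold g. replace (Cexp (t, 2 * PI)) with (Cexp (t, 0)). reflexivity.
      unfold Cexp; simpl. rewrite cos_2PI, sin_2PI, cos_0, sin_0. reflexivity. }
  assert (Ediff : C_differentiable f c).
  { apply H. rewrite Cmod_sub_diag. lra. }
  apply C_diff_iff in Ediff.
  replace (CInt (fun t : R => ((f (c + circ r t)%C - f c) / circ r t)%C) 0 (2 * PI)) with (CInt (fun y => g (ln r, y)) 0 (2 * PI)).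
  2: { apply CInt_ext; [lra|]. intros t _. unfold g. rewrite circ_Cexp by lra. reflexivity. }
  assert (Z : Cmod (CInt (fun y => g (ln r, y)) 0 (2 * PI) - RtoC (2 * PI) * C_derive f c) = 0).
  { apply Rle_antisym; [|apply Cmod_ge_0]. apply le_epsilon. intros e He. rewrite Rplus_0_l.
    destruct (proj1 (CD_eps _ _ _) Ediff (e / (2 * PI))) as [d [Hd H']]. apply Rdiv_lt_0_compat; lra.
    set (s := ln (Rmin r (d / 2))).
    assert (Hmin : 0 < Rmin r (d / 2)) by (apply Rmin_case; lra).
    assert (Hs : s <= ln r). { unfold s. destruct (Req_dec (Rmin r (d/2)) r) as [->|]; [lra|]. left; apply ln_increasing; [lra|]. generalize (Rmin_l r (d/2)); lra. }
    assert (Hs2 : exp s < d). { unfold s. rewrite exp_ln by lra. generalize (Rmin_r r (d/2)); lra. }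
    assert (Hs3 : exp s < R0). { unfold s. rewrite exp_ln by lra. generalize (Rmin_l r (d/2)); lra. }
    rewrite <- (G s Hs).
    assert (EX : ex_CInt (fun y => g (s, y)) 0 (2 * PI)).
    { apply ex_CInt_cont; [lra|]. intros t _. apply cont_ver. apply (slope_diff f c R0). exact H. exact Hs3. }
    replace (RtoC (2 * PI) * C_derive f c)%C with (CInt (fun _ => C_derive f c) 0 (2 * PI)).
    2: { rewrite CInt_const. rewrite Rminus_0_r. reflexivity. }
    assert (EC : ex_CInt (fun _ => C_derive f c) 0 (2 * PI)) by apply (ex_RInt_const (V := C_R_NormedModule)).
    rewrite <- CInt_minus by assumption.
    replace e with ((2 * PI - 0) * (e / (2 * PI))) by (field; lra).
    apply CInt_bound; [lra|apply ex_CInt_minus; assumption|].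
    intros t _. unfold g.
    specialize (H' (c + Cexp (s, t))%C). replace (c + Cexp (s, t) - c)%C with (Cexp (s, t)) in H' by ring.
    rewrite Cmod_Cexp in H'. simpl in H'. specialize (H' Hs2).
    assert (H0 := Cexp_neq_0 (s, t)).
    replace ((f (c + Cexp (s, t))%C - f c) / Cexp (s, t) - C_derive f c)%C with
      ((f (c + Cexp (s, t))%C - f c - Cexp (s, t) * C_derive f c) / Cexp (s, t))%C by (field; exact H0).
    rewrite Cmod_div by exact H0. rewrite Cmod_Cexp. simpl.
    apply (Rmult_le_reg_r (exp s)). apply exp_pos. unfold Rdiv at 1. rewrite Rmult_assoc, Rinv_l, Rmult_1_r. exact H'.
    generalize (exp_pos s); lra. }
  apply Cmod_eq_0 in Z.
  replace (CInt (fun y => g (ln r, y)) 0 (2 * PI)) with ((CInt (fun y => g (ln r, y)) 0 (2 * PI) - RtoC (2 * PI) * C_derive f c) + RtoC (2 * PI) * C_derive f c)%C by ring.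
  rewrite Z. ring.
Qed.

Lemma ex_CInt_slope_circ f c R0 r : 0 < r < R0 -> hol_ball f c R0 ->
  ex_CInt (fun t => (f (c + circ r t) - f c) / circ r t)%C 0 (2 * PI).
Proof. intros Hr H. generalize PI_RGT_0; intros. apply ex_CInt_cont; [lra|]. intros t _. apply (slope_circ_cont f c R0); assumption. Qed.

Lemma Cmod_2PI : Cmod (RtoC (2 * PI)) = 2 * PI.
Proof. rewrite Cmod_R. apply Rabs_pos_eq. generalize PI_RGT_0; lra. Qed.

(** The slope of [f] on the circle of radius [R0 / 2] is at most [4 * M /
    R0]. *)
Lemma Cauchy_1 f c R0 M : 0 < R0 -> hol_ball f c R0 -> (forall w, Cmod (w - c) < R0 -> Cmod (f w) <= M) ->
  Cmod (C_derive f c) <= 4 * M / R0.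
Proof.
  intros HR H HM. set (r := R0 / 2). assert (Hr : 0 < r < R0) by (unfold r; lra).
  assert (Hpi := PI_RGT_0).
  assert (E := derive_circle f c R0 r Hr H).
  assert (B : Cmod (RtoC (2 * PI) * C_derive f c) <= (2 * PI - 0) * (4 * M / R0)).
  { rewrite <- E. apply CInt_bound; [lra| apply (ex_CInt_slope_circ f c R0); assumption|].
    intros t _. rewrite Cmod_div by (apply circ_neq_0; lra). rewrite Cmod_circ by lra.
    apply (Rmult_le_reg_r r); [lra|]. unfold Rdiv at 1. rewrite Rmult_assoc, Rinv_l, Rmult_1_r by lra.
    replace (4 * M / R0 * r) with (M + M) by (unfold r; field; lra).
    eapply Rle_trans. apply Cmod_sub_le. apply Rplus_le_compat; apply HM.
    replace (c + circ r t - c)%C with (circ r t) by ring. rewrite Cmod_circ; lra.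
    rewrite Cmod_sub_diag; lra. }
  rewrite Cmod_mult, Cmod_2PI in B. rewrite Rminus_0_r in B. apply (Rmult_le_reg_l (2 * PI)); lra.
Qed.

Lemma Cmod_convex_ball (c w w' : C) (R0 t : R) : Cmod (w - c) < R0 -> Cmod (w' - c) < R0 -> 0 <= t <= 1 ->
  Cmod (w + t * (w' - w) - c) < R0.
Proof.
  intros H H' Ht.
  replace (w + t * (w' - w) - c)%C with (RtoC (1 - t) * (w - c) + RtoC t * (w' - c))%C by (rewrite RtoC_minus; ring).
  eapply Rle_lt_trans. apply Cmod_triangle. rewrite !Cmod_mult, !Cmod_R, !Rabs_pos_eq by lra.
  destruct (Req_dec t 0) as [->|]. rewrite Rmult_0_l, Rminus_0_r. lra.
  assert (t * Cmod (w' - c) < t * R0) by (apply Rmult_lt_compat_l; lra).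
  assert ((1 - t) * Cmod (w - c) <= (1 - t) * R0) by (apply Rmult_le_compat_l; lra). lra.
Qed.

Lemma Lipschitz_ball f c R0 B : hol_ball f c R0 -> (forall w, Cmod (w - c) < R0 -> Cmod (C_derive f w) <= B) ->
  forall w w', Cmod (w - c) < R0 -> Cmod (w' - c) < R0 -> Cmod (f w' - f w) <= 2 * B * Cmod (w' - w).
Proof.
  intros H HB w w' Hw Hw'. assert (E := mvt_ineq f w (w' - w) B).
  replace (w + (w' - w))%C with w' in E by ring. apply E.
  intros t Ht. split; [apply H|apply HB]; apply Cmod_convex_ball; assumption.
Qed.

(** * Holomorphy of the derivative, Cauchy's estimates, Taylor's formula *)

Lemma cont_at_const l t : cont_at (fun _ => l) t.
Proof. intros eps He. exists 1. split; [lra|]. intros. rewrite Cmod_sub_diag. exact He. Qed.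

(** Limits along a family of neighbourhoods indexed by a radius: of a real
    parameter for the continuity of integrands, and relative to a set for the
    continuity of the remainder. *)
Definition tends {X : Type} (near : R -> X -> Prop) (u : X -> C) (l : C) : Prop :=
  forall eps, 0 < eps -> exists d, 0 < d /\ forall x, near d x -> Cmod (u x - l) < eps.

Definition shrinks {X : Type} (near : R -> X -> Prop) : Prop := forall d d' x, d <= d' -> near d x -> near d' x.

Lemma tends_mult {X} (near : R -> X -> Prop) u v a b : shrinks near ->
  tends near u a -> tends near v b -> tends near (fun s => u s * v s)%C (a * b)%C.
Proof.
  intros Hs Hu Hv eps He. set (N := 1 + Cmod a + Cmod b).
  assert (HN : 1 <= N) by (unfold N; generalize (Cmod_ge_0 a) (Cmod_ge_0 b); lra).
  set (e := Rmin 1 (eps / (2 * N))).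
  assert (He1 : 0 < eps / (2 * N)) by (apply Rdiv_lt_0_compat; lra).
  assert (He' : 0 < e) by (unfold e; apply Rmin_case; lra).
  destruct (Hu e He') as [d1 [Hd1 H1]]. destruct (Hv e He') as [d2 [Hd2 H2]].
  exists (Rmin d1 d2). split. apply Rmin_case; lra. intros s Hn.
  specialize (H1 s (Hs _ _ _ (Rmin_l _ _) Hn)). specialize (H2 s (Hs _ _ _ (Rmin_r _ _) Hn)).
  replace (u s * v s - a * b)%C with ((u s - a) * (v s - b) + a * (v s - b) + (u s - a) * b)%C by ring.
  set (x := (u s - a)%C) in *. set (y := (v s - b)%C) in *.
  eapply Rle_lt_trans. apply Cmod_triangle. eapply Rle_lt_trans. apply Rplus_le_compat_r. apply Cmod_triangle.
  rewrite !Cmod_mult.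
  assert (Hx := Cmod_ge_0 x). assert (Hy := Cmod_ge_0 y). assert (Hut := Cmod_ge_0 a). assert (Hvt := Cmod_ge_0 b).
  assert (e <= 1) by apply Rmin_l.
  assert (Cmod x * Cmod y <= e * 1) by (apply Rmult_le_compat; lra).
  assert (Cmod a * Cmod y <= Cmod a * e) by (apply Rmult_le_compat_l; lra).
  assert (Cmod x * Cmod b <= e * Cmod b) by (apply Rmult_le_compat_r; lra).
  assert (e * N <= eps / 2).
  { apply Rle_trans with (eps / (2 * N) * N). apply Rmult_le_compat_r; [lra|apply Rmin_r]. apply Req_le; field; lra. }
  unfold N in *. lra.
Qed.

Lemma tends_plus {X} (near : R -> X -> Prop) u v a b : shrinks near ->
  tends near u a -> tends near v b -> tends near (fun s => u s + v s)%C (a + b)%C.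
Proof.
  intros Hs Hu Hv eps He. destruct (Hu (eps/2) ltac:(lra)) as [d1 [Hd1 H1]]. destruct (Hv (eps/2) ltac:(lra)) as [d2 [Hd2 H2]].
  exists (Rmin d1 d2). split. apply Rmin_case; lra. intros s Hn.
  specialize (H1 s (Hs _ _ _ (Rmin_l _ _) Hn)). specialize (H2 s (Hs _ _ _ (Rmin_r _ _) Hn)).
  replace (u s + v s - (a + b))%C with ((u s - a) + (v s - b))%C by ring.
  eapply Rle_lt_trans. apply Cmod_triangle. lra.
Qed.

Lemma tends_opp {X} (near : R -> X -> Prop) u a : tends near u a -> tends near (fun s => - u s)%C (- a)%C.
Proof.
  intros Hu eps He. destruct (Hu eps He) as [d [Hd H]]. exists d. split; [exact Hd|]. intros x Hx.
  replace (- u x - - a)%C with (- (u x - a))%C by ring. rewrite Cmod_opp. apply H, Hx.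
Qed.

Lemma shrinks_at t : shrinks (fun d s => Rabs (s - t) < d).
Proof. intros d d' x H Hx. lra. Qed.

Lemma cont_at_mult u v t : cont_at u t -> cont_at v t -> cont_at (fun s => u s * v s)%C t.
Proof. exact (tends_mult _ u v (u t) (v t) (shrinks_at t)). Qed.

Lemma cont_at_minus u v t : cont_at u t -> cont_at v t -> cont_at (fun s => u s - v s)%C t.
Proof. intros Hu Hv. exact (tends_plus _ u _ (u t) _ (shrinks_at t) Hu (tends_opp _ v (v t) Hv)). Qed.

Lemma cont_at_circ r t : 0 < r -> cont_at (circ r) t.
Proof.
  intros Hr. assert (D : C_differentiable Cexp (ln r, t)) by (eapply CD_diff, CD_Cexp).
  intros eps He. destruct (cont_ver _ _ _ D eps He) as [d [Hd H]]. exists d. split; [exact Hd|].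
  intros s Hs. rewrite !circ_Cexp by exact Hr. apply H, Hs.
Qed.

Lemma cont_at_inv_circ r t : 0 < r -> cont_at (fun t => / circ r t)%C t.
Proof.
  intros Hr. assert (D : C_differentiable (fun z => / Cexp z)%C (ln r, t)).
  { apply diff_inv. apply Cexp_neq_0. eapply CD_diff, CD_Cexp. }
  intros eps He. destruct (cont_ver _ _ _ D eps He) as [d [Hd H]]. exists d. split; [exact Hd|].
  intros s Hs. rewrite !circ_Cexp by exact Hr. apply H, Hs.
Qed.

Lemma hol_ball_sub f c R0 w r : hol_ball f c R0 -> Cmod (w - c) + r <= R0 -> hol_ball f w r.
Proof.
  intros H Hw x Hx. apply H. replace (x - c)%C with ((x - w) + (w - c))%C by ring.
  eapply Rle_lt_trans. apply Cmod_triangle. lra.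
Qed.

Lemma Cmod_sub_tri (a b c : C) : Cmod (a - c) <= Cmod (a - b) + Cmod (b - c).
Proof. replace (a - c)%C with ((a - b) + (b - c))%C by ring. apply Cmod_triangle. Qed.

Lemma Cmod_le_of_2PI (X : C) B : Cmod (RtoC (2 * PI) * X) <= (2 * PI - 0) * B -> Cmod X <= B.
Proof.
  rewrite Cmod_mult, Cmod_2PI, Rminus_0_r. intros H. apply (Rmult_le_reg_l (2 * PI)). generalize PI_RGT_0; lra. lra.
Qed.

(** By [derive_circle] the derivative is a mean of slopes of [f]. Since it is
    bounded, [f] is Lipschitz, hence the derivative is Lipschitz, hence [f w'
    - f w - (w' - w) * C_derive f w] is quadratic in [w' - w], uniformly in
    [w]; differentiating the mean under the integral sign is then a matter of
    inequalities. *)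
Theorem derive_diff f z R0 : 0 < R0 -> hol_ball f z R0 -> C_differentiable (C_derive f) z.
Proof.
  intros HR0 H0. assert (Hpi := PI_RGT_0).
  assert (Dz : C_differentiable f z). { apply H0. rewrite Cmod_sub_diag; lra. }
  destruct (diff_cont f z Dz 1 Rlt_0_1) as [d0 [Hd0 Hc]].
  set (R := Rmin R0 d0). assert (HR : 0 < R) by (apply Rmin_case; lra).
  assert (H : hol_ball f z R). { intros w Hw. apply H0. eapply Rlt_le_trans. exact Hw. apply Rmin_l. }
  set (M := 1 + Cmod (f z)).
  assert (HM : forall w, Cmod (w - z) < R -> Cmod (f w) <= M).
  { intros w Hw. specialize (Hc w (Rlt_le_trans _ _ _ Hw (Rmin_r _ _))).
    replace (f w) with ((f w - f z) + f z)%C by ring. eapply Rle_trans. apply Cmod_triangle. unfold M; lra. }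
  (* [B1] bounds the derivative, so [2 * B1] is a Lipschitz constant of [f];
     [B2] is a Lipschitz constant of the derivative. *)
  set (B1 := 4 * M / (R / 2)).
  assert (D1 : forall w, Cmod (w - z) < R / 2 -> Cmod (C_derive f w) <= B1).
  { intros w Hw. apply Cauchy_1. lra. apply (hol_ball_sub f z R). exact H. lra.
    intros x Hx. apply HM. generalize (Cmod_sub_tri x w z). lra. }
  assert (L1 : forall w w', Cmod (w - z) < R / 2 -> Cmod (w' - z) < R / 2 -> Cmod (f w' - f w) <= 2 * B1 * Cmod (w' - w)).
  { apply Lipschitz_ball. intros w Hw. apply H; lra. exact D1. }
  set (r := R / 8). assert (Hr : 0 < r) by (unfold r; lra).
  assert (Hcirc : forall w t, Cmod (w - z) < R / 4 -> Cmod (w + circ r t - z) < R / 2 /\ (Cmod (w - z) < R / 8 -> Cmod (w + circ r t - z) < R / 4)).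
  { intros w t Hw. assert (E := Cmod_sub_tri (w + circ r t) w z). replace (w + circ r t - w)%C with (circ r t) in E by ring.
    rewrite Cmod_circ in E by lra. unfold r in *. split; [|intros]; lra. }
  assert (HbM : forall w, Cmod (w - z) < R / 4 -> hol_ball f w (R / 2)).
  { intros w Hw. apply (hol_ball_sub f z R). exact H. lra. }
  set (B2 := 4 * B1 / r).
  assert (HM0 : 0 <= M) by (unfold M; generalize (Cmod_ge_0 (f z)); lra).
  assert (HB1 : 0 <= B1). { unfold B1. apply Rdiv_le_0_compat; lra. }
  assert (HB2 : 0 <= B2). { unfold B2. apply Rdiv_le_0_compat; lra. }
  assert (L2 : forall w w', Cmod (w - z) < R / 4 -> Cmod (w' - z) < R / 4 -> Cmod (C_derive f w' - C_derive f w) <= B2 * Cmod (w' - w)).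
  { intros w w' Hw Hw'. apply Cmod_le_of_2PI.
    replace (RtoC (2 * PI) * (C_derive f w' - C_derive f w))%C with (RtoC (2 * PI) * C_derive f w' - RtoC (2 * PI) * C_derive f w)%C by ring.
    rewrite <- (derive_circle f w (R/2) r) by (auto; unfold r; lra). rewrite <- (derive_circle f w' (R/2) r) by (auto; unfold r; lra).
    assert (E1 := ex_CInt_slope_circ f w (R/2) r ltac:(unfold r; lra) (HbM w Hw)). assert (E2 := ex_CInt_slope_circ f w' (R/2) r ltac:(unfold r; lra) (HbM w' Hw')).
    rewrite <- CInt_minus by assumption. apply CInt_bound; [lra|apply ex_CInt_minus; assumption|].
    intros t _. assert (Hn := circ_neq_0 r t Hr).
    replace ((f (w' + circ r t)%C - f w') / circ r t - (f (w + circ r t)%C - f w) / circ r t)%C with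
      (((f (w' + circ r t)%C - f (w + circ r t)%C) - (f w' - f w)) / circ r t)%C by (field; exact Hn).
    rewrite Cmod_div, Cmod_circ by assumption. apply (Rmult_le_reg_r r); [lra|].
    unfold Rdiv at 1. rewrite Rmult_assoc, Rinv_l, Rmult_1_r by lra.
    eapply Rle_trans. apply Cmod_sub_le.
    assert (X1 := L1 (w + circ r t)%C (w' + circ r t)%C (proj1 (Hcirc w t Hw)) (proj1 (Hcirc w' t Hw'))).
    replace (w' + circ r t - (w + circ r t))%C with (w' - w)%C in X1 by ring.
    assert (X2 := L1 w w' ltac:(lra) ltac:(lra)).
    replace (B2 * Cmod (w' - w) * r) with (4 * B1 * Cmod (w' - w)) by (unfold B2; field; lra). lra. }
  assert (T2 : forall w w', Cmod (w - z) < R / 4 -> Cmod (w' - z) < R / 4 ->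
     Cmod (f w' - f w - (w' - w) * C_derive f w) <= 2 * B2 * (Cmod (w' - w) * Cmod (w' - w))).
  { intros w w' Hw Hw'. set (q := fun x => (f x - x * C_derive f w)%C).
    replace (f w' - f w - (w' - w) * C_derive f w)%C with (q (w + (w' - w))%C - q w)%C.
    2: { unfold q. replace (w + (w' - w))%C with w' by ring. ring. }
    replace (2 * B2 * (Cmod (w' - w) * Cmod (w' - w))) with (2 * (B2 * Cmod (w' - w)) * Cmod (w' - w)) by ring.
    apply mvt_ineq. intros t Ht. set (x := (w + t * (w' - w))%C).
    assert (Hx : Cmod (x - z) < R / 4) by (apply Cmod_convex_ball; assumption).
    assert (Dq : CD q x (C_derive f x - (1 * C_derive f w + x * 0))%C).
    { unfold q. apply CD_minus. apply C_diff_iff. apply H; lra. apply (CD_mult (fun x => x) (fun _ => C_derive f w)). apply CD_id. apply CD_const. }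
    split. eapply CD_diff; exact Dq. rewrite (CD_derive _ _ _ Dq).
    replace (C_derive f x - (1 * C_derive f w + x * 0))%C with (C_derive f x - C_derive f w)%C by ring.
    eapply Rle_trans. apply L2; assumption. apply Rmult_le_compat_l; [lra|].
    unfold x. replace (w + t * (w' - w) - w)%C with (t * (w' - w))%C by ring. rewrite Cmod_mult, Cmod_R, Rabs_pos_eq by lra.
    rewrite <- (Rmult_1_l (Cmod (w' - w))) at 2. apply Rmult_le_compat_r; [apply Cmod_ge_0|lra]. }
  set (u := fun t => ((C_derive f (z + circ r t) - C_derive f z) * / circ r t)%C).
  assert (Hz4 : Cmod (z - z) < R / 8). { rewrite Cmod_sub_diag. lra. }
  assert (Cu : forall t, cont_at (fun t => C_derive f (z + circ r t)%C) t).
  { intros t eps He. destruct (cont_at_circ r t Hr (eps / (B2 + 1))) as [d [Hd Hd']]. apply Rdiv_lt_0_compat; lra.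
    exists d. split; [exact Hd|]. intros s Hs. specialize (Hd' s Hs).
    eapply Rle_lt_trans. apply L2; apply Hcirc; lra.
    replace (z + circ r s - (z + circ r t))%C with (circ r s - circ r t)%C by ring.
    apply (Rmult_lt_compat_r (B2 + 1)) in Hd'; [|lra]. unfold Rdiv in Hd'. rewrite Rmult_assoc, Rinv_l in Hd' by lra.
    generalize (Cmod_ge_0 (circ r s - circ r t)). lra. }
  assert (Eu : ex_CInt u 0 (2 * PI)).
  { apply ex_CInt_cont; [lra|]. intros t _. unfold u. apply cont_at_mult. apply cont_at_minus. apply Cu. apply cont_at_const.
    apply cont_at_inv_circ; lra. }
  exists (CInt u 0 (2 * PI) / RtoC (2 * PI))%C. set (l := (CInt u 0 (2 * PI) / RtoC (2 * PI))%C).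
  assert (H2pi : RtoC (2 * PI) <> RtoC 0). { intros E. apply RtoC_inj in E. lra. }
  assert (El : (RtoC (2 * PI) * l)%C = CInt u 0 (2 * PI)). { unfold l. field. exact H2pi. }
  apply CD_eps. intros eps He.
  set (d := Rmin (R / 8) (eps / (4 * B2 / r + 1))).
  assert (Hq : 0 <= 4 * B2 / r) by (apply Rdiv_le_0_compat; lra).
  exists d. split. { unfold d. apply Rmin_case; [lra|]. apply Rdiv_lt_0_compat; lra. }
  intros w Hw. assert (Hw1 := Rlt_le_trans _ _ _ Hw (Rmin_l _ _)). assert (Hw2 := Rlt_le_trans _ _ _ Hw (Rmin_r _ _)).
  set (h := (w - z)%C) in *.
  apply Rle_trans with (4 * B2 / r * (Cmod h * Cmod h)).
  2: { rewrite <- Rmult_assoc. apply Rmult_le_compat_r; [apply Cmod_ge_0|].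
       apply (Rmult_lt_compat_r (4 * B2 / r + 1)) in Hw2; [|lra]. unfold Rdiv in Hw2 at 2. rewrite Rmult_assoc, Rinv_l in Hw2 by lra.
       generalize (Cmod_ge_0 h). lra. }
  apply Cmod_le_of_2PI.
  replace (RtoC (2 * PI) * (C_derive f w - C_derive f z - h * l))%C with
    ((RtoC (2 * PI) * C_derive f w - RtoC (2 * PI) * C_derive f z) - h * (RtoC (2 * PI) * l))%C by ring.
  rewrite El. assert (Hw4 : Cmod (w - z) < R / 4) by (fold h; lra). assert (Hz4' : Cmod (z - z) < R / 4) by lra.
  rewrite <- (derive_circle f w (R/2) r) by (auto; unfold r; lra). rewrite <- (derive_circle f z (R/2) r) by (auto; unfold r; lra).
  assert (E1 := ex_CInt_slope_circ f w (R/2) r ltac:(unfold r; lra) (HbM w Hw4)). assert (E2 := ex_CInt_slope_circ f z (R/2) r ltac:(unfold r; lra) (HbM z Hz4')).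
  rewrite <- CInt_scal by exact Eu. rewrite <- CInt_minus by assumption.
  assert (E3 : ex_CInt (fun t => h * u t)%C 0 (2 * PI)). { exists (h * CInt u 0 (2 * PI))%C. apply is_CInt_scal, CInt_correct, Eu. }
  assert (E4 := ex_CInt_minus _ _ _ _ E1 E2). rewrite <- CInt_minus by assumption.
  apply CInt_bound; [lra|apply ex_CInt_minus; assumption|].
  intros t _. unfold u. assert (Hn := circ_neq_0 r t Hr).
  replace ((f (w + circ r t)%C - f w) / circ r t - (f (z + circ r t)%C - f z) / circ r t -
     h * ((C_derive f (z + circ r t) - C_derive f z) * / circ r t))%C with
   (((f (w + circ r t)%C - f (z + circ r t)%C - h * C_derive f (z + circ r t)) - (f w - f z - h * C_derive f z)) / circ r t)%C
   by (field; exact Hn).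
  rewrite Cmod_div, Cmod_circ by assumption. apply (Rmult_le_reg_r r); [lra|].
  unfold Rdiv at 1. rewrite Rmult_assoc, Rinv_l, Rmult_1_r by lra.
  eapply Rle_trans. apply Cmod_sub_le.
  assert (X1 := T2 (z + circ r t)%C (w + circ r t)%C (proj2 (Hcirc z t Hz4') Hz4) (proj2 (Hcirc w t Hw4) Hw1)).
  replace (w + circ r t - (z + circ r t))%C with h in X1 by (unfold h; ring).
  assert (X2 := T2 z w Hz4' Hw4). fold h in X2.
  replace (4 * B2 / r * (Cmod h * Cmod h) * r) with (2 * (2 * B2 * (Cmod h * Cmod h))) by (field; lra). lra.
Qed.

Definition hol_at (f : C -> C) (z : C) := exists r, 0 < r /\ hol_ball f z r.

Lemma hol_at_ball f c R0 w : hol_ball f c R0 -> Cmod (w - c) < R0 -> hol_at f w.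
Proof. intros H Hw. exists (R0 - Cmod (w - c)). split; [lra|]. apply (hol_ball_sub f c R0); [exact H|lra]. Qed.

Lemma hol_at_diff f z : hol_at f z -> C_differentiable f z.
Proof. intros [r [Hr H]]. apply H. rewrite Cmod_sub_diag; lra. Qed.

Lemma hol_ball_derive f c R0 : hol_ball f c R0 -> hol_ball (C_derive f) c R0.
Proof. intros H w Hw. destruct (hol_at_ball f c R0 w H Hw) as [r [Hr H']]. apply (derive_diff f w r Hr H'). Qed.

Lemma hol_ball_derive_n f c R0 j : hol_ball f c R0 -> hol_ball (C_derive_n f j) c R0.
Proof. intros H. induction j as [|j IH]. exact H. apply (hol_ball_derive (C_derive_n f j)). exact IH. Qed.

Lemma hol_at_derive f z : hol_at f z -> hol_at (C_derive f) z.
Proof. intros [r [Hr H]]. exists r. split; [exact Hr|]. apply hol_ball_derive, H. Qed.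

Lemma hol_at_derive_n f z j : hol_at f z -> hol_at (C_derive_n f j) z.
Proof. intros [r [Hr H]]. exists r. split; [exact Hr|]. apply hol_ball_derive_n, H. Qed.

Lemma derive_n_S f j : C_derive_n f (S j) = C_derive (C_derive_n f j).
Proof. reflexivity. Qed.

Lemma derive_n_Sr f j : C_derive_n f (S j) = C_derive_n (C_derive f) j.
Proof. unfold C_derive_n. apply Nat.iter_succ_r. Qed.

Fixpoint cauchy_const (j : nat) : R := match j with O => 1 | S j => 8 * 2 ^ j * cauchy_const j end.

Lemma cauchy_const_pos j : 0 < cauchy_const j.
Proof. induction j; simpl; [lra|]. apply Rmult_lt_0_compat; [|exact IHj]. apply Rmult_lt_0_compat; [lra|apply pow_lt; lra]. Qed.

(** Each derivation halves the radius, which accounts for the constant. *)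
Theorem Cauchy_n j : forall f c R0 M, 0 < R0 -> hol_ball f c R0 -> (forall w, Cmod (w - c) < R0 -> Cmod (f w) <= M) ->
  Cmod (C_derive_n f j c) <= cauchy_const j * M / R0 ^ j.
Proof.
  induction j as [|j IH]; intros f c R0 M HR H HM.
  - simpl. unfold C_derive_n; simpl. rewrite Rmult_1_l, Rdiv_1_r. apply HM. rewrite Cmod_sub_diag; lra.
  - rewrite derive_n_Sr.
    assert (X := IH (C_derive f) c (R0 / 2) (8 * M / R0) ltac:(lra)).
    assert (0 < R0 ^ j) by (apply pow_lt; lra). assert (0 < 2 ^ j) by (apply pow_lt; lra).
    replace (cauchy_const (S j) * M / R0 ^ S j) with (cauchy_const j * (8 * M / R0) / (R0 / 2) ^ j).
    + apply X.
      * intros w Hw. apply (hol_ball_derive f c R0 H). lra.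
      * intros w Hw. replace (8 * M / R0) with (4 * M / (R0 / 2)) by (field; lra). apply Cauchy_1. lra.
        apply (hol_ball_sub f c R0); [exact H|lra]. intros x Hx. apply HM. generalize (Cmod_sub_tri x w c). lra.
    + unfold Rdiv at 3. rewrite Rpow_mult_distr, pow_inv. simpl. field. lra.
Qed.

Fixpoint csum (a : nat -> C) (n : nat) : C := match n with O => RtoC 0 | S n => (csum a n + a n)%C end.

Lemma csum_ext a b n : (forall i, (i < n)%nat -> a i = b i) -> csum a n = csum b n.
Proof. induction n; intros H; simpl; [reflexivity|]. rewrite IHn, H; auto. Qed.

Definition tpoly (f : C -> C) (c : C) (n : nat) (h : C) : C :=
  csum (fun j => (C_derive_n f j c / RtoC (INR (fact j)) * h ^ j)%C) n.

Lemma fact_C_neq_0 j : RtoC (INR (fact j)) <> RtoC 0.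
Proof. intros E. apply RtoC_inj in E. apply INR_fact_neq_0 in E. exact E. Qed.

Lemma tpoly_1 f c h : tpoly f c 1 h = f c.
Proof.
  unfold tpoly, csum. change (C_derive_n f 0 c) with (f c). change (h ^ 0)%C with (RtoC 1).
  change (RtoC (INR (fact 0))) with (RtoC 1). field.
Qed.

Lemma tpoly_S f c n h : tpoly f c (S n) h = (tpoly f c n h + C_derive_n f n c / RtoC (INR (fact n)) * h ^ n)%C.
Proof. reflexivity. Qed.

Lemma CD_tpoly f c n x : CD (fun x => tpoly f c (S n) (x - c)%C) x (tpoly (C_derive f) c n (x - c)%C).
Proof.
  induction n as [|n IH].
  - change (tpoly (C_derive f) c 0 (x - c)%C) with (RtoC 0). apply (CD_ext (fun _ => f c)). 2: apply CD_const.
    intros w. symmetry. apply tpoly_1.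
  - apply (CD_plus (fun x => tpoly f c (S n) (x - c)%C)
      (fun x => (C_derive_n f (S n) c / RtoC (INR (fact (S n))) * (x - c) ^ S n)%C)). exact IH.
    eapply CD_val. apply (CD_mult (fun _ => (C_derive_n f (S n) c / RtoC (INR (fact (S n))))%C) (fun x => ((x - c) ^ S n)%C)).
    apply CD_const. apply (CD_pow (fun x => (x - c)%C)). apply CD_minus. apply CD_id. apply CD_const.
    change (RtoC 0 * (x - c) ^ S n + C_derive_n f (S n) c / RtoC (INR (fact (S n))) * (RtoC (INR (S n)) * (x - c) ^ n * (RtoC 1 - RtoC 0))
      = C_derive_n (C_derive f) n c / RtoC (INR (fact n)) * (x - c) ^ n)%C.
    rewrite <- derive_n_Sr. change (fact (S n)) with (S n * fact n)%nat. rewrite mult_INR, RtoC_mult.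
    field. split. apply fact_C_neq_0. intros E. apply RtoC_inj in E. apply (not_0_INR (S n)) in E; [exact E|lia].
Qed.

Lemma tpoly_0 f c n : tpoly f c (S n) (RtoC 0) = f c.
Proof.
  induction n. apply tpoly_1. rewrite tpoly_S, IHn, Cpow_S. ring.
Qed.

(** The derivative of the remainder of order [k + 1] is the remainder of order
    [k] of the derivative. *)
Theorem Taylor_bound k : forall f c h S0, 0 <= S0 ->
  (forall t, 0 <= t <= 1 -> hol_at f (c + t * h)%C /\ Cmod (C_derive_n f (S k) (c + t * h)%C) <= S0) ->
  Cmod (f (c + h)%C - tpoly f c (S k) h) <= 2 ^ (S k) * S0 * Cmod h ^ (S k).
Proof.
  induction k as [|k IH]; intros f c h S0 HS H.
  - assert (E := mvt_ineq f c h S0).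
    rewrite tpoly_1. change (2 ^ 1) with (2 * 1). change (Cmod h ^ 1) with (Cmod h * 1). rewrite !Rmult_1_r. apply E.
    intros t Ht. split. apply hol_at_diff. apply H, Ht. apply H, Ht.
  - set (q := fun x => (f x - tpoly f c (S (S k)) (x - c))%C).
    replace (f (c + h)%C - tpoly f c (S (S k)) h)%C with (q (c + h)%C - q c)%C.
    2: { unfold q. replace (c - c)%C with (RtoC 0) by ring. rewrite tpoly_0. replace (c + h - c)%C with h by ring. ring. }
    replace (2 ^ S (S k) * S0 * Cmod h ^ S (S k)) with (2 * (2 ^ S k * S0 * Cmod h ^ S k) * Cmod h) by (simpl; ring).
    apply mvt_ineq. intros t Ht. set (x := (c + t * h)%C).
    assert (Dq : CD q x (C_derive f x - tpoly (C_derive f) c (S k) (x - c))%C).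
    { unfold q. apply (CD_minus f (fun x => tpoly f c (S (S k)) (x - c)%C)). apply C_diff_iff. apply hol_at_diff. apply H, Ht. apply CD_tpoly. }
    split. eapply CD_diff; exact Dq. rewrite (CD_derive _ _ _ Dq).
    assert (X := IH (C_derive f) c (t * h)%C S0 HS). replace (x - c)%C with (t * h)%C by (unfold x; ring). unfold x.
    eapply Rle_trans. apply X.
    + intros s Hs. replace (c + s * (t * h))%C with (c + RtoC (s * t) * h)%C by (rewrite RtoC_mult; ring).
      assert (Hst : 0 <= s * t <= 1). { split. apply Rmult_le_pos; lra. rewrite <- (Rmult_1_l 1). apply Rmult_le_compat; lra. }
      split. apply hol_at_derive. apply H, Hst. rewrite <- derive_n_Sr. apply H, Hst.
    + apply Rmult_le_compat_l. apply Rmult_le_pos; [apply pow_le; lra|exact HS].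
      apply pow_incr. split; [apply Cmod_ge_0|]. rewrite Cmod_mult, Cmod_R, Rabs_pos_eq by lra.
      rewrite <- (Rmult_1_l (Cmod h)) at 2. apply Rmult_le_compat_r; [apply Cmod_ge_0|lra].
Qed.

(** * Normally convergent series of holomorphic functions *)

Definition is_csum (a : nat -> C) (l : C) :=
  forall eps, 0 < eps -> exists N, forall n, (N <= n)%nat -> Cmod (csum a n - l) < eps.

Lemma csum_Re a n : Re (csum a (S n)) = sum_n (fun i => Re (a i)) n.
Proof.
  induction n. rewrite sum_O. simpl. rewrite Rplus_0_l. reflexivity.
  rewrite sum_Sn, <- IHn. reflexivity.
Qed.

Lemma csum_Im a n : Im (csum a (S n)) = sum_n (fun i => Im (a i)) n.
Proof.
  induction n. rewrite sum_O. simpl. rewrite Rplus_0_l. reflexivity.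
  rewrite sum_Sn, <- IHn. reflexivity.
Qed.

Lemma is_csum_Series a l : is_csum a l -> C_Series a = l.
Proof.
  intros H. unfold C_Series. rewrite (surjective_pairing l). f_equal; apply is_series_unique; apply filterlim_locally;
   intros eps; destruct (H eps (cond_pos eps)) as [N HN]; exists N; intros n Hn; specialize (HN (S n) ltac:(lia)).
  - rewrite <- csum_Re. eapply Rle_lt_trans; [|exact HN]. apply (re_le_Cmod (csum a (S n) - l)).
  - rewrite <- csum_Im. eapply Rle_lt_trans; [|exact HN]. apply (Im_le_Cmod (csum a (S n) - l)).
Qed.

Lemma is_csum_ext a b l : (forall i, a i = b i) -> is_csum a l -> is_csum b l.
Proof.
  intros E H eps He. destruct (H eps He) as [N HN]. exists N. intros n Hn.
  rewrite <- (csum_ext a b). apply HN, Hn. intros; apply E.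
Qed.

Lemma csum_plus a b n : csum (fun i => a i + b i)%C n = (csum a n + csum b n)%C.
Proof. induction n; simpl. ring. rewrite IHn. ring. Qed.

Lemma csum_scal l a n : csum (fun i => l * a i)%C n = (l * csum a n)%C.
Proof. induction n; simpl. ring. rewrite IHn. ring. Qed.

Lemma is_csum_plus a b l l' : is_csum a l -> is_csum b l' -> is_csum (fun i => a i + b i)%C (l + l')%C.
Proof.
  intros H H' eps He. destruct (H (eps/2) ltac:(lra)) as [N HN]. destruct (H' (eps/2) ltac:(lra)) as [N' HN'].
  exists (max N N'). intros n Hn. rewrite csum_plus.
  replace (csum a n + csum b n - (l + l'))%C with ((csum a n - l) + (csum b n - l'))%C by ring.
  eapply Rle_lt_trans. apply Cmod_triangle. specialize (HN n ltac:(lia)). specialize (HN' n ltac:(lia)). lra.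
Qed.

Lemma csum_zero_tail a N n : (forall i, (N <= i)%nat -> a i = RtoC 0) -> (N <= n)%nat -> csum a n = csum a N.
Proof.
  intros H Hn. induction Hn. reflexivity. simpl. rewrite IHHn, H by lia. ring.
Qed.

Lemma is_csum_finite a N : (forall i, (N <= i)%nat -> a i = RtoC 0) -> is_csum a (csum a N).
Proof.
  intros H eps He. exists N. intros n Hn. rewrite (csum_zero_tail a N n H Hn).
  rewrite Cmod_sub_diag. exact He.
Qed.

Lemma is_csum_bound a l B : is_csum a l -> (forall n, Cmod (csum a n) <= B) -> Cmod l <= B.
Proof.
  intros H HB. apply le_epsilon. intros e He. destruct (H e He) as [N HN]. specialize (HN N (le_n _)).
  replace l with (csum a N + - (csum a N - l))%C by ring. eapply Rle_trans. apply Cmod_sub_le.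
  specialize (HB N). lra.
Qed.

(** The majorant of all series below; its partial sums telescope to at most
    [1]. *)
Definition tele (i : nat) : R := / (INR (S i) * INR (S (S i))).

Lemma INR_S_pos i : 0 < INR (S i).
Proof. apply lt_0_INR; lia. Qed.

Lemma tele_pos i : 0 < tele i.
Proof. unfold tele. apply Rinv_0_lt_compat, Rmult_lt_0_compat; apply INR_S_pos. Qed.

Lemma tele_diff i : tele i = / INR (S i) - / INR (S (S i)).
Proof. unfold tele. rewrite (S_INR (S i)). field. generalize (INR_S_pos i). lra. Qed.

Lemma inv_sq_le_tele i : / (INR (S i) * INR (S i)) <= 2 * tele i.
Proof.
  unfold tele. assert (H := INR_S_pos i). assert (H1 : 1 <= INR (S i)) by (rewrite S_INR; generalize (pos_INR i); lra).
  rewrite (S_INR (S i)).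
  apply (Rmult_le_reg_r (INR (S i) * INR (S i) * (INR (S i) + 1))). repeat apply Rmult_lt_0_compat; lra.
  replace (/ (INR (S i) * INR (S i)) * (INR (S i) * INR (S i) * (INR (S i) + 1))) with (INR (S i) + 1) by (field; lra).
  replace (2 * / (INR (S i) * (INR (S i) + 1)) * (INR (S i) * INR (S i) * (INR (S i) + 1))) with (2 * INR (S i)) by (field; lra).
  lra.
Qed.

Lemma csum_diff_bound a N0 B : 0 <= B -> (forall i, (N0 <= i)%nat -> Cmod (a i) <= B * tele i) ->
  forall m n, (N0 <= m)%nat -> (m <= n)%nat -> Cmod (csum a n - csum a m) <= B * (/ INR (S m) - / INR (S n)).
Proof.
  intros HB H m n Hm Hn. induction Hn.
  - rewrite Cmod_sub_diag. lra.
  - simpl csum. replace (csum a m0 + a m0 - csum a m)%C with ((csum a m0 - csum a m) + a m0)%C by ring.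
    eapply Rle_trans. apply Cmod_triangle. specialize (H m0 ltac:(lia)). rewrite tele_diff in H. lra.
Qed.

Lemma csum_total_bound a B n : 0 <= B -> (forall i, Cmod (a i) <= B * tele i) -> Cmod (csum a n) <= B.
Proof.
  intros HB H. assert (Y := csum_diff_bound a 0 B HB (fun i _ => H i) 0%nat n ltac:(lia) ltac:(lia)).
  replace (csum a n - csum a 0)%C with (csum a n) in Y by (simpl; ring).
  eapply Rle_trans. exact Y. generalize (Rinv_0_lt_compat _ (INR_S_pos n)). intros. change (INR 1) with 1. rewrite Rinv_1.
  rewrite <- (Rmult_1_r B) at 2. apply Rmult_le_compat_l; lra.
Qed.

Lemma archi_inv eps : 0 < eps -> exists N, forall n, (N <= n)%nat -> / INR (S n) < eps.
Proof.
  intros He. destruct (archimed_cor1 eps He) as [N [H1 H2]]. exists N. intros n Hn.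
  eapply Rle_lt_trans; [|exact H1]. apply Rinv_le_contravar. apply lt_0_INR; lia. apply le_INR; lia.
Qed.

Lemma csum_cv a N0 B : 0 <= B -> (forall i, (N0 <= i)%nat -> Cmod (a i) <= B * tele i) ->
  is_csum a (C_Series a) /\ forall m, (N0 <= m)%nat -> Cmod (C_Series a - csum a m) <= B * / INR (S m).
Proof.
  intros HB H. assert (D := csum_diff_bound a N0 B HB H).
  assert (CC : forall eps, 0 < eps -> exists N, forall n m, (N <= n)%nat -> (N <= m)%nat -> Cmod (csum a n - csum a m) < eps).
  { intros eps He. destruct (archi_inv (eps / (B + 1))) as [N HN]. apply Rdiv_lt_0_compat; lra.
    assert (W : forall n m, (max N0 N <= m)%nat -> (m <= n)%nat -> Cmod (csum a n - csum a m) < eps).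
    { intros n m H1 H2. eapply Rle_lt_trans. apply D; [lia|exact H2].
      specialize (HN m ltac:(lia)). generalize (Rinv_0_lt_compat _ (INR_S_pos n)). intros.
      apply Rle_lt_trans with (B * / INR (S m)). apply Rmult_le_compat_l; lra.
      generalize (Rinv_0_lt_compat _ (INR_S_pos m)). intros.
      apply (Rmult_lt_compat_r (B + 1)) in HN; [|lra]. unfold Rdiv in HN. rewrite Rmult_assoc, Rinv_l in HN; lra. }
    exists (max N0 N). intros n m Hn Hm. destruct (Nat.le_ge_cases m n). apply W; assumption.
    rewrite Cmod_sub_sym. apply W; assumption. }
  destruct (Rcomplete.R_complete (fun n => Re (csum a n))) as [x Hx].
  { intros eps He. destruct (CC eps He) as [N HN]. exists N. intros n m Hn Hm. eapply Rle_lt_trans; [|apply (HN n m Hn Hm)].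
    apply (re_le_Cmod (csum a n - csum a m)). }
  destruct (Rcomplete.R_complete (fun n => Im (csum a n))) as [y Hy].
  { intros eps He. destruct (CC eps He) as [N HN]. exists N. intros n m Hn Hm. eapply Rle_lt_trans; [|apply (HN n m Hn Hm)].
    apply (Im_le_Cmod (csum a n - csum a m)). }
  assert (L : is_csum a (x, y)).
  { intros eps He. destruct (Hx (eps/2) ltac:(lra)) as [N1 HN1]. destruct (Hy (eps/2) ltac:(lra)) as [N2 HN2].
    exists (max N1 N2). intros n Hn. specialize (HN1 n ltac:(lia)). specialize (HN2 n ltac:(lia)). unfold Rdist in *.
    eapply Rle_lt_trans. apply Cmod_le_ReIm.
    change (Re (csum a n - (x, y))%C) with (Re (csum a n) - x). change (Im (csum a n - (x, y))%C) with (Im (csum a n) - y). lra. }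
  rewrite (is_csum_Series _ _ L). split; [exact L|].
  intros m Hm. apply le_epsilon. intros e He. destruct (L e He) as [N HN]. specialize (HN (max N m) ltac:(lia)).
  eapply Rle_trans. apply (Cmod_sub_tri _ (csum a (max N m))). rewrite Cmod_sub_sym.
  specialize (D m (max N m) Hm ltac:(lia)).
  generalize (Rinv_0_lt_compat _ (INR_S_pos (max N m))). intros.
  assert (B * (/ INR (S m) - / INR (S (max N m))) <= B * / INR (S m)) by (apply Rmult_le_compat_l; lra). lra.
Qed.

Lemma derive_n_minus f g c R0 j : hol_ball f c R0 -> hol_ball g c R0 ->
  forall w, Cmod (w - c) < R0 -> C_derive_n (fun x => f x - g x)%C j w = (C_derive_n f j w - C_derive_n g j w)%C.
Proof.
  intros Hf Hg. induction j as [|j IH]; intros w Hw. reflexivity.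
  rewrite !derive_n_S. apply CD_derive. apply (CD_loc (fun x => C_derive_n f j x - C_derive_n g j x)%C _ w _ (R0 - Cmod (w - c))). lra.
  intros x Hx. symmetry. apply IH. generalize (Cmod_sub_tri x w c). lra.
  apply CD_minus; apply C_diff_iff; [apply (hol_ball_derive_n f c R0 j Hf w Hw)|apply (hol_ball_derive_n g c R0 j Hg w Hw)].
Qed.

Lemma derive_n_plus f g c R0 j : hol_ball f c R0 -> hol_ball g c R0 ->
  forall w, Cmod (w - c) < R0 -> C_derive_n (fun x => f x + g x)%C j w = (C_derive_n f j w + C_derive_n g j w)%C.
Proof.
  intros Hf Hg. induction j as [|j IH]; intros w Hw. reflexivity.
  rewrite !derive_n_S. apply CD_derive. apply (CD_loc (fun x => C_derive_n f j x + C_derive_n g j x)%C _ w _ (R0 - Cmod (w - c))). lra.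
  intros x Hx. symmetry. apply IH. generalize (Cmod_sub_tri x w c). lra.
  apply CD_plus; apply C_diff_iff; [apply (hol_ball_derive_n f c R0 j Hf w Hw)|apply (hol_ball_derive_n g c R0 j Hg w Hw)].
Qed.

Lemma derive_n_zero j w : C_derive_n (fun _ => RtoC 0) j w = RtoC 0.
Proof.
  revert w. induction j as [|j IH]; intros w. reflexivity. rewrite derive_n_S. apply CD_derive.
  apply (CD_ext (fun _ => RtoC 0)). intros x; symmetry; apply IH. apply CD_const.
Qed.

Lemma diff_csum (F : nat -> C -> C) n z : (forall i, (i < n)%nat -> C_differentiable (F i) z) ->
  C_differentiable (fun w => csum (fun i => F i w) n) z.
Proof.
  induction n; intros H; simpl. apply diff_const. apply diff_plus. apply IHn. intros; apply H; lia. apply H; lia.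
Qed.

Lemma derive_n_csum (F : nat -> C -> C) n c R0 j : (forall i, (i < n)%nat -> hol_ball (F i) c R0) ->
  forall w, Cmod (w - c) < R0 -> C_derive_n (fun x => csum (fun i => F i x) n) j w = csum (fun i => C_derive_n (F i) j w) n.
Proof.
  induction n; intros H w Hw; simpl. apply derive_n_zero.
  rewrite (derive_n_plus (fun x => csum (fun i => F i x) n) (F n) c R0); auto. rewrite IHn; auto.
  intros x Hx. apply diff_csum. intros i Hi. apply H; auto.
Qed.

(** Cauchy's estimates bound the second order errors of the terms by the same
    majorant as the terms, so the sum is differentiable with the expected
    derivative. *)
Lemma hol_series_normal (F : nat -> C -> C) z R0 B : 0 < R0 -> 0 <= B ->
  (forall i, hol_ball (F i) z R0) -> (forall i w, Cmod (w - z) < R0 -> Cmod (F i w) <= B * tele i) ->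
  C_differentiable (fun w => C_Series (fun i => F i w)) z.
Proof.
  intros HR HB H HF.
  set (B1 := 4 * B / R0). set (B2 := cauchy_const 2 * B / (R0 / 2) ^ 2).
  assert (Hc2 := cauchy_const_pos 2). assert (HR2 : 0 < (R0 / 2) ^ 2) by (apply pow_lt; lra).
  set (kc := cauchy_const 2) in *.
  assert (HB1 : 0 <= B1) by (apply Rdiv_le_0_compat; lra).
  assert (HB2 : 0 <= B2). { apply Rdiv_le_0_compat; [|lra]. apply Rmult_le_pos; lra. }
  assert (Hz : Cmod (z - z) < R0). { rewrite Cmod_sub_diag. lra. }
  destruct (csum_cv (fun i => C_derive (F i) z) 0 B1 HB1) as [Ld _].
  { intros i _. replace (B1 * tele i) with (4 * (B * tele i) / R0) by (unfold B1; field; lra).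
    apply Cauchy_1; auto. }
  exists (C_Series (fun i => C_derive (F i) z)). apply CD_eps. intros eps He.
  set (d := Rmin (R0 / 2) (eps / (4 * B2 + 1))).
  exists d. split. { unfold d. apply Rmin_case; [lra|]. apply Rdiv_lt_0_compat; lra. }
  intros w Hw. assert (Hw1 := Rlt_le_trans _ _ _ Hw (Rmin_l _ _)). assert (Hw2 := Rlt_le_trans _ _ _ Hw (Rmin_r _ _)).
  assert (Lw : is_csum (fun i => F i w) (C_Series (fun i => F i w))). { apply (csum_cv _ 0 B HB). intros i _. apply HF. lra. }
  assert (Lz : is_csum (fun i => F i z) (C_Series (fun i => F i z))). { apply (csum_cv _ 0 B HB). intros i _. apply HF. exact Hz. }
  set (h := (w - z)%C) in *.
  assert (T : forall i, Cmod (F i w - F i z - h * C_derive (F i) z) <= (4 * B2 * (Cmod h * Cmod h)) * tele i).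
  { intros i. assert (X := Taylor_bound 1 (F i) z h (B2 * tele i)).
    replace (z + h)%C with w in X by (unfold h; ring).
    replace (tpoly (F i) z 2 h) with (F i z + h * C_derive (F i) z)%C in X.
    2: { rewrite tpoly_S, tpoly_1, Cpow_1_r. change (C_derive_n (F i) 1 z) with (C_derive (F i) z).
         change (RtoC (INR (fact 1))) with (RtoC 1). field. }
    replace (F i w - F i z - h * C_derive (F i) z)%C with (F i w - (F i z + h * C_derive (F i) z))%C by ring.
    replace (4 * B2 * (Cmod h * Cmod h) * tele i) with (2 ^ 2 * (B2 * tele i) * Cmod h ^ 2) by ring.
    apply X. apply Rmult_le_pos; [lra|apply Rlt_le, tele_pos].
    intros t Ht.
    assert (Hx : Cmod (z + t * h - z) < R0 / 2).
    { replace (z + t * h - z)%C with (t * h)%C by ring. rewrite Cmod_mult, Cmod_R, Rabs_pos_eq by lra.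
      assert (t * Cmod h <= 1 * Cmod h) by (apply Rmult_le_compat_r; [apply Cmod_ge_0|lra]). lra. }
    split. apply (hol_at_ball (F i) z R0); [apply H|lra].
    replace (B2 * tele i) with (cauchy_const 2 * (B * tele i) / (R0 / 2) ^ 2) by (unfold B2, kc; field; lra).
    apply Cauchy_n. lra. apply (hol_ball_sub (F i) z R0); [apply H|lra].
    intros x Hx'. apply HF. generalize (Cmod_sub_tri x (z + t * h) z). lra. }
  apply Rle_trans with (4 * B2 * (Cmod h * Cmod h)).
  - assert (HL : is_csum (fun i => F i w + ((- (1)) * F i z + (- h) * C_derive (F i) z))%C
      (C_Series (fun i => F i w) + ((- (1)) * C_Series (fun i => F i z) + (- h) * C_Series (fun i => C_derive (F i) z)))%C).
    { assert (SC : forall l a b, is_csum a b -> is_csum (fun i => l * a i)%C (l * b)%C).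
      { intros l a b Hab e He'. destruct (Hab (e / (1 + Cmod l))) as [N HN]. apply Rdiv_lt_0_compat; generalize (Cmod_ge_0 l); lra.
        exists N. intros n Hn. specialize (HN n Hn). rewrite csum_scal. replace (l * csum a n - l * b)%C with (l * (csum a n - b))%C by ring.
        rewrite Cmod_mult. assert (Hl := Cmod_ge_0 l). apply (Rmult_lt_compat_l (1 + Cmod l)) in HN; [|lra].
        unfold Rdiv in HN. replace ((1 + Cmod l) * (e * / (1 + Cmod l))) with e in HN by (field; lra).
        generalize (Cmod_ge_0 (csum a n - b)). lra. }
      repeat apply is_csum_plus; auto. }
    replace (C_Series (fun i => F i w) - C_Series (fun i => F i z) - h * C_Series (fun i => C_derive (F i) z))%C with
      (C_Series (fun i => F i w) + ((- (1)) * C_Series (fun i => F i z) + (- h) * C_Series (fun i => C_derive (F i) z)))%C by ring.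
    apply (is_csum_bound _ _ _ HL). intros n.
    assert (Q : forall i, (0 <= i)%nat -> Cmod (F i w + ((- (1)) * F i z + (- h) * C_derive (F i) z)) <= (4 * B2 * (Cmod h * Cmod h)) * tele i).
    { intros i _. replace (F i w + ((- (1)) * F i z + (- h) * C_derive (F i) z))%C with (F i w - F i z - h * C_derive (F i) z)%C by ring. apply T. }
    assert (P0 : 0 <= 4 * B2 * (Cmod h * Cmod h)). { assert (Hh2 : 0 <= Cmod h * Cmod h) by (apply Rmult_le_pos; apply Cmod_ge_0). apply Rmult_le_pos; lra. }
    apply csum_total_bound; [exact P0|]. intros i. apply Q; lia.
  - rewrite <- Rmult_assoc. apply Rmult_le_compat_r; [apply Cmod_ge_0|].
    apply (Rmult_lt_compat_r (4 * B2 + 1)) in Hw2; [|lra]. unfold Rdiv in Hw2. rewrite (Rmult_assoc eps), Rinv_l in Hw2 by lra.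
    generalize (Cmod_ge_0 h). lra.
Qed.

(** Finitely many terms need only be differentiable at the point itself; this
    is where the summands evaluated close to the singular segment go. *)
Lemma hol_series (F : nat -> C -> C) z R0 B N0 : 0 < R0 -> 0 <= B ->
  (forall i, (i < N0)%nat -> C_differentiable (F i) z) ->
  (forall i, (N0 <= i)%nat -> hol_ball (F i) z R0) ->
  (forall i w, (N0 <= i)%nat -> Cmod (w - z) < R0 -> Cmod (F i w) <= B * tele i) ->
  C_differentiable (fun w => C_Series (fun i => F i w)) z.
Proof.
  intros HR HB H1 H2 H3.
  set (F2 := fun i w => if Compare_dec.lt_dec i N0 then RtoC 0 else F i w).
  set (F1 := fun i w => if Compare_dec.lt_dec i N0 then F i w else RtoC 0).
  apply (diff_loc (fun w => csum (fun i => F i w) N0 + C_Series (fun i => F2 i w))%C _ z R0 HR).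
  - intros w Hw. symmetry. apply is_csum_Series. apply (is_csum_ext (fun i => F1 i w + F2 i w)%C).
    + intros i. unfold F1, F2. destruct (Compare_dec.lt_dec i N0); ring.
    + apply is_csum_plus.
      * rewrite (csum_ext (fun i => F i w) (fun i => F1 i w)). apply is_csum_finite.
        intros i Hi. unfold F1. destruct (Compare_dec.lt_dec i N0); [lia|reflexivity].
        intros i Hi. unfold F1. destruct (Compare_dec.lt_dec i N0); [reflexivity|lia].
      * apply (csum_cv _ N0 B HB). intros i Hi. unfold F2. destruct (Compare_dec.lt_dec i N0); [lia|]. apply H3; assumption.
  - apply diff_plus. apply diff_csum. exact H1.
    apply (hol_series_normal F2 z R0 B HR HB).
    + intros i w Hw. unfold F2. destruct (Compare_dec.lt_dec i N0). apply diff_const. apply H2; [lia|exact Hw].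
    + intros i w Hw. unfold F2. destruct (Compare_dec.lt_dec i N0). rewrite Cmod_0. apply Rmult_le_pos; [exact HB|apply Rlt_le, tele_pos]. apply H3; [lia|exact Hw].
Qed.

(** The iterated derivative of a tail is bounded by the tail of the
    majorant. *)
Theorem derive_n_series (F : nat -> C -> C) c R0 B j : 0 < R0 -> 0 <= B ->
  (forall i, hol_ball (F i) c R0) -> (forall i w, Cmod (w - c) < R0 -> Cmod (F i w) <= B * tele i) ->
  is_csum (fun i => C_derive_n (F i) j c) (C_derive_n (fun w => C_Series (fun i => F i w)) j c).
Proof.
  intros HR HB H HF.
  assert (HS : hol_ball (fun w => C_Series (fun i => F i w)) c R0).
  { intros w Hw. apply (hol_series_normal F w (R0 - Cmod (w - c)) B); [lra|exact HB| |].
    - intros i. apply (hol_ball_sub (F i) c R0); [apply H|lra].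
    - intros i x Hx. apply HF. generalize (Cmod_sub_tri x w c). lra. }
  assert (Hc : Cmod (c - c) < R0). { rewrite Cmod_sub_diag. lra. }
  assert (HK := cauchy_const_pos j). assert (HRj : 0 < R0 ^ j) by (apply pow_lt; lra).
  set (K := cauchy_const j * B / R0 ^ j).
  assert (HK0 : 0 <= K). { apply Rdiv_le_0_compat; [|lra]. apply Rmult_le_pos; lra. }
  intros eps He. destruct (archi_inv (eps / (K + 1))) as [N HN]. apply Rdiv_lt_0_compat; lra.
  exists N. intros n Hn. specialize (HN n Hn). rewrite Cmod_sub_sym.
  assert (Hn' : hol_ball (fun x => csum (fun i => F i x) n) c R0). { intros w Hw. apply diff_csum. intros i Hi. apply H, Hw. }
  rewrite <- (derive_n_csum F n c R0 j) by auto.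
  rewrite <- (derive_n_minus _ _ c R0 j HS Hn' c Hc).
  eapply Rle_lt_trans. apply (Cauchy_n j _ c R0 (B * / INR (S n))); [exact HR| |].
  - intros w Hw. apply diff_minus; [apply HS|apply Hn']; exact Hw.
  - intros w Hw. apply (csum_cv (fun i => F i w) 0 B HB). intros i _. apply HF, Hw. lia.
  - replace (cauchy_const j * (B * / INR (S n)) / R0 ^ j) with (K * / INR (S n)).
    2: { unfold K. field. split; [|lra]. generalize (INR_S_pos n). lra. }
    generalize (Rinv_0_lt_compat _ (INR_S_pos n)). intros.
    apply (Rmult_lt_compat_r (K + 1)) in HN; [|lra]. unfold Rdiv in HN. rewrite Rmult_assoc, Rinv_l in HN by lra. lra.
Qed.

(** * The summands of the operator and its truncated series *)

(** The size of a function for the whole argument: a bound for [|z f z|] on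
    the half-plane [Re z < - 1/5]. That half-plane contains discs around all
    the [-m], of radius proportional to [m], and its points [-m + 1 / z] when
    [Re z <= 0]. *)
Definition decays (f : C -> C) (A : R) : Prop :=
  0 <= A /\ forall z, Re z < - (1 / 5) -> C_differentiable f z /\ Cmod z * Cmod (f z) <= A.

(** The part of the summand of index [m] that depends only on the Taylor
    coefficients of [f] at [-m]. *)
Definition jet_poly (k : nat) (f : C -> C) (m : nat) (z : C) : C :=
  csum (fun j => (C_derive_n f j (- INR m) / RtoC (INR (fact j)) * z ^ (k - j))%C) (S k).

Lemma csum_S a n : csum a (S n) = (csum a n + a n)%C.
Proof. reflexivity. Qed.

Lemma sum_n_m_csum (a : nat -> C) k : csum a (S k) = (a O + sum_n_m a 1 k)%C.
Proof.
  induction k as [|k IH].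
  - rewrite sum_n_m_zero by lia. exact (Cplus_comm (RtoC 0) (a O)).
  - rewrite sum_n_Sm by lia. change (csum a (S (S k))) with (csum a (S k) + a (S k))%C. rewrite IH.
    symmetry. exact (Cplus_assoc (a O) (sum_n_m a 1 k) (a (S k))).
Qed.

Lemma T_term_split k f z m : T_term k f z m = (- (z ^ k * f (/ z - INR m)) + jet_poly k f m z)%C.
Proof.
  unfold T_term, jet_poly. rewrite sum_n_m_csum.
  rewrite (sum_n_m_ext_loc _ (fun j => (C_derive_n f j (- INR m) / RtoC (INR (fact j)) * z ^ (k - j))%C)).
  - rewrite Nat.sub_0_r. change (C_derive_n f 0 (- INR m)) with (f (- INR m))%C. change (RtoC (INR (fact 0))) with (RtoC 1).
    set (s := sum_n_m _ 1 k). change C in (type of s). field.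
  - intros j _. assert (E : forall a b c : C, c <> RtoC 0 -> (a / c * b)%C = (b / c * a)%C) by (intros; field; assumption).
    apply E, fact_C_neq_0.
Qed.

Lemma T_term_Taylor k f z m : z <> RtoC 0 ->
  T_term k f z m = (- (z ^ k * (f (- INR m + / z) - tpoly f (- INR m) (S k) (/ z))))%C.
Proof.
  intros Hz. rewrite T_term_split. replace (- INR m + / z)%C with (/ z - INR m)%C by ring.
  replace (jet_poly k f m z) with (z ^ k * tpoly f (- INR m) (S k) (/ z))%C. ring.
  unfold tpoly. rewrite <- csum_scal. apply csum_ext. intros j Hj.
  replace (z ^ k)%C with (z ^ (k - j) * z ^ j)%C by (rewrite <- Cpow_add_r; f_equal; lia).
  rewrite Cpow_inv by exact Hz. field. split. apply fact_C_neq_0. apply Cpow_nz, Hz.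
Qed.

Lemma Re_neg_le_Cmod z : - Re z <= Cmod z.
Proof. generalize (re_le_Cmod z). intros H. generalize (Rle_abs (- Re z)). rewrite Rabs_Ropp. lra. Qed.

Lemma Re_le_Cmod z : Re z <= Cmod z.
Proof. generalize (re_le_Cmod z). generalize (Rle_abs (Re z)). lra. Qed.

Lemma Re_minus_INR z m : Re (z - INR m)%C = Re z - INR m.
Proof. unfold Cminus, Cplus, Copp, RtoC, Re; simpl. ring. Qed.

Lemma Re_minus_opp z m : Re (z - - RtoC m)%C = Re z + m.
Proof. unfold Cminus, Cplus, Copp, RtoC, Re; simpl. ring. Qed.

Lemma INR_S_ge1 i : 1 <= INR (S i).
Proof. rewrite S_INR. generalize (pos_INR i). lra. Qed.

Lemma decays_bound f A w r : decays f A -> 0 < r -> Re w < - (1/5) -> r <= Cmod w -> Cmod (f w) <= A / r.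
Proof.
  intros [HA H] Hr Hw Hrw. destruct (H w Hw) as [_ H'].
  apply (Rmult_le_reg_r r); [exact Hr|]. unfold Rdiv. rewrite Rmult_assoc, Rinv_l, Rmult_1_r by lra.
  assert (Cmod (f w) * r <= Cmod (f w) * Cmod w) by (apply Rmult_le_compat_l; [apply Cmod_ge_0|exact Hrw]). lra.
Qed.

Definition jet_const (j : nat) : R := cauchy_const j * 5 * (5 / 2) ^ j.

Lemma jet_const_pos j : 0 < jet_const j.
Proof. unfold jet_const. repeat apply Rmult_lt_0_compat; try apply cauchy_const_pos; try lra. apply pow_lt; lra. Qed.

Lemma jet_bound f A i j w : decays f A -> Cmod (w - (- INR (S i))) <= 2 * INR (S i) / 5 ->
  hol_at f w /\ Cmod (C_derive_n f j w) <= jet_const j * A / INR (S i) ^ (S j).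
Proof.
  intros HA Hw. set (m := INR (S i)) in *. assert (Hm : 1 <= m) by apply INR_S_ge1.
  assert (HR : forall x, Cmod (x - w) < 2 * m / 5 -> Re x < - (m / 5)).
  { intros x Hx. assert (E := Cmod_sub_tri x w (- m)).
    assert (E2 := Re_le_Cmod (x - - m)). rewrite Re_minus_opp in E2. lra. }
  assert (HB : hol_ball f w (2 * m / 5)). { intros x Hx. apply HA. specialize (HR x Hx). lra. }
  split. exists (2 * m / 5); split; [lra|exact HB].
  replace (jet_const j * A / m ^ S j) with (cauchy_const j * (A / (m / 5)) / (2 * m / 5) ^ j).
  - apply Cauchy_n; [lra|exact HB|]. intros x Hx. specialize (HR x Hx). apply (decays_bound f A); [exact HA|lra|lra|].
    generalize (Re_neg_le_Cmod x). lra.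
  - unfold jet_const. replace (2 * m / 5) with (m * / (5/2)) by field. rewrite Rpow_mult_distr, pow_inv. simpl.
    field. repeat split; try lra; apply pow_nonzero; lra.
Qed.

Lemma inv_pow_le_tele k i n : (1 <= k)%nat -> (S k <= n)%nat -> / INR (S i) ^ n <= 2 * tele i.
Proof.
  intros Hk Hn. assert (H := INR_S_ge1 i). eapply Rle_trans; [|apply inv_sq_le_tele].
  apply Rinv_le_contravar. apply Rmult_lt_0_compat; lra.
  replace (INR (S i) * INR (S i)) with (INR (S i) ^ 2) by ring. apply Rle_pow. exact H. lia.
Qed.

(** For [m |z| >= 5] the displacement [1 / z] stays in the disc of radius [m /
    5] around [-m], and the Taylor remainder of order [k] is of size [m ^
    (-k-2) / |z|]. *)
Lemma T_term_far k : (1 <= k)%nat -> exists K, 0 <= K /\ forall f A z i, decays f A -> 5 <= INR (S i) * Cmod z ->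
  Cmod (T_term k f z (S i)) <= K * A * tele i.
Proof.
  intros Hk. exists (2 ^ S k * jet_const (S k)).
  assert (HJ := jet_const_pos (S k)). assert (H2 : 0 < 2 ^ S k) by (apply pow_lt; lra).
  split. apply Rmult_le_pos; lra.
  intros f A z i HA Hz. set (m := INR (S i)) in *. assert (Hm : 1 <= m) by apply INR_S_ge1.
  assert (Hz0 : 0 < Cmod z). { destruct (Rle_lt_or_eq_dec 0 _ (Cmod_ge_0 z)) as [|E]; [assumption|]. rewrite <- E, Rmult_0_r in Hz. lra. }
  assert (Hzn : z <> RtoC 0) by (apply Cmod_gt_0; exact Hz0).
  assert (Hi : / Cmod z <= m / 5).
  { apply (Rmult_le_reg_r (Cmod z)); [exact Hz0|]. rewrite Rinv_l by lra. lra. }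
  rewrite T_term_Taylor by exact Hzn. rewrite Cmod_opp, Cmod_mult, Cmod_pow.
  set (S0 := jet_const (S k) * A / m ^ S (S k)).
  assert (Hmk : 0 < m ^ S (S k)) by (apply pow_lt; lra).
  assert (HS : 0 <= S0). { apply Rdiv_le_0_compat; [|lra]. apply Rmult_le_pos; [lra|apply HA]. }
  assert (HT := Taylor_bound k f (- m)%C (/ z) S0 HS).
  assert (HT' : Cmod (f (- m + / z)%C - tpoly f (- m) (S k) (/ z)) <= 2 ^ S k * S0 * Cmod (/ z) ^ S k).
  { apply HT. intros t Ht.
    assert (X : Cmod (- m + t * / z - - m) <= 2 * m / 5).
    { replace (- m + t * / z - - m)%C with (t * / z)%C by ring. rewrite Cmod_mult, Cmod_R, Rabs_pos_eq, Cmod_inv by (lra || exact Hzn).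
      assert (t * / Cmod z <= 1 * / Cmod z) by (apply Rmult_le_compat_r; [apply Rlt_le, Rinv_0_lt_compat; lra|lra]). lra. }
    apply (jet_bound f A i (S k)); assumption. }
  eapply Rle_trans. apply Rmult_le_compat_l. apply pow_le, Cmod_ge_0. exact HT'.
  rewrite Cmod_inv by exact Hzn.
  replace (Cmod z ^ k * (2 ^ S k * S0 * (/ Cmod z) ^ S k)) with (2 ^ S k * S0 * / Cmod z).
  2: { rewrite pow_inv. simpl. generalize S0; intros s0. field. repeat split; try (apply pow_nonzero); lra. }
  apply Rle_trans with (2 ^ S k * S0 * (m / 5)).
  apply Rmult_le_compat_l. apply Rmult_le_pos; lra. exact Hi.
  replace (2 ^ S k * S0 * (m / 5)) with (2 ^ S k * jet_const (S k) * A * (/ m ^ (S k) / 5)).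
  2: { unfold S0. simpl (m ^ S (S k)). simpl (m ^ S k). field. repeat split; try (apply pow_nonzero); lra. }
  apply Rmult_le_compat_l. apply Rmult_le_pos; [apply Rmult_le_pos; lra|apply HA].
  assert (B := inv_pow_le_tele k i (S k) Hk (le_n _)). fold m in B. generalize (tele_pos i). lra.
Qed.

(** For [m |z| < 5] the powers [|z| ^ (k-j)] compensate: each coefficient, of
    size [m ^ (-j-1)], contributes [m ^ (-k-1)]. *)
Lemma jet_poly_near k : (1 <= k)%nat -> exists K, 0 <= K /\ forall f A z i, decays f A -> INR (S i) * Cmod z < 5 ->
  Cmod (jet_poly k f (S i) z) <= K * A * tele i.
Proof.
  intros Hk.
  assert (G : forall n, (n <= S k)%nat -> exists K, 0 <= K /\ forall f A z i, decays f A -> INR (S i) * Cmod z < 5 ->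
    Cmod (csum (fun j => (C_derive_n f j (- INR (S i)) / RtoC (INR (fact j)) * z ^ (k - j))%C) n) <= K * A * tele i).
  { induction n as [|n IH]; intros Hn.
    - exists 0. split; [lra|]. intros f A z i HA _. simpl. rewrite Cmod_0. lra.
    - destruct (IH ltac:(lia)) as [K [HK IH']]. exists (K + jet_const n * 5 ^ (k - n) * 2).
      assert (HJ := jet_const_pos n). assert (H5 : 0 < 5 ^ (k - n)) by (apply pow_lt; lra).
      assert (HJ5 : 0 < jet_const n * 5 ^ (k - n)) by (apply Rmult_lt_0_compat; lra).
      split. lra.
      intros f A z i HA Hz. specialize (IH' f A z i HA Hz). rewrite csum_S.
      eapply Rle_trans. apply Cmod_triangle.
      set (m := INR (S i)) in *. assert (Hm : 1 <= m) by apply INR_S_ge1.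
      assert (J : Cmod (C_derive_n f n (- m)) <= jet_const n * A / m ^ S n).
      { apply (jet_bound f A i n). exact HA. fold m. rewrite Cmod_sub_diag. lra. }
      rewrite Cmod_mult, Cmod_pow, Cmod_div by apply fact_C_neq_0.
      assert (Hf : 1 <= Cmod (RtoC (INR (fact n)))).
      { rewrite Cmod_R, Rabs_pos_eq by apply pos_INR. apply (le_INR 1). apply lt_O_fact. }
      assert (J' : Cmod (C_derive_n f n (- m)) / Cmod (RtoC (INR (fact n))) <= jet_const n * A / m ^ S n).
      { eapply Rle_trans; [|exact J]. rewrite <- (Rmult_1_r (Cmod (C_derive_n f n (- m)))) at 2. apply Rmult_le_compat_l. apply Cmod_ge_0.
        rewrite <- Rinv_1. apply Rinv_le_contravar; lra. }
      assert (Hz' : Cmod z <= 5 / m). { apply (Rmult_le_reg_r m); [lra|]. unfold Rdiv. rewrite Rmult_assoc, Rinv_l by lra. lra. }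
      assert (P : Cmod z ^ (k - n) <= 5 ^ (k - n) / m ^ (k - n)).
      { replace (5 ^ (k - n) / m ^ (k - n)) with ((5 / m) ^ (k - n)). apply pow_incr. split; [apply Cmod_ge_0|exact Hz'].
        unfold Rdiv. rewrite Rpow_mult_distr, pow_inv. reflexivity. }
      assert (Q : Cmod (C_derive_n f n (- m)) / Cmod (RtoC (INR (fact n))) * Cmod z ^ (k - n) <=
         (jet_const n * A / m ^ S n) * (5 ^ (k - n) / m ^ (k - n))).
      { apply Rmult_le_compat; [|apply pow_le, Cmod_ge_0|exact J'|exact P]. apply Rdiv_le_0_compat; [apply Cmod_ge_0|lra]. }
      assert (W : (jet_const n * A / m ^ S n) * (5 ^ (k - n) / m ^ (k - n)) = jet_const n * 5 ^ (k - n) * A * / m ^ S k).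
      { replace (S k) with (S n + (k - n))%nat by lia. rewrite pow_add. field. split; apply pow_nonzero; lra. }
      rewrite W in Q.
      assert (B := inv_pow_le_tele k i (S k) Hk (le_n _)). fold m in B.
      assert (V : jet_const n * 5 ^ (k - n) * A * / m ^ S k <= jet_const n * 5 ^ (k - n) * A * (2 * tele i)).
      { apply Rmult_le_compat_l; [|exact B]. apply Rmult_le_pos; [lra|apply HA]. }
      replace ((K + jet_const n * 5 ^ (k - n) * 2) * A * tele i) with (K * A * tele i + jet_const n * 5 ^ (k - n) * A * (2 * tele i)) by ring.
      lra. }
  exact (G (S k) (le_n _)).
Qed.

Lemma jet_poly_diff k f m z : C_differentiable (jet_poly k f m) z.
Proof.
  unfold jet_poly. apply (diff_csum (fun j z => (C_derive_n f j (- INR m) / RtoC (INR (fact j)) * z ^ (k - j))%C)).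
  intros i _. apply diff_mult. apply diff_const. apply diff_pow, diff_id.
Qed.

Lemma slash_diff k f (m : nat) z : z <> RtoC 0 -> C_differentiable f (/ z - INR m)%C ->
  C_differentiable (fun w => w ^ k * f (/ w - INR m))%C z.
Proof.
  intros Hz H. apply diff_mult. apply diff_pow, diff_id. apply (diff_comp f (fun w => / w - INR m)%C). exact H.
  apply diff_minus. apply diff_inv. exact Hz. apply diff_id. apply diff_const.
Qed.

Lemma T_term_diff k f m z : z <> RtoC 0 -> C_differentiable f (/ z - INR m)%C -> C_differentiable (fun w => T_term k f w m) z.
Proof.
  intros Hz H. apply (diff_ext (fun w => - (w ^ k * f (/ w - INR m)) + jet_poly k f m w)%C). intros; symmetry; apply T_term_split.
  apply diff_plus. apply diff_opp, slash_diff; assumption. apply jet_poly_diff.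
Qed.

Definition T_rest_term (k : nat) (f : C -> C) (e : nat -> bool) (z : C) (i : nat) : C :=
  (T_term k f z (S i) + if e (S i) then z ^ k * f (/ z - INR (S i)) else 0)%C.
(** The series of [T_op] with [f (1 / z - m)] removed from the summands of
    index [m] selected by [e]; their polynomial parts stay, so that the series
    still converges. *)
Definition T_rest (k : nat) (f : C -> C) (e : nat -> bool) (z : C) : C := C_Series (T_rest_term k f e z).

Lemma exists_far z : z <> RtoC 0 -> exists N, forall i, (N <= i)%nat -> 5 <= INR (S i) * Cmod z.
Proof.
  intros Hz. assert (H : 0 < Cmod z) by (apply Cmod_gt_0; exact Hz).
  destruct (archi_inv (Cmod z / 5)) as [N HN]; [lra|]. exists N. intros i Hi. specialize (HN i Hi).
  assert (P := INR_S_pos i). apply (Rmult_lt_compat_l (INR (S i))) in HN; [|exact P]. rewrite Rinv_r in HN by lra. lra.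
Qed.

Lemma T_rest_conv k f A e M z : (1 <= k)%nat -> decays f A -> z <> RtoC 0 -> (forall m, (M <= m)%nat -> e m = false) ->
  is_csum (T_rest_term k f e z) (T_rest k f e z).
Proof.
  intros Hk HA Hz He. destruct (exists_far z Hz) as [N HN]. destruct (T_term_far k Hk) as [K [HK HT]].
  apply (csum_cv _ (max N M) (K * A)). apply Rmult_le_pos; [exact HK|apply HA].
  intros i Hi. unfold T_rest_term. rewrite He by lia. rewrite Cplus_0_r. apply HT. exact HA. apply HN; lia.
Qed.

Lemma T_conv k f A z : (1 <= k)%nat -> decays f A -> z <> RtoC 0 -> is_csum (fun i => T_term k f z (S i)) (T_op k f z).
Proof.
  intros Hk HA Hz. destruct (exists_far z Hz) as [N HN]. destruct (T_term_far k Hk) as [K [HK HT]].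
  apply (csum_cv _ N (K * A)). apply Rmult_le_pos; [exact HK|apply HA].
  intros i Hi. apply HT. exact HA. apply HN; lia.
Qed.

Lemma T_rest_eq k f A e M z : (1 <= k)%nat -> decays f A -> z <> RtoC 0 -> (forall m, (M <= m)%nat -> e m = false) ->
  T_rest k f e z = (T_op k f z + csum (fun i => if e (S i) then z ^ k * f (/ z - INR (S i)) else 0)%C M)%C.
Proof.
  intros Hk HA Hz He. apply is_csum_Series. apply is_csum_plus. apply (T_conv k f A); assumption.
  apply is_csum_finite. intros i Hi. rewrite He by lia. reflexivity.
Qed.

(** [r] times the number of indices [m] in [1, ..., n] with [m * r < 5]. *)
Fixpoint near_sum (r : R) (n : nat) : R :=
  match n with O => 0 | S n => near_sum r n + (if Rlt_dec (INR (S n) * r) 5 then r else 0) end.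

Lemma near_sum_le r n : 0 <= r -> near_sum r n <= 5 /\ near_sum r n <= INR n * r.
Proof.
  intros Hr. induction n as [|n [I1 I2]]. simpl; lra.
  change (near_sum r (S n)) with (near_sum r n + (if Rlt_dec (INR (S n) * r) 5 then r else 0)).
  rewrite S_INR. destruct (Rlt_dec _ 5); rewrite ?S_INR in *; lra.
Qed.

(** The summands with [m |z| < 5] that are not removed number at most [5 /
    |z|], and each contributes at most [|z| ^ k A']: since [k >= 1] this stays
    bounded as [z] tends to [0]. *)
Theorem T_rest_bound k : (1 <= k)%nat -> exists K, 0 <= K /\ forall f A A' e M z, decays f A -> 0 <= A' -> z <> RtoC 0 ->
  (forall m, (M <= m)%nat -> e m = false) ->
  (forall i, e (S i) = true -> INR (S i) * Cmod z < 5) ->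
  (forall i, e (S i) = false -> INR (S i) * Cmod z < 5 -> Cmod (f (/ z - INR (S i))%C) <= A') ->
  Cmod (T_rest k f e z) <= K * (A + A').
Proof.
  intros Hk. destruct (T_term_far k Hk) as [K1 [HK1 HT]]. destruct (jet_poly_near k Hk) as [K2 [HK2 HP]].
  assert (H5 : 0 < 5 ^ k) by (apply pow_lt; lra).
  exists (K1 + K2 + 5 ^ k). split. lra.
  intros f A A' e M z HA HA' Hz HM He1 He2. assert (HA0 : 0 <= A) by apply HA.
  assert (Hr := Cmod_ge_0 z).
  apply (is_csum_bound _ _ _ (T_rest_conv k f A e M z Hk HA Hz HM)). intros n.
  (* [u] has the majorant [tele]; [v] consists of the values of [f] that stay
     although [m |z| < 5]. *)
  set (u := fun i => if Rlt_dec (INR (S i) * Cmod z) 5 then jet_poly k f (S i) z else T_term k f z (S i)).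
  set (v := fun i => if Rlt_dec (INR (S i) * Cmod z) 5 then (if e (S i) then RtoC 0 else (- (z ^ k * f (/ z - INR (S i))))%C) else RtoC 0).
  rewrite (csum_ext _ (fun i => u i + v i)%C).
  2: { intros i _. unfold T_rest_term, u, v. destruct (Rlt_dec _ 5) as [H|H].
       - rewrite T_term_split. destruct (e (S i)); ring.
       - destruct (e (S i)) eqn:E; [|ring]. exfalso; apply H, He1, E. }
  rewrite csum_plus. eapply Rle_trans. apply Cmod_triangle.
  assert (Hu : Cmod (csum u n) <= (K1 + K2) * A).
  { apply csum_total_bound. apply Rmult_le_pos; lra. intros i. unfold u. assert (Hb := tele_pos i).
    assert (0 <= A * tele i) by (apply Rmult_le_pos; lra).
    assert (0 <= K1 * (A * tele i)) by (apply Rmult_le_pos; lra). assert (0 <= K2 * (A * tele i)) by (apply Rmult_le_pos; lra).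
    destruct (Rlt_dec _ 5) as [H'|H'].
    - eapply Rle_trans. apply HP; eassumption. lra.
    - eapply Rle_trans. apply HT; [eassumption|lra]. lra. }
  assert (Hv : Cmod (csum v n) <= 5 ^ (k - 1) * A' * near_sum (Cmod z) n).
  { clear Hu. assert (H5' : 0 < 5 ^ (k - 1)) by (apply pow_lt; lra). induction n as [|n IH]. simpl. rewrite Cmod_0. lra.
    change (csum v (S n)) with (csum v n + v n)%C.
    change (near_sum (Cmod z) (S n)) with (near_sum (Cmod z) n + (if Rlt_dec (INR (S n) * Cmod z) 5 then Cmod z else 0)).
    rewrite Rmult_plus_distr_l. eapply Rle_trans. apply Cmod_triangle. apply Rplus_le_compat. exact IH.
    unfold v. destruct (Rlt_dec _ 5) as [H'|H'].
    - destruct (e (S n)) eqn:E. rewrite Cmod_0. apply Rmult_le_pos; [apply Rmult_le_pos; lra|exact Hr].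
      rewrite Cmod_opp, Cmod_mult, Cmod_pow.
      assert (Hz5 : Cmod z <= 5). { assert (1 * Cmod z <= INR (S n) * Cmod z) by (apply Rmult_le_compat_r; [exact Hr|apply INR_S_ge1]). lra. }
      replace k with (S (k - 1)) at 1 by lia. simpl pow.
      replace (5 ^ (k - 1) * A' * Cmod z) with ((Cmod z * 5 ^ (k - 1)) * A') by ring.
      apply Rmult_le_compat; [apply Rmult_le_pos; [exact Hr|apply pow_le, Hr]|apply Cmod_ge_0| |apply He2; assumption].
      apply Rmult_le_compat_l; [exact Hr|]. apply pow_incr. lra.
    - rewrite Cmod_0. lra. }
  assert (Hs := proj1 (near_sum_le (Cmod z) n Hr)).
  assert (5 ^ (k - 1) * A' * near_sum (Cmod z) n <= 5 ^ (k - 1) * A' * 5).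
  { apply Rmult_le_compat_l; [|exact Hs]. apply Rmult_le_pos; [apply pow_le; lra|exact HA']. }
  replace (5 ^ (k - 1) * A' * 5) with (5 ^ k * A') in H by (replace k with (S (k - 1)) at 1 by lia; simpl; ring).
  assert (0 <= (K1 + K2) * A') by (apply Rmult_le_pos; lra). assert (0 <= 5 ^ k * A) by (apply Rmult_le_pos; lra). lra.
Qed.

Theorem T_rest_diff k f A e M z : (1 <= k)%nat -> decays f A -> z <> RtoC 0 -> (forall m, (M <= m)%nat -> e m = false) ->
  (forall i, e (S i) = false -> C_differentiable f (/ z - INR (S i))%C) ->
  C_differentiable (T_rest k f e) z.
Proof.
  intros Hk HA Hz HM He. assert (Hr : 0 < Cmod z) by (apply Cmod_gt_0; exact Hz).
  destruct (T_term_far k Hk) as [K [HK HT]].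
  assert (Hhalf : (z / 2)%C <> RtoC 0). { intros E. apply Hz. replace z with (z / 2 * 2)%C by (field; intros E0; apply RtoC_inj in E0; lra). rewrite E; ring. }
  destruct (exists_far (z / 2)%C Hhalf) as [N HN].
  assert (Hm2 : Cmod (z / 2) = Cmod z / 2). { rewrite Cmod_div, Cmod_R, Rabs_pos_eq; try lra. intros E0; apply RtoC_inj in E0; lra. }
  rewrite Hm2 in HN.
  assert (Hball : forall i w, (N <= i)%nat -> Cmod (w - z) < Cmod z / 2 -> 5 <= INR (S i) * Cmod w /\ w <> RtoC 0).
  { intros i w Hi Hw. assert (Cmod z <= Cmod (z - w) + Cmod w). { replace z with ((z - w) + w)%C at 1 by ring. apply Cmod_triangle. }
    rewrite Cmod_sub_sym in H. assert (Hw2 : Cmod z / 2 <= Cmod w) by lra. split.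
    eapply Rle_trans. apply (HN i Hi). apply Rmult_le_compat_l; [apply Rlt_le, INR_S_pos|exact Hw2].
    apply Cmod_gt_0; lra. }
  unfold T_rest. apply (hol_series (fun i w => T_rest_term k f e w i) z (Cmod z / 2) (K * A) (max N M)).
  - lra.
  - apply Rmult_le_pos; [exact HK|apply HA].
  - intros i _. unfold T_rest_term. destruct (e (S i)) eqn:E.
    + apply (diff_ext (jet_poly k f (S i))). intros w. rewrite T_term_split. ring. apply jet_poly_diff.
    + apply diff_plus. apply T_term_diff. exact Hz. apply He, E. apply diff_const.
  - intros i Hi w Hw. destruct (Hball i w ltac:(lia) Hw) as [H5 Hw0].
    unfold T_rest_term. rewrite HM by lia. apply diff_plus; [|apply diff_const]. apply T_term_diff. exact Hw0.
    apply HA. rewrite Re_minus_INR. assert (X := Re_le_Cmod (/ w)). rewrite Cmod_inv in X by exact Hw0.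
    assert (Hwp : 0 < Cmod w) by (apply Cmod_gt_0; exact Hw0).
    assert (/ Cmod w <= INR (S i) / 5). { apply (Rmult_le_reg_r (Cmod w)); [exact Hwp|]. rewrite Rinv_l; lra. }
    generalize (INR_S_ge1 i). lra.
  - intros i w Hi Hw. unfold T_rest_term. rewrite HM by lia. rewrite Cplus_0_r. apply HT. exact HA. apply (Hball i w); [lia|exact Hw].
Qed.

(** When [Re (1 / v) <= 0], the points [1 / v - m] are at distance at least
    [m] from [0], so that the terms are dominated uniformly in [v]. *)
Lemma T_term_left k : (1 <= k)%nat -> exists K, 0 <= K /\ forall f A v i, decays f A -> Re (/ v)%C <= 0 ->
  Cmod (T_term k f v (S i)) <= K * A * tele i.
Proof.
  intros Hk. destruct (T_term_far k Hk) as [K1 [HK1 HT]]. destruct (jet_poly_near k Hk) as [K2 [HK2 HP]].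
  assert (H5 : 0 < 5 ^ k) by (apply pow_lt; lra).
  exists (K1 + K2 + 5 ^ k * 2). split; [lra|]. intros f A v i HA Hv. assert (HA0 : 0 <= A) by apply HA.
  assert (Hb := tele_pos i). assert (P : 0 <= A * tele i) by (apply Rmult_le_pos; lra).
  assert (0 <= K1 * (A * tele i)) by (apply Rmult_le_pos; lra). assert (0 <= K2 * (A * tele i)) by (apply Rmult_le_pos; lra).
  assert (0 <= 5 ^ k * (A * tele i)) by (apply Rmult_le_pos; lra).
  destruct (Rlt_dec (INR (S i) * Cmod v) 5) as [H'|H'].
  - rewrite T_term_split. eapply Rle_trans. apply Cmod_triangle.
    assert (B := HP f A v i HA H').
    rewrite Cmod_opp, Cmod_mult, Cmod_pow. set (m := INR (S i)) in *. assert (Hm : 1 <= m) by apply INR_S_ge1.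
    assert (F : Cmod (f (/ v - m)%C) <= A / m).
    { apply (decays_bound f A). exact HA. lra. unfold m; rewrite Re_minus_INR; fold m; lra.
      assert (X := Re_neg_le_Cmod (/ v - m)%C). unfold m in X at 1. rewrite Re_minus_INR in X. fold m in X. lra. }
    assert (Hz' : Cmod v <= 5 / m). { apply (Rmult_le_reg_r m); [lra|]. unfold Rdiv. rewrite Rmult_assoc, Rinv_l by lra. lra. }
    assert (Pk : Cmod v ^ k <= 5 ^ k / m ^ k).
    { replace (5 ^ k / m ^ k) with ((5 / m) ^ k). apply pow_incr. split; [apply Cmod_ge_0|exact Hz'].
      unfold Rdiv. rewrite Rpow_mult_distr, pow_inv. reflexivity. }
    assert (Q : Cmod v ^ k * Cmod (f (/ v - m)%C) <= (5 ^ k / m ^ k) * (A / m)).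
    { apply Rmult_le_compat; auto. apply pow_le, Cmod_ge_0. apply Cmod_ge_0. }
    replace ((5 ^ k / m ^ k) * (A / m)) with (5 ^ k * A * / m ^ S k) in Q.
    2: { simpl. field. split; [lra|apply pow_nonzero; lra]. }
    assert (B2 := inv_pow_le_tele k i (S k) Hk (le_n _)). fold m in B2.
    assert (5 ^ k * A * / m ^ S k <= 5 ^ k * A * (2 * tele i)). { apply Rmult_le_compat_l; [apply Rmult_le_pos; lra|exact B2]. }
    lra.
  - eapply Rle_trans. apply HT; [eassumption|lra]. lra.
Qed.

Lemma csum_T_cont k f A n : (1 <= k)%nat -> decays f A -> forall eps, 0 < eps -> exists d, 0 < d /\
  forall v, Re (/ v)%C <= 0 -> Cmod v < d -> Cmod (csum (fun i => T_term k f v (S i)) n - csum (fun i => T_term k f 0 (S i)) n) < eps.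
Proof.
  intros Hk HA. induction n as [|n IH]; intros eps He.
  - exists 1. split; [lra|]. intros v _ _. simpl. rewrite Cmod_sub_diag. exact He.
  - destruct (IH (eps / 3) ltac:(lra)) as [d1 [Hd1 H1]].
    destruct (diff_cont _ _ (jet_poly_diff k f (S n) 0) (eps / 3) ltac:(lra)) as [d2 [Hd2 H2]].
    set (d3 := eps / 3 / (A + 1)). assert (HA0 : 0 <= A) by apply HA. assert (Hd3 : 0 < d3) by (unfold d3; apply Rdiv_lt_0_compat; lra).
    exists (Rmin (Rmin d1 d2) (Rmin d3 1)). split. repeat apply Rmin_case; lra.
    intros v Hv Hvd.
    assert (D1 := Rlt_le_trans _ _ _ Hvd (Rle_trans _ _ _ (Rmin_l _ _) (Rmin_l _ _))).
    assert (D2 := Rlt_le_trans _ _ _ Hvd (Rle_trans _ _ _ (Rmin_l _ _) (Rmin_r _ _))).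
    assert (D3 := Rlt_le_trans _ _ _ Hvd (Rle_trans _ _ _ (Rmin_r _ _) (Rmin_l _ _))).
    assert (D4 := Rlt_le_trans _ _ _ Hvd (Rle_trans _ _ _ (Rmin_r _ _) (Rmin_r _ _))).
    rewrite !csum_S, !T_term_split.
    replace (RtoC 0 ^ k)%C with (RtoC 0). 2: { replace k with (S (k - 1)) by lia. rewrite Cpow_S. ring. }
    specialize (H1 v Hv D1). specialize (H2 v). replace (v - 0)%C with v in H2 by ring. specialize (H2 D2).
    set (X := csum (fun i => T_term k f v (S i)) n) in *. set (Y := csum (fun i => T_term k f 0 (S i)) n) in *.
    replace (X + (- (v ^ k * f (/ v - INR (S n))) + jet_poly k f (S n) v) - (Y + (- (RtoC 0 * f (/ RtoC 0 - INR (S n))) + jet_poly k f (S n) (RtoC 0))))%C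
      with ((X - Y) + ((jet_poly k f (S n) v - jet_poly k f (S n) (RtoC 0)) + - (v ^ k * f (/ v - INR (S n)))))%C by ring.
    assert (F : Cmod (f (/ v - INR (S n))%C) <= A / 1).
    { assert (Hm := INR_S_ge1 n). apply (decays_bound f A). exact HA. lra. rewrite Re_minus_INR; lra.
      assert (Xx := Re_neg_le_Cmod (/ v - INR (S n))%C). rewrite Re_minus_INR in Xx. lra. }
    rewrite Rdiv_1_r in F.
    assert (V : Cmod v ^ k <= Cmod v). { replace k with (S (k - 1)) by lia. simpl. rewrite <- (Rmult_1_r (Cmod v)) at 3. apply Rmult_le_compat_l. apply Cmod_ge_0.
      rewrite <- (pow1 (k - 1)). apply pow_incr. split; [apply Cmod_ge_0|lra]. }
    assert (W : Cmod (v ^ k * f (/ v - INR (S n))%C) < eps / 3).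
    { rewrite Cmod_mult, Cmod_pow. apply Rle_lt_trans with (Cmod v * A). apply Rmult_le_compat; auto. apply pow_le, Cmod_ge_0. apply Cmod_ge_0.
      assert (Cmod v * (A + 1) < d3 * (A + 1)) by (apply Rmult_lt_compat_r; lra). unfold d3 in H. replace (eps / 3 / (A + 1) * (A + 1)) with (eps / 3) in H by (field; lra).
      generalize (Cmod_ge_0 v). lra. }
    eapply Rle_lt_trans. apply Cmod_triangle.
    assert (Cmod ((jet_poly k f (S n) v - jet_poly k f (S n) (RtoC 0)) + - (v ^ k * f (/ v - INR (S n))))%C <= Cmod (jet_poly k f (S n) v - jet_poly k f (S n) (RtoC 0))%C + Cmod (v ^ k * f (/ v - INR (S n)))%C).
    { eapply Rle_trans. apply Cmod_sub_le. lra. } lra.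
Qed.

Lemma Re_inv_0 : Re (/ RtoC 0)%C <= 0.
Proof. unfold Cinv, RtoC, Re; simpl. unfold Rdiv. rewrite Rmult_0_l. lra. Qed.

(** With the convention [/ 0 = 0] the formula for [T_op k f 0] gives the sum
    of the Taylor coefficients of order [k], which is the limit of [T_op k f
    v] within the left half-plane. *)
Theorem T_cont_0 k f A : (1 <= k)%nat -> decays f A -> forall eps, 0 < eps -> exists d, 0 < d /\
  forall v, Re (/ v)%C <= 0 -> Cmod v < d -> Cmod (T_op k f v - T_op k f 0) < eps.
Proof.
  intros Hk HA eps He. destruct (T_term_left k Hk) as [K [HK HT]]. assert (HA0 : 0 <= A) by apply HA.
  assert (HKA : 0 <= K * A) by (apply Rmult_le_pos; lra).
  destruct (archi_inv (eps / 3 / (K * A + 1))) as [N HN]. repeat apply Rdiv_lt_0_compat; lra.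
  specialize (HN N (le_n _)).
  assert (Tail : forall v, Re (/ v)%C <= 0 -> Cmod (T_op k f v - csum (fun i => T_term k f v (S i)) N) < eps / 3).
  { intros v Hv. eapply Rle_lt_trans. apply (csum_cv (fun i => T_term k f v (S i)) 0 (K * A) HKA). intros i _. apply HT; assumption. lia.
    apply (Rmult_lt_compat_r (K * A + 1)) in HN; [|lra]. unfold Rdiv in HN. rewrite (Rmult_assoc (eps * / 3)), Rinv_l in HN by lra.
    generalize (Rinv_0_lt_compat _ (INR_S_pos N)). lra. }
  destruct (csum_T_cont k f A N Hk HA (eps / 3) ltac:(lra)) as [d [Hd H]].
  exists d. split; [exact Hd|]. intros v Hv Hvd. specialize (H v Hv Hvd).
  assert (T1 := Tail v Hv). assert (T2 := Tail (RtoC 0) Re_inv_0). rewrite Cmod_sub_sym in T2.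
  assert (E1 := Cmod_sub_tri (T_op k f v) (csum (fun i => T_term k f v (S i)) N) (T_op k f 0)).
  assert (E2 := Cmod_sub_tri (csum (fun i => T_term k f v (S i)) N) (csum (fun i => T_term k f 0 (S i)) N) (T_op k f 0)). lra.
Qed.

Lemma T_left_bound k : (1 <= k)%nat -> exists K, 0 <= K /\ forall f A v, decays f A -> Re (/ v)%C <= 0 -> Cmod (T_op k f v) <= K * A.
Proof.
  intros Hk. destruct (T_term_left k Hk) as [K [HK HT]]. exists K. split; [exact HK|]. intros f A v HA Hv.
  assert (HKA : 0 <= K * A) by (apply Rmult_le_pos; [exact HK|apply HA]).
  apply (is_csum_bound (fun i => T_term k f v (S i))). apply (csum_cv _ 0 (K * A) HKA). intros i _. apply HT; assumption.
  intros n. apply csum_total_bound; [exact HKA|]. intros i. apply HT; assumption.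
Qed.

(** * Bol's identity and the contraction of the operator *)

Lemma hol_at_open f p : hol_at f p -> exists d, 0 < d /\ forall w, Cmod (w - p) < d -> hol_at f w.
Proof. intros [r [Hr H]]. exists r. split; [exact Hr|]. intros w Hw. apply (hol_at_ball f p r); assumption. Qed.

Definition mobius_ok (f : C -> C) (a : C) (z : C) := z <> RtoC 0 /\ hol_at f (/ z - a)%C.

Lemma mobius_ok_open f a z : mobius_ok f a z -> exists d, 0 < d /\ forall w, Cmod (w - z) < d -> mobius_ok f a w.
Proof.
  intros [Hz H]. destruct (hol_at_open _ _ H) as [d [Hd H']].
  assert (Dz : C_differentiable (fun w => / w - a)%C z). { apply diff_minus. apply diff_inv. exact Hz. apply diff_id. apply diff_const. }
  destruct (diff_cont _ _ Dz d Hd) as [d1 [Hd1 H1]].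
  assert (Hm : 0 < Cmod z) by (apply Cmod_gt_0; exact Hz).
  exists (Rmin d1 (Cmod z)). split. apply Rmin_case; lra. intros w Hw. split.
  - intros ->. assert (X := Rlt_le_trans _ _ _ Hw (Rmin_r _ _)). rewrite Cmod_sub_sym in X. replace (z - 0)%C with z in X by ring. lra.
  - apply H'. apply H1. eapply Rlt_le_trans. exact Hw. apply Rmin_l.
Qed.

Lemma mobius_ok_hol f a z k : mobius_ok f a z -> hol_at (fun w => w ^ k * f (/ w - a))%C z.
Proof.
  intros H. destruct (mobius_ok_open f a z H) as [d [Hd H']]. exists d. split; [exact Hd|].
  intros w Hw. destruct (H' w Hw) as [Hw0 Hh]. apply diff_mult. apply diff_pow, diff_id.
  apply (diff_comp f (fun w => / w - a)%C). apply hol_at_diff, Hh. apply diff_minus. apply diff_inv. exact Hw0. apply diff_id. apply diff_const.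
Qed.

(** Leibniz formula for a product with the identity, the only case needed for
    the induction in [Bol]. *)
Lemma leibniz_id n : forall G z, hol_at G z ->
  C_derive_n (fun w => w * G w)%C (S n) z = (z * C_derive_n G (S n) z + INR (S n) * C_derive_n G n z)%C.
Proof.
  induction n as [|n IH]; intros G z H.
  - rewrite derive_n_S. apply CD_derive. eapply CD_val. apply (CD_mult (fun w => w) G). apply CD_id. apply C_diff_iff, hol_at_diff, H.
    change (C_derive_n G 1 z) with (C_derive G z). change (C_derive_n G 0 z) with (G z). change (INR 1) with 1.
    change (1 * G z + z * C_derive G z = z * C_derive G z + 1 * G z)%C. ring.
  - rewrite derive_n_S. apply CD_derive. destruct (hol_at_open _ _ H) as [d [Hd H']].
    apply (CD_loc (fun z => z * C_derive_n G (S n) z + INR (S n) * C_derive_n G n z)%C _ z _ d Hd).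
    + intros w Hw. symmetry. apply IH, H', Hw.
    + eapply CD_val. apply (CD_plus (fun z => z * C_derive_n G (S n) z)%C (fun z => INR (S n) * C_derive_n G n z)%C).
      apply (CD_mult (fun z => z) (C_derive_n G (S n))). apply CD_id. apply C_diff_iff, hol_at_diff, hol_at_derive_n, H.
      apply (CD_mult (fun _ => RtoC (INR (S n))) (C_derive_n G n)). apply CD_const. apply C_diff_iff, hol_at_diff, hol_at_derive_n, H.
      rewrite <- !derive_n_S. rewrite (S_INR (S n)), RtoC_plus.
      set (a := C_derive_n G (S (S n)) z). set (b := C_derive_n G (S n) z). set (c := RtoC (INR (S n))). set (e := C_derive_n G n z).
      change (1 * b + z * a + (0 * e + c * b) = z * a + (c + 1) * b)%C. ring.
Qed.

(** Derivation of order [k + 1] turns the action of the inversion with the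
    factor [w ^ k] into the one with the factor [w ^ (-k-2)]. The induction on
    [k] multiplies by one more factor [w]. *)
Theorem Bol k : forall f a z, mobius_ok f a z ->
  C_derive_n (fun w => w ^ k * f (/ w - a))%C (S k) z =
  ((- (1)) ^ (S k) * (/ z) ^ (S (S k)) * C_derive_n f (S k) (/ z - a))%C.
Proof.
  induction k as [|k IH]; intros f a z H; destruct H as [Hz H0].
  - rewrite derive_n_S. apply CD_derive. apply (CD_ext (fun w => f (/ w - a)%C)).
    { intros w. change (C_derive_n (fun w0 => w0 ^ 0 * f (/ w0 - a))%C 0 w) with (w ^ 0 * f (/ w - a))%C. change (w ^ 0)%C with (RtoC 1). ring. }
    eapply CD_val. apply (CD_comp f (fun w => / w - a)%C). apply C_diff_iff, hol_at_diff, H0.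
    apply CD_minus. apply CD_inv_id. exact Hz. apply CD_const.
    change (C_derive_n f 1) with (C_derive f). set (b := C_derive f (/ z - a)). simpl Cpow.
    change ((- / (z * z) - 0) * b = - (1) * 1 * (/ z * (/ z * 1)) * b)%C. field. exact Hz.
  - assert (Hok : mobius_ok f a z) by (split; assumption).
    assert (E1 : C_derive_n (fun w => w ^ S k * f (/ w - a))%C (S (S k)) z = C_derive_n (fun w => w * (w ^ k * f (/ w - a)))%C (S (S k)) z).
    { f_equal. apply functional_extensionality. intros w. rewrite Cpow_S. ring. }
    rewrite E1. clear E1. rewrite leibniz_id by (apply mobius_ok_hol; exact Hok).
    rewrite (IH f a z Hok).
    assert (E2 : C_derive_n (fun w => w ^ k * f (/ w - a))%C (S (S k)) z =
      ((- (1)) ^ (S k) * (- (INR (S (S k)) * (/ z) ^ (S k) / (z * z)) * C_derive_n f (S k) (/ z - a)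
         + (/ z) ^ (S (S k)) * (- / (z * z) * C_derive_n f (S (S k)) (/ z - a))))%C).
    { rewrite derive_n_S. apply CD_derive. destruct (mobius_ok_open f a z Hok) as [d [Hd H']].
      apply (CD_loc (fun w => (- (1)) ^ (S k) * ((/ w) ^ (S (S k)) * C_derive_n f (S k) (/ w - a)))%C _ z _ d Hd).
      - intros w Hw. rewrite (IH f a w) by (apply H', Hw). ring.
      - eapply CD_val. apply (CD_mult (fun _ => (- (1)) ^ (S k))%C (fun w => ((/ w) ^ (S (S k)) * C_derive_n f (S k) (/ w - a))%C)). apply CD_const.
        apply (CD_mult (fun w => (/ w) ^ (S (S k)))%C (fun w => C_derive_n f (S k) (/ w - a))%C).
        apply (CD_pow (fun w => / w)%C). apply CD_inv_id, Hz.
        apply (CD_comp (C_derive_n f (S k)) (fun w => / w - a)%C). apply C_diff_iff, hol_at_diff, hol_at_derive_n, H0.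
        apply CD_minus. apply CD_inv_id, Hz. apply CD_const.
        rewrite <- derive_n_S. simpl pred.
        set (b := C_derive_n f (S k) (/ z - a)). set (e := C_derive_n f (S (S k)) (/ z - a)). set (s := ((- (1)) ^ S k)%C).
        set (p := ((/ z) ^ S k)%C). set (p' := ((/ z) ^ S (S k))%C). set (n := RtoC (INR (S (S k)))).
        change (0 * (p' * b) + s * (n * p * - / (z * z) * b + p' * ((- / (z * z) - 0) * e)) = s * (- (n * p / (z * z)) * b + p' * (- / (z * z) * e)))%C.
        field. exact Hz. }
    rewrite E2. rewrite !(Cpow_S (- (1))). rewrite !(Cpow_S (/ z)).
    set (p := ((/ z) ^ k)%C). set (n := RtoC (INR (S (S k)))). set (s := ((- (1)) ^ k)%C). field. exact Hz.
Qed.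

Lemma derive_n_pow_zero n : forall i c z, (i < n)%nat -> C_derive_n (fun w => c * w ^ i)%C n z = RtoC 0.
Proof.
  induction n as [|n IH]; intros i c z Hi. lia. rewrite derive_n_Sr.
  replace (C_derive (fun w => c * w ^ i)%C) with (fun w => (c * INR i) * w ^ (pred i))%C.
  2: { apply functional_extensionality. intros w. symmetry. apply CD_derive. eapply CD_val. apply (CD_mult (fun _ => c) (fun w => w ^ i)%C). apply CD_const.
       apply (CD_pow (fun w => w)). apply CD_id. change (0 * w ^ i + c * (INR i * w ^ pred i * 1) = c * INR i * w ^ pred i)%C. ring. }
  destruct i as [|i].
  - replace (fun w => (c * INR 0 * w ^ pred 0)%C) with (fun _ : C => RtoC 0). apply derive_n_zero.
    apply functional_extensionality. intros w. change (INR 0) with 0. ring.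
  - apply IH. simpl. lia.
Qed.

Lemma jet_poly_derive k f m z : C_derive_n (jet_poly k f m) (S k) z = RtoC 0.
Proof.
  unfold jet_poly.
  rewrite (derive_n_csum (fun j z => (C_derive_n f j (- INR m) / RtoC (INR (fact j)) * z ^ (k - j))%C) (S k) z 1).
  - assert (G : forall n, csum (fun i => C_derive_n (fun z0 => (C_derive_n f i (- INR m) / INR (fact i) * z0 ^ (k - i))%C) (S k) z) n = RtoC 0).
    { induction n. reflexivity. rewrite csum_S, IHn. rewrite derive_n_pow_zero by lia. ring. }
    apply G.
  - intros i _ w _. apply diff_mult. apply diff_const. apply diff_pow, diff_id.
  - rewrite Cmod_sub_diag. lra.
Qed.

Lemma Re_inv z : Re (/ z)%C = Re z / (Cmod z * Cmod z).
Proof.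
  replace (Cmod z * Cmod z) with (Cmod z ^ 2) by ring. rewrite Cmod2_alt. destruct z as [a b]. unfold Cinv, Re, Im; simpl. reflexivity.
Qed.

Lemma Re_inv_neg z : Re z <= 0 -> Re (/ z)%C <= 0.
Proof.
  intros H. rewrite Re_inv. assert (0 <= Cmod z * Cmod z) by (apply Rmult_le_pos; apply Cmod_ge_0).
  destruct (Req_dec (Cmod z * Cmod z) 0) as [->|Hn]. unfold Rdiv. rewrite Rinv_0. lra.
  unfold Rdiv. assert (0 < / (Cmod z * Cmod z)) by (apply Rinv_0_lt_compat; lra).
  assert (0 <= - Re z * / (Cmod z * Cmod z)) by (apply Rmult_le_pos; lra). lra.
Qed.

Lemma Re_neg_neq_0 z : Re z < 0 -> z <> RtoC 0.
Proof. intros H ->. simpl in H. lra. Qed.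

Lemma decays_hol_at f A z : decays f A -> Re z < - (1 / 5) -> hol_at f z.
Proof.
  intros HA Hz. exists (- (1/5) - Re z). split; [lra|]. intros w Hw. apply HA.
  assert (X := Re_le_Cmod (w - z)). change (Re (w - z)%C) with (Re w - Re z) in X. lra.
Qed.

Lemma decays_mobius_ok f A z i : decays f A -> Re z < 0 -> mobius_ok f (INR (S i)) z.
Proof.
  intros HA Hz. split. apply Re_neg_neq_0; lra. apply (decays_hol_at f A); [exact HA|].
  rewrite Re_minus_INR. assert (X := Re_inv_neg z ltac:(lra)). generalize (INR_S_ge1 i). lra.
Qed.

Lemma T_term_derive k f A z i : decays f A -> Re z < 0 ->
  C_derive_n (fun w => T_term k f w (S i)) (S k) z =
  (- ((- (1)) ^ (S k) * (/ z) ^ (S (S k)) * C_derive_n f (S k) (/ z - INR (S i))))%C.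
Proof.
  intros HA Hz. assert (Hok := decays_mobius_ok f A z i HA Hz).
  replace (fun w => T_term k f w (S i)) with (fun w => jet_poly k f (S i) w - (w ^ k * f (/ w - INR (S i))))%C.
  2: { apply functional_extensionality. intros w. rewrite T_term_split. ring. }
  destruct (mobius_ok_hol f (INR (S i)) z k Hok) as [r [Hr Hh]].
  rewrite (derive_n_minus (jet_poly k f (S i)) (fun w => w ^ k * f (/ w - INR (S i)))%C z r).
  - rewrite jet_poly_derive, Bol by exact Hok. ring.
  - intros w _. apply jet_poly_diff.
  - exact Hh.
  - rewrite Cmod_sub_diag. lra.
Qed.

Lemma T_diff k f A z : (1 <= k)%nat -> decays f A -> z <> RtoC 0 -> (forall i, C_differentiable f (/ z - INR (S i))%C) ->
  C_differentiable (T_op k f) z.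
Proof.
  intros Hk HA Hz H. apply (diff_ext (T_rest k f (fun _ => false))).
  - intros w. unfold T_rest, T_op. f_equal. apply functional_extensionality. intros i. unfold T_rest_term. ring.
  - apply (T_rest_diff k f A (fun _ => false) 0 z Hk HA Hz). reflexivity. intros i _. apply H.
Qed.

(** The polynomial parts have degree at most [k] and disappear. *)
Lemma T_op_derive k f A z : (1 <= k)%nat -> decays f A -> Re z <= - 1 ->
  is_csum (fun i => - ((- (1)) ^ (S k) * (/ z) ^ (S (S k)) * C_derive_n f (S k) (/ z - INR (S i))))%C (C_derive_n (T_op k f) (S k) z).
Proof.
  intros Hk HA Hz. destruct (T_term_left k Hk) as [K [HK HT]].
  assert (HB : forall w, Cmod (w - z) < 1 / 2 -> Re w < 0).
  { intros w Hw. assert (X := Re_le_Cmod (w - z)). change (Re (w - z)%C) with (Re w - Re z) in X. lra. }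
  apply (is_csum_ext (fun i => C_derive_n (fun w => T_term k f w (S i)) (S k) z)).
  { intros i. apply (T_term_derive k f A); [exact HA|lra]. }
  apply (derive_n_series (fun i w => T_term k f w (S i)) z (1/2) (K * A)).
  - lra.
  - apply Rmult_le_pos; [exact HK|apply HA].
  - intros i w Hw. specialize (HB w Hw). destruct (decays_mobius_ok f A w i HA HB) as [H1 H2]. apply T_term_diff; [exact H1|]. apply hol_at_diff, H2.
  - intros i w Hw. apply HT. exact HA. apply Re_inv_neg. specialize (HB w Hw). lra.
Qed.

(** Its inverse is [1 + gold]; this is the form in which the golden ratio is
    used. *)
Definition gold : R := (sqrt 5 - 1) / 2.

Lemma sqrt5_bounds : 2 < sqrt 5 < 5 / 2.
Proof.
  split. apply Rsqr_incrst_0; try (apply sqrt_pos || lra). rewrite Rsqr_sqrt by lra. unfold Rsqr; lra.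
  apply Rsqr_incrst_0; try (apply sqrt_pos || lra). rewrite Rsqr_sqrt by lra. unfold Rsqr; lra.
Qed.

Lemma gold_bounds : 1 / 2 < gold < 3 / 4.
Proof. generalize sqrt5_bounds. unfold gold. lra. Qed.

Lemma gold_eq : gold * (1 + gold) = 1.
Proof. unfold gold. assert (H : sqrt 5 * sqrt 5 = 5) by (apply sqrt_sqrt; lra). nra. Qed.

(** With [u = - 1 / z], this is [|z| ^ (-k-2)] times the density [1 / ((1 + Re
    u) |u + 1 + gold| ^ k)], a positive function that the transfer operator
    with kernel [|m + u| ^ (-k-2)] contracts by [gold ^ k]. *)
Definition weight (k : nat) (z : C) : R :=
  / (Cmod z ^ (k + 2) * ((1 + Re (- / z)%C) * Cmod ((1 + gold)%R - / z)%C ^ k)).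

Lemma Cmod_mono_re (u : C) (a b : R) : 0 <= Re u -> 0 <= a -> a <= b -> Cmod (u + a) <= Cmod (u + b).
Proof.
  intros Hu Ha Hab. apply Rsqr_incr_0; try apply Cmod_ge_0. unfold Rsqr.
  replace (Cmod (u + a) * Cmod (u + a)) with (Cmod (u + a) ^ 2) by ring. replace (Cmod (u + b) * Cmod (u + b)) with (Cmod (u + b) ^ 2) by ring.
  rewrite !Cmod2_alt. destruct u as [x y]. unfold Re, Im in *; simpl in *. nra.
Qed.

(** Since [(1 + gold) * gold = 1], the product on the right is [(1 + gold) *
    |u + m + gold|], and [m + gold >= 1 + gold]. This inequality is
    responsible for the rate [gold], both for the operator and for the
    products along orbits. *)
Lemma gold_step (u : C) (m : R) : 0 <= Re u -> 1 <= m -> (u + m)%C <> RtoC 0 ->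
  (1 + gold) * Cmod (u + (1 + gold)%R) <= Cmod (u + m) * Cmod ((1 + gold)%R + / (u + m)).
Proof.
  intros Hu Hm Hn. assert (Hg := gold_bounds). rewrite <- Cmod_mult.
  replace ((u + m) * ((1 + gold)%R + / (u + m)))%C with (RtoC (1 + gold) * (u + RtoC (m + gold)))%C.
  - rewrite Cmod_mult, Cmod_R, Rabs_pos_eq by lra. apply Rmult_le_compat_l; [lra|]. apply Cmod_mono_re; lra.
  - rewrite (RtoC_plus m gold). replace (RtoC (1 + gold) * (u + (RtoC m + RtoC gold)))%C with (RtoC (1 + gold) * (u + RtoC m) + RtoC (gold * (1 + gold)))%C.
    rewrite gold_eq. field. exact Hn. rewrite RtoC_mult. ring.
Qed.

Lemma weight_step k z i : Re z <= -1 ->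
  weight k (/ z - INR (S i)) <= gold ^ k * / ((Re (- / z)%C + INR (S i)) * (Re (- / z)%C + INR (S i) + 1) * Cmod ((1 + gold)%R - / z)%C ^ k).
Proof.
  intros Hz. set (u := (- / z)%C). set (m := INR (S i)). assert (Hm : 1 <= m) by apply INR_S_ge1. assert (Hg := gold_bounds).
  assert (Hu : 0 <= Re u). { unfold u. assert (X := Re_inv_neg z ltac:(lra)). change (Re (- / z)%C) with (- Re (/ z)%C). lra. }
  assert (Ep : (/ z - m)%C = (- (u + m))%C) by (unfold u; ring). rewrite Ep.
  assert (Hr : Re (u + m)%C = Re u + m) by reflexivity.
  assert (Hum : Re u + m <= Cmod (u + m)) by (rewrite <- Hr; apply Re_le_Cmod).
  assert (Hn : (u + m)%C <> RtoC 0) by (apply Cmod_gt_0; lra).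
  assert (En : (/ - (u + m))%C = (- / (u + m))%C). { field. exact Hn. }
  unfold weight. rewrite Cmod_opp, En.
  replace (- - / (u + m))%C with (/ (u + m))%C by ring. replace (RtoC (1 + gold) - - / (u + m))%C with (RtoC (1 + gold) + / (u + m))%C by ring.
  replace (RtoC (1 + gold) - / z)%C with (u + RtoC (1 + gold))%C by (unfold u; ring).
  assert (Hs := gold_step u m Hu Hm Hn).
  set (q := Cmod (u + m)) in *. set (h := Cmod (RtoC (1 + gold) + / (u + m))) in *. set (c := Cmod (u + RtoC (1 + gold))) in *.
  assert (Hc : 0 < c). { unfold c. apply Rlt_le_trans with (Re (u + RtoC (1 + gold))%C). change (Re (u + RtoC (1 + gold))%C) with (Re u + (1 + gold)). lra. apply Re_le_Cmod. }
  rewrite Re_inv, Hr. fold q. set (x := Re u) in *.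
  assert (Hgk : 0 < gold ^ k) by (apply pow_lt; lra). assert (Hck : 0 < c ^ k) by (apply pow_lt; lra).
  assert (Hxm : 0 < (x + m) * (x + m + 1)) by (apply Rmult_lt_0_compat; lra).
  assert (P : (x + m) * (x + m + 1) * c ^ k <= gold ^ k * (q ^ (k + 2) * ((1 + (x + m) / (q * q)) * h ^ k))).
  { replace (gold ^ k * (q ^ (k + 2) * ((1 + (x + m) / (q * q)) * h ^ k))) with ((q * q + (x + m)) * (gold * (q * h)) ^ k).
    - apply Rmult_le_compat; [lra|lra|nra|]. apply pow_incr. split; [lra|].
      apply Rle_trans with (gold * ((1 + gold) * c)). rewrite <- Rmult_assoc, gold_eq. lra. apply Rmult_le_compat_l; [lra|exact Hs].
    - rewrite !Rpow_mult_distr, pow_add. field. lra. }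
  assert (Hden : 0 < gold ^ k * (q ^ (k + 2) * ((1 + (x + m) / (q * q)) * h ^ k))).
  { eapply Rlt_le_trans; [|exact P]. apply Rmult_lt_0_compat; lra. }
  assert (Hden2 : 0 < q ^ (k + 2) * ((1 + (x + m) / (q * q)) * h ^ k)).
  { apply (Rmult_lt_reg_l (gold ^ k)); [lra|]. lra. }
  apply (Rmult_le_reg_l (q ^ (k + 2) * ((1 + (x + m) / (q * q)) * h ^ k))); [exact Hden2|].
  rewrite Rinv_r by lra.
  apply (Rmult_le_reg_r ((x + m) * (x + m + 1) * c ^ k)). apply Rmult_lt_0_compat; lra.
  replace (q ^ (k + 2) * ((1 + (x + m) / (q * q)) * h ^ k) * (gold ^ k * / ((x + m) * (x + m + 1) * c ^ k)) * ((x + m) * (x + m + 1) * c ^ k))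
    with (gold ^ k * (q ^ (k + 2) * ((1 + (x + m) / (q * q)) * h ^ k))).
  lra. assert (Hq : q <> 0) by lra. revert Hck Hxm Hq. generalize (c ^ k) (h ^ k) (gold ^ k) (q ^ (k + 2)). intros. field. repeat split; try lra; nra.
Qed.

(** A region mapped into itself by all [z => 1 / z - m]; it contains the
    segments from [-m] to [1 / z - m] for [Re z < - 1/5], where [|1 / z| <=
    5]. *)
Definition strip (z : C) := Re z <= -1 /\ Rabs (Im z) <= 5.

Definition weighted_bound (k : nat) (f : C -> C) (N : R) := forall z, strip z -> Cmod (C_derive_n f (S k) z) <= N * weight k z.

(** Telescoping of the Gauss density. *)
Lemma csum_tele_le x n : 0 <= x ->
  forall a : nat -> C, forall B, 0 <= B -> (forall i, Cmod (a i) <= B * / ((x + INR (S i)) * (x + INR (S i) + 1))) -> Cmod (csum a n) <= B * / (1 + x).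
Proof.
  intros Hx a B HB H.
  assert (G : Cmod (csum a n) <= B * (/ (1 + x) - / (1 + x + INR n))).
  { induction n as [|n IH].
    - simpl. rewrite Cmod_0. rewrite Rplus_0_r. lra.
    - rewrite csum_S. eapply Rle_trans. apply Cmod_triangle. specialize (H n).
      assert (E : / ((x + INR (S n)) * (x + INR (S n) + 1)) = / (1 + x + INR n) - / (1 + x + INR (S n))).
      { rewrite S_INR. generalize (pos_INR n). intros. field. lra. }
      rewrite E in H. lra. }
  eapply Rle_trans. exact G. apply Rmult_le_compat_l; [exact HB|].
  assert (0 < / (1 + x + INR n)) by (apply Rinv_0_lt_compat; generalize (pos_INR n); lra). lra.
Qed.

Lemma strip_inv_bounds z : Re z <= -1 -> -1 <= Re (/ z)%C <= 0 /\ Cmod (/ z) <= 1.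
Proof.
  intros Hz. assert (Hn : z <> RtoC 0) by (apply Re_neg_neq_0; lra).
  assert (H1 : 1 <= Cmod z) by (generalize (Re_neg_le_Cmod z); lra).
  assert (H2 : Cmod (/ z) <= 1). { rewrite Cmod_inv by exact Hn. rewrite <- Rinv_1. apply Rinv_le_contravar; lra. }
  split; [|exact H2]. split. generalize (Re_neg_le_Cmod (/ z)). lra. apply Re_inv_neg; lra.
Qed.

Lemma Im_minus_R z (m : R) : Im (z - m)%C = Im z.
Proof. unfold Cminus, Cplus, Copp, RtoC, Im; simpl. ring. Qed.

Theorem weighted_bound_T k f A N : (1 <= k)%nat -> decays f A -> 0 <= N -> weighted_bound k f N -> weighted_bound k (T_op k f) (gold ^ k * N).
Proof.
  intros Hk HA HN Hnu z [Hz Hzi]. assert (Hg := gold_bounds).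
  destruct (strip_inv_bounds z Hz) as [[R1 R2] R3].
  set (x := Re (- / z)%C). assert (Hx : 0 <= x). { unfold x. change (Re (- / z)%C) with (- Re (/ z)%C). lra. }
  set (c := Cmod (RtoC (1 + gold) - / z)%C).
  assert (Hc : 0 < c). { unfold c. apply Rlt_le_trans with (Re (RtoC (1 + gold) - / z)%C). change (Re (RtoC (1 + gold) - / z)%C) with ((1 + gold) - Re (/ z)%C). lra. apply Re_le_Cmod. }
  assert (Hn : z <> RtoC 0) by (apply Re_neg_neq_0; lra). assert (Hzm : 0 < Cmod z) by (apply Cmod_gt_0; exact Hn).
  apply (is_csum_bound _ _ _ (T_op_derive k f A z Hk HA Hz)). intros n.
  assert (Hck : 0 < c ^ k) by (apply pow_lt; lra). assert (Hgk : 0 < gold ^ k) by (apply pow_lt; lra).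
  assert (Hzk : 0 < Cmod z ^ (k + 2)) by (apply pow_lt; lra).
  replace (gold ^ k * N * weight k z) with (gold ^ k * N * / (Cmod z ^ (k + 2) * c ^ k) * / (1 + x)).
  2: { unfold weight. fold c x. field. repeat split; lra. }
  apply csum_tele_le; [exact Hx| |].
  - apply Rmult_le_pos. apply Rmult_le_pos; lra. apply Rlt_le, Rinv_0_lt_compat, Rmult_lt_0_compat; lra.
  - intros i. rewrite Cmod_opp, !Cmod_mult, !Cmod_pow, Cmod_opp, Cmod_1, pow1, Rmult_1_l, Cmod_inv by exact Hn.
    assert (Hs : strip (/ z - INR (S i))%C).
    { split. rewrite Re_minus_INR. generalize (INR_S_ge1 i). lra. rewrite Im_minus_R. generalize (Im_le_Cmod (/ z)). lra. }
    assert (B := Hnu _ Hs). assert (W := weight_step k z i Hz). fold x c in W.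
    replace (S (S k)) with (k + 2)%nat by lia. rewrite pow_inv.
    apply Rle_trans with (/ Cmod z ^ (k + 2) * (N * (gold ^ k * / ((x + INR (S i)) * (x + INR (S i) + 1) * c ^ k)))).
    + apply Rmult_le_compat_l. apply Rlt_le, Rinv_0_lt_compat; lra. eapply Rle_trans. exact B. apply Rmult_le_compat_l; assumption.
    + apply Req_le. generalize (INR_S_ge1 i). intros. field. repeat split; lra.
Qed.

(** Cauchy's estimate on the disc of radius [|z| / 10] around a point of the
    strip. *)
Lemma weighted_bound_of_decays k : exists K, 0 < K /\ forall f A, decays f A -> weighted_bound k f (K * A).
Proof.
  assert (Hg := gold_bounds). assert (Hcc := cauchy_const_pos (S k)).
  assert (H10 : 0 < 10 ^ S k) by (apply pow_lt; lra). assert (H3 : 0 < 3 ^ k) by (apply pow_lt; lra).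
  exists (cauchy_const (S k) * 2 * 10 ^ S k * (2 * 3 ^ k)).
  assert (Hpos : 0 < cauchy_const (S k) * 2 * 10 ^ S k).
  { apply Rmult_lt_0_compat; [apply Rmult_lt_0_compat; lra|exact H10]. }
  split. apply Rmult_lt_0_compat; [exact Hpos|lra].
  intros f A HA z [Hz Hzi]. assert (HA0 : 0 <= A) by apply HA.
  set (r := Cmod z). assert (Hr : 1 <= r) by (unfold r; generalize (Re_neg_le_Cmod z); lra).
  assert (Hr2 : r <= - Re z + 5). { unfold r. generalize (Cmod_le_ReIm z). rewrite (Rabs_left (Re z)) by lra. lra. }
  assert (HB : forall w, Cmod (w - z) < r / 10 -> Re w < - (1/5) /\ r / 2 <= Cmod w).
  { intros w Hw. assert (X := Re_le_Cmod (w - z)). change (Re (w - z)%C) with (Re w - Re z) in X. split. lra.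
    assert (Y : r <= Cmod (z - w) + Cmod w). { unfold r. replace z with ((z - w) + w)%C at 1 by ring. apply Cmod_triangle. }
    rewrite Cmod_sub_sym in Y. lra. }
  assert (D : Cmod (C_derive_n f (S k) z) <= cauchy_const (S k) * (A / (r / 2)) / (r / 10) ^ (S k)).
  { apply Cauchy_n; [lra| |]. intros w Hw. apply HA, HB, Hw. intros w Hw. destruct (HB w Hw). apply (decays_bound f A); auto; lra. }
  eapply Rle_trans. exact D.
  destruct (strip_inv_bounds z Hz) as [[R1 R2] R3].
  assert (Hrk : 0 < r ^ (k + 2)) by (apply pow_lt; lra).
  assert (Hx : 0 <= Re (- / z)%C <= 1). { change (Re (- / z)%C) with (- Re (/ z)%C). lra. }
  assert (Hc : 0 < Cmod (RtoC (1 + gold) - / z)%C <= 3).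
  { split. apply Rlt_le_trans with (Re (RtoC (1 + gold) - / z)%C). change (Re (RtoC (1 + gold) - / z)%C) with ((1 + gold) - Re (/ z)%C). lra. apply Re_le_Cmod.
    eapply Rle_trans. apply Cmod_sub_le. rewrite Cmod_R, Rabs_pos_eq by lra. lra. }
  assert (Hck : 0 < Cmod (RtoC (1 + gold) - / z)%C ^ k <= 3 ^ k). { split. apply pow_lt; lra. apply pow_incr; lra. }
  replace (cauchy_const (S k) * (A / (r / 2)) / (r / 10) ^ S k) with (cauchy_const (S k) * 2 * 10 ^ S k * A * / r ^ (k + 2)).
  2: { replace ((r / 10) ^ S k) with (r ^ S k / 10 ^ S k) by (unfold Rdiv; rewrite Rpow_mult_distr, pow_inv; reflexivity).
       replace (k + 2)%nat with (S (S k)) by lia. change (r ^ S (S k)) with (r * r ^ S k).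
       generalize (cauchy_const (S k)); intros. field. repeat split; try lra. apply pow_nonzero; lra. }
  unfold weight. fold r. set (c := Cmod (RtoC (1 + gold) - / z)%C ^ k) in *. set (x := Re (- / z)%C) in *.
  replace (cauchy_const (S k) * 2 * 10 ^ S k * (2 * 3 ^ k) * A * / (r ^ (k + 2) * ((1 + x) * c))) with
    (cauchy_const (S k) * 2 * 10 ^ S k * A * / r ^ (k + 2) * ((2 * 3 ^ k) * / ((1 + x) * c))).
  2: { generalize (cauchy_const (S k)) (10 ^ S k); intros. field. repeat split; lra. }
  rewrite <- (Rmult_1_r (cauchy_const (S k) * 2 * 10 ^ S k * A * / r ^ (k + 2))) at 1.
  apply Rmult_le_compat_l.
  - apply Rmult_le_pos; [apply Rmult_le_pos; lra|]. apply Rlt_le, Rinv_0_lt_compat; lra.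
  - apply (Rmult_le_reg_r ((1 + x) * c)). apply Rmult_lt_0_compat; lra. rewrite Rmult_assoc, Rinv_l. rewrite Rmult_1_l, Rmult_1_r.
    apply Rmult_le_compat; lra. apply Rgt_not_eq, Rmult_lt_0_compat; lra.
Qed.

Lemma weight_le k p i : Re p <= - INR (S i) -> (1 <= k)%nat -> 0 <= weight k p <= 2 * tele i.
Proof.
  intros Hp Hk. assert (Hg := gold_bounds). assert (Hm := INR_S_ge1 i).
  assert (R2 : Re (/ p)%C <= 0) by (apply Re_inv_neg; lra).
  assert (Hq : INR (S i) <= Cmod p) by (generalize (Re_neg_le_Cmod p); lra).
  assert (Hx : 0 <= Re (- / p)%C). { change (Re (- / p)%C) with (- Re (/ p)%C). lra. }
  assert (Hc : 1 <= Cmod (RtoC (1 + gold) - / p)%C).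
  { apply Rle_trans with (Re (RtoC (1 + gold) - / p)%C). change (Re (RtoC (1 + gold) - / p)%C) with ((1 + gold) - Re (/ p)%C). lra. apply Re_le_Cmod. }
  assert (Hck : 1 <= Cmod (RtoC (1 + gold) - / p)%C ^ k) by (apply pow_R1_Rle; exact Hc).
  unfold weight. set (c := Cmod (RtoC (1 + gold) - / p)%C ^ k) in *. set (x := Re (- / p)%C) in *.
  assert (Hpk : INR (S i) ^ (k + 2) <= Cmod p ^ (k + 2)) by (apply pow_incr; lra).
  assert (Hmk : 0 < INR (S i) ^ (k + 2)) by (apply pow_lt; lra).
  assert (Hxc : 1 <= (1 + x) * c). { rewrite <- (Rmult_1_l 1). apply Rmult_le_compat; lra. }
  split. apply Rlt_le, Rinv_0_lt_compat. apply Rmult_lt_0_compat; lra.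
  eapply Rle_trans; [|apply (inv_pow_le_tele k i (k + 2) Hk); lia].
  apply Rinv_le_contravar; [exact Hmk|]. rewrite <- (Rmult_1_r (INR (S i) ^ (k + 2))). apply Rmult_le_compat; lra.
Qed.

(** Taylor's formula along the segments from [-m] to [1 / z - m]. *)
Theorem decays_T k f A N : (1 <= k)%nat -> decays f A -> 0 <= N -> weighted_bound k f N -> decays (T_op k f) (2 ^ (k + 2) * N).
Proof.
  intros Hk HA HN Hnu. assert (H2 : 0 < 2 ^ (k + 2)) by (apply pow_lt; lra). split. apply Rmult_le_pos; lra.
  intros z Hz. assert (Hn : z <> RtoC 0) by (apply Re_neg_neq_0; lra).
  assert (Hzm : 1 / 5 < Cmod z) by (generalize (Re_neg_le_Cmod z); lra).
  assert (Hiz : Cmod (/ z) <= 5). { rewrite Cmod_inv by exact Hn. replace 5 with (/ (1/5)) by field. apply Rinv_le_contravar; lra. }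
  assert (R2 : Re (/ z)%C <= 0) by (apply Re_inv_neg; lra).
  split.
  - apply (T_diff k f A); auto. intros i. apply HA. rewrite Re_minus_INR. generalize (INR_S_ge1 i). lra.
  - rewrite <- Cmod_mult. rewrite Rmult_comm.
    assert (HS : forall n, Cmod (csum (fun i => T_term k f z (S i)) n) <= 2 ^ (k + 2) * N / Cmod z).
    { intros n. apply csum_total_bound. apply Rdiv_le_0_compat; [apply Rmult_le_pos; lra|lra]. intros i.
      rewrite T_term_Taylor by exact Hn. rewrite Cmod_opp, Cmod_mult, Cmod_pow.
      assert (Hb := tele_pos i).
      assert (HT : Cmod (f (- INR (S i) + / z)%C - tpoly f (- INR (S i)) (S k) (/ z)) <= 2 ^ S k * (N * (2 * tele i)) * Cmod (/ z) ^ S k).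
      { apply Taylor_bound. apply Rmult_le_pos; lra. intros t Ht.
        assert (Hre : Re (- INR (S i) + t * / z)%C <= - INR (S i)).
        { replace (Re (- INR (S i) + t * / z)%C) with (- INR (S i) + t * Re (/ z)%C).
          assert (0 <= t * - Re (/ z)%C) by (apply Rmult_le_pos; lra). lra.
          destruct (/ z)%C as [a b]. unfold Cmult, Cplus, Copp, RtoC, Re; simpl. ring. }
        assert (Hst : strip (- INR (S i) + t * / z)%C).
        { split. generalize (INR_S_ge1 i). lra. replace (Im (- INR (S i) + t * / z)%C) with (t * Im (/ z)%C).
          rewrite Rabs_mult, Rabs_pos_eq by lra. assert (X := Im_le_Cmod (/ z)%C).
          assert (t * Rabs (Im (/ z)%C) <= 1 * Rabs (Im (/ z)%C)) by (apply Rmult_le_compat_r; [apply Rabs_pos|lra]). lra.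
          destruct (/ z)%C as [a b]. unfold Cmult, Cplus, Copp, RtoC, Im; simpl. ring. }
        split. apply (decays_hol_at f A). exact HA. generalize (INR_S_ge1 i). lra.
        eapply Rle_trans. apply Hnu. exact Hst. apply Rmult_le_compat_l; [exact HN|]. apply weight_le; assumption. }
      eapply Rle_trans. apply Rmult_le_compat_l. apply pow_le, Cmod_ge_0. exact HT.
      rewrite Cmod_inv by exact Hn. rewrite pow_inv. apply Req_le. rewrite pow_add. simpl. field. repeat split; try (apply pow_nonzero); lra. }
    assert (B := is_csum_bound _ _ _ (T_conv k f A z Hk HA Hn) HS).
    rewrite Rmult_comm. rewrite Cmod_mult. apply (Rmult_le_compat_l (Cmod z)) in B; [|lra].
    replace (Cmod z * (2 ^ (k + 2) * N / Cmod z)) with (2 ^ (k + 2) * N) in B by (field; lra). lra.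
Qed.

Lemma decays_mono f A B : decays f A -> A <= B -> decays f B.
Proof. intros [H1 H2] H. split. lra. intros z Hz. destruct (H2 z Hz). split; [assumption|lra]. Qed.

(** The contraction acts on the weighted bounds of the derivatives; the
    passage from and to the functions costs a constant factor, once. *)
Theorem decays_iter k : (1 <= k)%nat -> exists K, 0 < K /\ forall f A j, decays f A -> decays (Nat.iter j (T_op k) f) (K * gold ^ (j * k) * A).
Proof.
  intros Hk. destruct (weighted_bound_of_decays k) as [K0 [HK0 Hnu]]. assert (Hg := gold_bounds).
  assert (H2 : 0 < 2 ^ (k + 2)) by (apply pow_lt; lra). assert (Hgk : 0 < gold ^ k) by (apply pow_lt; lra).
  set (K1 := 2 ^ (k + 2) * K0 / gold ^ k). assert (HK1 : 0 < K1). { unfold K1. apply Rdiv_lt_0_compat; [apply Rmult_lt_0_compat; lra|lra]. }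
  exists (1 + K1). split. lra. intros f A j HA. assert (HA0 : 0 <= A) by apply HA.
  assert (G : forall j, (exists B, decays (Nat.iter j (T_op k) f) B) /\ weighted_bound k (Nat.iter j (T_op k) f) (gold ^ (j * k) * (K0 * A))).
  { induction j0 as [|j0 [[B HB] IH]].
    - split. exists A; exact HA. simpl. rewrite Rmult_1_l. apply Hnu, HA.
    - assert (P : 0 <= gold ^ (j0 * k) * (K0 * A)). { apply Rmult_le_pos. apply pow_le; lra. apply Rmult_le_pos; lra. }
      simpl Nat.iter. split. eexists. eapply decays_T; eassumption.
      replace (gold ^ (S j0 * k) * (K0 * A)) with (gold ^ k * (gold ^ (j0 * k) * (K0 * A))). eapply weighted_bound_T; eassumption.
      simpl. rewrite pow_add. ring. }
  destruct j as [|j].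
  - simpl. rewrite Rmult_1_r. apply (decays_mono f A). exact HA. assert (0 <= K1 * A) by (apply Rmult_le_pos; lra). lra.
  - destruct (G j) as [[B HB] HN].
    assert (P : 0 <= gold ^ (j * k) * (K0 * A)). { apply Rmult_le_pos. apply pow_le; lra. apply Rmult_le_pos; lra. }
    assert (Pg : 0 <= gold ^ (S j * k)) by (apply pow_le; lra).
    assert (PA : 0 <= gold ^ (S j * k) * A) by (apply Rmult_le_pos; lra).
    apply (decays_mono _ (2 ^ (k + 2) * (gold ^ (j * k) * (K0 * A)))). apply (decays_T k _ B); assumption.
    replace (2 ^ (k + 2) * (gold ^ (j * k) * (K0 * A))) with (K1 * gold ^ (S j * k) * A).
    2: { unfold K1. simpl (S j * k)%nat. rewrite (pow_add gold k). field. lra. } lra.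
Qed.

(** * Functions vanishing at infinity and the supremum over the domain *)

Definition hol_off01 (f : C -> C) := forall z, ~ segment 0 1 z -> C_differentiable f z.

Lemma Csub_0 (z : C) : (z - 0)%C = z.
Proof. ring. Qed.

Lemma Cmod_le_sub_add (a b : C) : Cmod a <= Cmod (a - b) + Cmod b.
Proof. replace a with ((a - b) + b)%C at 1 by ring. apply Cmod_triangle. Qed.

Lemma not_segment_Re_neg z : Re z < 0 -> ~ segment 0 1 z.
Proof. intros H [_ H']. lra. Qed.

Lemma not_segment_Re_gt1 z : 1 < Re z -> ~ segment 0 1 z.
Proof. intros H [_ H']. lra. Qed.

Lemma C_eq_parts z a b : Re z = a -> Im z = b -> z = (a, b).
Proof. destruct z as [x y]. unfold Re, Im; simpl. intros -> ->. reflexivity. Qed.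

Lemma hol_off01_T k f A : (1 <= k)%nat -> decays f A -> hol_off01 f -> hol_off01 (T_op k f).
Proof.
  intros Hk HA Hf z Hz.
  assert (Hn : z <> RtoC 0). { intros ->. apply Hz. split; simpl; [reflexivity|lra]. }
  apply (T_diff k f A); auto. intros i. apply Hf. intros [H1 H2]. apply Hz.
  rewrite Re_minus_INR in H2. rewrite Im_minus_R in H1. assert (Hm := INR_S_ge1 i).
  set (t := Re (/ z)%C) in *. assert (E : (/ z)%C = RtoC t) by (apply C_eq_parts; auto).
  assert (Ez : z = RtoC (/ t)). { transitivity (/ / z)%C. field; exact Hn. rewrite E, RtoC_inv by lra. reflexivity. }
  rewrite Ez. split; simpl. reflexivity. split. apply Rlt_le, Rinv_0_lt_compat; lra. rewrite <- Rinv_1. apply Rinv_le_contravar; lra.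
Qed.

(** The function in the coordinate [w = 1 / z], with its value [0] at
    infinity. *)
Definition at_inf (f : C -> C) (w : C) : C := if excluded_middle_informative (w = RtoC 0) then RtoC 0 else f (/ w)%C.

Lemma at_inf_0 f : at_inf f (RtoC 0) = RtoC 0.
Proof. unfold at_inf. destruct (excluded_middle_informative _); congruence. Qed.

Lemma at_inf_n f w : w <> RtoC 0 -> at_inf f w = f (/ w)%C.
Proof. intros H. unfold at_inf. destruct (excluded_middle_informative _); congruence. Qed.

Lemma at_inf_diff_0 k f : (1 <= k)%nat -> zero_at_infinity k f -> C_differentiable (at_inf f) (RtoC 0).
Proof.
  intros Hk [g [r [Hr [Hg Hf]]]].
  apply (diff_loc (fun w => w ^ k * g w)%C _ _ r Hr).
  - intros w Hw. replace (w - 0)%C with w in Hw by ring. destruct (excluded_middle_informative (w = RtoC 0)) as [->|Hn].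
    rewrite at_inf_0. replace k with (S (k - 1)) by lia. rewrite Cpow_S. ring.
    rewrite at_inf_n by exact Hn. symmetry. apply Hf; assumption.
  - apply diff_mult. apply diff_pow, diff_id. apply Hg. rewrite Cmod_0. exact Hr.
Qed.

Lemma at_inf_diff f w : w <> RtoC 0 -> C_differentiable f (/ w)%C -> C_differentiable (at_inf f) w.
Proof.
  intros Hn H. assert (Hm : 0 < Cmod w) by (apply Cmod_gt_0; exact Hn).
  apply (diff_loc (fun w => f (/ w)%C) _ _ (Cmod w) Hm).
  - intros x Hx. symmetry. apply at_inf_n. intros ->. rewrite Cmod_sub_sym in Hx. replace (w - 0)%C with w in Hx by ring. lra.
  - apply (diff_comp f (fun w => / w)%C). exact H. apply diff_inv. exact Hn. apply diff_id.
Qed.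

Lemma Cinv_neq_0 z : z <> RtoC 0 -> (/ z)%C <> RtoC 0.
Proof. intros H E. assert (z * / z = 1)%C by (field; exact H). rewrite E in H0. rewrite Cmult_0_r in H0. apply RtoC_inj in H0. lra. Qed.

(** In the coordinate [w = 1 / z] the half-plane becomes a disc on whose
    closure the function is holomorphic and vanishes at [w = 0], hence is
    [O(w)] near each point. The constant is qualitative; it ensures
    convergence even if the supremum over [Dinf] is infinite. *)
Lemma decays_of_O_space k phi : (1 <= k)%nat -> O_space k (segment 0 1) phi -> exists A, decays phi A.
Proof.
  intros Hk [Hd Hz]. set (F := at_inf phi).
  assert (DF : forall x y, x <= 0 -> C_differentiable F (x, y)).
  { intros x y Hx. destruct (excluded_middle_informative ((x, y) = RtoC 0)) as [->|Hn].
    - apply (at_inf_diff_0 k); assumption.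
    - apply at_inf_diff. exact Hn. apply Hd. intros [H1 H2]. assert (X := Re_inv_neg (x, y) Hx).
      apply (Cinv_neq_0 _ Hn). apply C_eq_parts; lra. }
  assert (B : exists B, forall x y, -5 <= x <= 0 -> -5 <= y <= 5 -> Cmod (F (x, y)) <= B * Cmod (x, y)).
  { apply (bisection (fun a b c d => exists B, forall x y, a <= x <= b -> c <= y <= d -> Cmod (F (x, y)) <= B * Cmod (x, y))); try lra.
    - intros a b c d _ _ [B1 H1] [B2 H2] [B3 H3] [B4 H4].
      exists (Rmax (Rmax B1 B2) (Rmax B3 B4)). intros x y Hx Hy.
      assert (M1 : B1 <= Rmax (Rmax B1 B2) (Rmax B3 B4)) by (eapply Rle_trans; [apply Rmax_l|apply Rmax_l]).
      assert (M2 : B2 <= Rmax (Rmax B1 B2) (Rmax B3 B4)) by (eapply Rle_trans; [apply Rmax_r|apply Rmax_l]).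
      assert (M3 : B3 <= Rmax (Rmax B1 B2) (Rmax B3 B4)) by (eapply Rle_trans; [apply Rmax_l|apply Rmax_r]).
      assert (M4 : B4 <= Rmax (Rmax B1 B2) (Rmax B3 B4)) by (eapply Rle_trans; [apply Rmax_r|apply Rmax_r]).
      destruct (Rle_dec x ((a + b) / 2)); destruct (Rle_dec y ((c + d) / 2)).
      + eapply Rle_trans. apply H1; lra. apply Rmult_le_compat_r. apply Cmod_ge_0. exact M1.
      + eapply Rle_trans. apply H3; lra. apply Rmult_le_compat_r. apply Cmod_ge_0. exact M3.
      + eapply Rle_trans. apply H2; lra. apply Rmult_le_compat_r. apply Cmod_ge_0. exact M2.
      + eapply Rle_trans. apply H4; lra. apply Rmult_le_compat_r. apply Cmod_ge_0. exact M4.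
    - intros x y Hx Hy. assert (D := DF x y ltac:(lra)).
      assert (HC : forall a b c d dl, a <= x <= b -> c <= y <= d -> b - a < dl -> d - c < dl -> forall s t, a <= s <= b -> c <= t <= d ->
         Cmod ((s, t) - (x, y)) < 2 * dl).
      { intros a b c d dl H1 H2 H3 H4 s t Hs Ht. unfold Cminus, Cplus, Copp; simpl. eapply Rle_lt_trans. apply Cmod_pair_le.
        assert (Rabs (s + - x) < dl) by (apply Rabs_def1; lra). assert (Rabs (t + - y) < dl) by (apply Rabs_def1; lra). lra. }
      destruct (excluded_middle_informative ((x, y) = RtoC 0)) as [E|Hn].
      + destruct D as [l Hl]. destruct (proj1 (CD_eps _ _ l) Hl 1 Rlt_0_1) as [d [Hd0 H']].
        exists (d / 2). split; [lra|]. intros a b c e H1 H2 H3 H4 H5 H6 H7 H8. exists (1 + Cmod l). intros s t Hs Ht.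
        specialize (H' (s, t)). rewrite E in *. unfold F in H' at 2. rewrite at_inf_0 in H'.
        rewrite Csub_0 in H'.
        assert (X := HC a b c e (d/2) H2 H5 H7 H8 s t Hs Ht). rewrite Csub_0 in X.
        specialize (H' ltac:(lra)).
        replace (F (s, t)) with ((F (s, t) - 0 - (s, t) * l) + (s, t) * l)%C by ring. eapply Rle_trans. apply Cmod_triangle.
        rewrite Cmod_mult. lra.
      + assert (Hm : 0 < Cmod (x, y)) by (apply Cmod_gt_0; exact Hn).
        destruct (diff_cont F (x, y) D 1 Rlt_0_1) as [d [Hd0 H']].
        exists (Rmin (d / 2) (Cmod (x, y) / 4)). split. apply Rmin_case; lra.
        intros a b c e H1 H2 H3 H4 H5 H6 H7 H8. exists ((1 + Cmod (F (x, y))) * (2 / Cmod (x, y))). intros s t Hs Ht.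
        assert (X := HC a b c e _ H2 H5 H7 H8 s t Hs Ht).
        assert (X1 : Cmod ((s, t) - (x, y)) < d). { eapply Rlt_le_trans. exact X. generalize (Rmin_l (d/2) (Cmod (x, y) / 4)). lra. }
        assert (X2 : Cmod ((s, t) - (x, y)) < Cmod (x, y) / 2). { eapply Rlt_le_trans. exact X. generalize (Rmin_r (d/2) (Cmod (x, y) / 4)). lra. }
        specialize (H' _ X1).
        assert (Y : Cmod (x, y) <= Cmod ((x, y) - (s, t)) + Cmod (s, t)) by apply Cmod_le_sub_add.
        rewrite Cmod_sub_sym in Y.
        assert (Z : Cmod (F (s, t)) <= 1 + Cmod (F (x, y))). { eapply Rle_trans. apply (Cmod_le_sub_add _ (F (x, y))). lra. }
        eapply Rle_trans. exact Z. rewrite Rmult_assoc. rewrite <- (Rmult_1_r (1 + Cmod (F (x, y)))) at 1.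
        apply Rmult_le_compat_l. generalize (Cmod_ge_0 (F (x, y))); lra.
        apply (Rmult_le_reg_r (Cmod (x, y))). exact Hm. replace (2 / Cmod (x, y) * Cmod (s, t) * Cmod (x, y)) with (2 * Cmod (s, t)) by (field; lra). lra. }
  destruct B as [B HB]. exists (Rmax 0 B). split. apply Rmax_l.
  intros z Hz'. split. apply Hd. apply not_segment_Re_neg; lra.
  assert (Hn : z <> RtoC 0) by (apply Re_neg_neq_0; lra).
  assert (Hi : Cmod (/ z) <= 5). { rewrite Cmod_inv by exact Hn. replace 5 with (/ (1/5)) by field. apply Rinv_le_contravar; [lra|]. generalize (Re_neg_le_Cmod z); lra. }
  assert (H1 := re_le_Cmod (/ z)). assert (H2 := Im_le_Cmod (/ z)). assert (H3 := Re_inv_neg z ltac:(lra)).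
  specialize (HB (Re (/ z)%C) (Im (/ z)%C)).
  rewrite <- (C_eq_parts (/ z)%C _ _ eq_refl eq_refl) in HB.
  assert (H4 : -5 <= Re (/ z)%C <= 0). { split; [|exact H3]. destruct (Rabs_le_between (Re (/ z)%C) 5) as [X _]. specialize (X ltac:(lra)). lra. }
  assert (H5 : -5 <= Im (/ z)%C <= 5). { destruct (Rabs_le_between (Im (/ z)%C) 5) as [X _]. specialize (X ltac:(lra)). lra. }
  specialize (HB H4 H5). unfold F in HB. rewrite at_inf_n in HB by (apply Cinv_neq_0; exact Hn).
  replace (/ / z)%C with z in HB by (field; exact Hn).
  assert (Hm : 0 < Cmod z) by (apply Cmod_gt_0; exact Hn).
  rewrite Cmod_inv in HB by exact Hn. apply (Rmult_le_compat_l (Cmod z)) in HB; [|lra].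
  replace (Cmod z * (B * / Cmod z)) with B in HB by (field; lra). generalize (Rmax_r 0 B). lra.
Qed.

Lemma sqrt3_bounds : 17 / 10 < sqrt 3 < 9 / 5.
Proof.
  split; apply Rsqr_incrst_0; try (apply sqrt_pos || lra); rewrite Rsqr_sqrt by lra; unfold Rsqr; lra.
Qed.

Lemma Dinf_left z : Re z < - (1/5) -> Dinf z.
Proof. intros H. right. left. generalize sqrt3_bounds. lra. Qed.

Lemma Dinf_right z : 9 / 5 <= Re z -> Dinf z.
Proof.
  intros H. right. right. generalize sqrt3_bounds. intros B. split. lra.
  apply Rlt_le_trans with (Re (z - RtoC (sqrt 3 / 3))%C). change (Re (z - RtoC (sqrt 3 / 3))%C) with (Re z - sqrt 3 / 3). lra. apply Re_le_Cmod.
Qed.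

Lemma Dinf_far z : 5 / 2 < Cmod z -> Dinf z.
Proof.
  intros H. destruct (Rlt_dec (1/2) (Rabs (Im z))) as [H1|H1]. left; exact H1.
  assert (X := Cmod_le_ReIm z). destruct (Rle_dec 0 (Re z)).
  - apply Dinf_right. rewrite Rabs_pos_eq in X by lra. lra.
  - apply Dinf_left. rewrite Rabs_left in X by lra. lra.
Qed.

(** Far from the origin, the derivative of the function in the coordinate [w =
    1 / z] is bounded by the supremum, and the function vanishes at [w =
    0]. *)
Lemma decays_of_sup_Dinf k phi M : (1 <= k)%nat -> O_space k (segment 0 1) phi -> 0 <= M -> (forall z, Dinf z -> Cmod (phi z) <= M) -> decays phi (80 * M).
Proof.
  intros Hk [Hd Hz] HM HD. split; [lra|]. intros z Hre. split. apply Hd, not_segment_Re_neg; lra.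
  assert (Hp := HD z (Dinf_left z Hre)).
  destruct (Rlt_dec 5 (Cmod z)) as [H5|H5].
  2: { apply Rle_trans with (5 * M); [|lra]. apply Rmult_le_compat; try apply Cmod_ge_0; lra. }
  assert (Hn : z <> RtoC 0) by (apply Re_neg_neq_0; lra).
  set (F := at_inf phi).
  assert (Hfar : forall w, w <> RtoC 0 -> Cmod w < 2 / 5 -> 5 / 2 < Cmod (/ w)).
  { intros w Hw H. rewrite Cmod_inv by exact Hw. replace (5/2) with (/ (2/5)) by field. apply Rinv_lt_contravar; [|exact H].
    apply Rmult_lt_0_compat; [apply Cmod_gt_0; exact Hw|lra]. }
  assert (HF : hol_ball F (RtoC 0) (2/5)).
  { intros w Hw. replace (w - 0)%C with w in Hw by ring. destruct (excluded_middle_informative (w = RtoC 0)) as [->|Hw0].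
    apply (at_inf_diff_0 k); assumption. apply at_inf_diff; [exact Hw0|]. apply Hd. intros [S1 S2].
    assert (X := Hfar w Hw0 Hw). assert (Y := Cmod_le_ReIm (/ w)). rewrite S1, Rabs_R0, Rabs_pos_eq in Y by lra. lra. }
  assert (BF : forall w, Cmod (w - 0) < 2 / 5 -> Cmod (F w) <= M).
  { intros w Hw. replace (w - 0)%C with w in Hw by ring. unfold F. destruct (excluded_middle_informative (w = RtoC 0)) as [->|Hw0].
    rewrite at_inf_0, Cmod_0. exact HM. rewrite at_inf_n by exact Hw0. apply HD, Dinf_far, Hfar; assumption. }
  assert (BD : forall w, Cmod (w - 0) < 1 / 5 -> Cmod (C_derive F w) <= 40 * M).
  { intros w Hw. apply Rle_trans with (4 * M / (1/5)); [|lra]. apply Cauchy_1. lra. apply (hol_ball_sub F (RtoC 0) (2/5)). exact HF. lra.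
    intros x Hx. apply BF. generalize (Cmod_sub_tri x w 0). lra. }
  assert (Hiz : Cmod (/ z) < 1 / 5). { rewrite Cmod_inv by exact Hn. replace (1/5) with (/ 5) by field. apply Rinv_lt_contravar; lra. }
  assert (L := Lipschitz_ball F (RtoC 0) (1/5) (40 * M) (hol_ball_sub F 0 (2/5) 0 (1/5) HF ltac:(replace (0 - 0)%C with (RtoC 0) by ring; rewrite Cmod_0; lra)) BD (RtoC 0) (/ z)%C).
  replace (/ z - 0)%C with (/ z)%C in L by ring. replace (0 - 0)%C with (RtoC 0) in L by ring. rewrite Cmod_0 in L.
  specialize (L ltac:(lra) Hiz). unfold F in L. rewrite at_inf_0, at_inf_n in L by (apply Cinv_neq_0; exact Hn).
  replace (/ / z)%C with z in L by (field; exact Hn). replace (phi z - 0)%C with (phi z) in L by ring.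
  rewrite Cmod_inv in L by exact Hn. apply (Rmult_le_compat_l (Cmod z)) in L; [|lra].
  replace (Cmod z * (2 * (40 * M) * / Cmod z)) with (80 * M) in L by (field; lra). exact L.
Qed.

Lemma sup_Dinf_cases phi : sup_Dinf phi = p_infty \/ exists M, sup_Dinf phi = Finite M /\ 0 <= M /\ forall z, Dinf z -> Cmod (phi z) <= M.
Proof.
  unfold sup_Dinf. set (E := fun x => x = 0 \/ exists z, Dinf z /\ x = Cmod (phi z)).
  destruct (Lub_Rbar_correct E) as [U _]. destruct (Lub_Rbar E) as [M| |].
  - right. exists M. split; [reflexivity|]. split. apply (U 0). left; reflexivity. intros z Hz. apply (U (Cmod (phi z))). right. exists z; auto.
  - left; reflexivity.
  - exfalso. apply (U 0). left; reflexivity.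
Qed.

(** * Orbits of the continued fraction map *)

Lemma D_set_facts z : D_set z -> z <> RtoC 0 /\ 0 < Re z <= 1 /\ Cmod z <= 1.
Proof.
  intros [H1 [_ [_ H2]]]. split. intros ->. simpl in H2; lra. split; [|exact H1]. split; [exact H2|]. generalize (Re_le_Cmod z). lra.
Qed.

(** The value [1/5] replaces [1 - sqrt 3 / 2], which is smaller. *)
Lemma Delta_facts z : Delta_set z -> - (1/5) <= Re z <= 1.
Proof.
  intros [H1 [H2 H3]]. split; [|generalize (Re_le_Cmod z); lra].
  assert (X := Re_neg_le_Cmod z).
  assert (H4 : 1 <= Cmod (z + 1) ^ 2) by (apply Rle_trans with (1 ^ 2); [lra|apply pow_incr; lra]).
  rewrite Cmod2_alt in H4. replace (Re (z + 1)%C) with (Re z + 1) in H4 by reflexivity.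
  replace (Im (z + 1)%C) with (Im z) in H4 by (destruct z; unfold Cplus, RtoC, Im; simpl; ring).
  assert (H5 : Im z ^ 2 <= (1 / 2) ^ 2) by (rewrite <- pow2_abs; apply pow_incr; split; [apply Rabs_pos|exact H3]).
  apply Rnot_lt_le. intros H6. assert (H7 : (Re z + 1) ^ 2 <= (4 / 5) ^ 2) by (apply pow_incr; lra). lra.
Qed.

Lemma cyl_facts n m z0 i : D_cyl n m z0 -> (i <= n)%nat -> - (1/5) <= Re (cf_orbit m z0 i) <= 1.
Proof.
  intros [H1 H2] Hi. destruct (Nat.eq_dec i n) as [->|]. apply Delta_facts, H2.
  destruct (D_set_facts _ (H1 i ltac:(lia))) as [_ [H _]]. lra.
Qed.

(** Up to sign, [p_(i-1) - q_(i-1) z_0] is the product of the first [i] points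
    of the orbit. *)
Lemma cf_form_step m z0 : forall i, (forall l, (l < S i)%nat -> cf_orbit m z0 l <> RtoC 0) ->
  cf_form m (S i) z0 = (- cf_orbit m z0 i * cf_form m i z0)%C.
Proof.
  induction i as [|i IH]; intros H.
  - unfold cf_form; simpl. ring.
  - specialize (IH (fun l Hl => H l ltac:(lia))). assert (Hz := H i ltac:(lia)).
    assert (E : cf_form m (S (S i)) z0 = (INR (m (S i)) * cf_form m (S i) z0 + cf_form m i z0)%C).
    { unfold cf_form. change (cf_num m (S (S i))) with (m (S i) * cf_num m (S i) + cf_num m i)%nat.
      change (cf_den m (S (S i))) with (m (S i) * cf_den m (S i) + cf_den m i)%nat.
      rewrite !plus_INR, !mult_INR, !RtoC_plus, !RtoC_mult. ring. }
    rewrite E. change (cf_orbit m z0 (S i)) with (/ cf_orbit m z0 i - INR (m (S i)))%C.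
    assert (E2 : cf_form m i z0 = (- / cf_orbit m z0 i * cf_form m (S i) z0)%C) by (rewrite IH; field; exact Hz).
    rewrite E2. ring.
Qed.

(** By [gold_step], [|z_i| |z_(i+1) + 1 + gold| <= gold |z_i + 1 + gold|]; the
    product along the orbit telescopes. *)
Lemma cf_form_bound n m z0 : D_cyl n m z0 -> (forall i, (1 <= i <= n)%nat -> (1 <= m i)%nat) ->
  forall i, (i < n)%nat -> Cmod (cf_form m i z0) <= 2 * gold ^ i.
Proof.
  intros HD Hm. assert (Hg := gold_bounds). assert (HD' := HD). destruct HD' as [H1 H2].
  assert (G : forall i, (i < n)%nat -> Cmod (cf_form m i z0) * Cmod (cf_orbit m z0 i + RtoC (1 + gold)) <= gold ^ i * Cmod (z0 + RtoC (1 + gold))).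
  { induction i as [|i IH]; intros Hi.
    - simpl. replace (cf_form m 0 z0) with (RtoC 1) by (unfold cf_form; simpl; ring). rewrite Cmod_1. lra.
    - specialize (IH ltac:(lia)). rewrite cf_form_step by (intros l Hl; apply D_set_facts, H1; lia).
      rewrite Cmod_mult, Cmod_opp.
      destruct (D_set_facts _ (H1 i ltac:(lia))) as [Hz [Hr Hc]]. destruct (D_set_facts _ (H1 (S i) Hi)) as [Hz' [Hr' Hc']].
      set (z := cf_orbit m z0 i) in *. set (u := cf_orbit m z0 (S i)) in *. set (mm := INR (m (S i))).
      assert (Hmm : 1 <= mm) by (apply (le_INR 1); apply Hm; lia).
      assert (Eu : (u + mm)%C = (/ z)%C). { unfold u, mm, z. simpl. ring. }
      assert (X := gold_step u mm ltac:(lra) Hmm). rewrite Eu in X. specialize (X (Cinv_neq_0 _ Hz)).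
      replace (/ / z)%C with z in X by (field; exact Hz). rewrite Cmod_inv in X by exact Hz.
      assert (Hzm : 0 < Cmod z) by (apply Cmod_gt_0; exact Hz).
      assert (Y : Cmod z * Cmod (u + RtoC (1 + gold)) <= gold * Cmod (z + RtoC (1 + gold))).
      { apply (Rmult_le_compat_l (gold * Cmod z)) in X; [|apply Rmult_le_pos; lra].
        replace (gold * Cmod z * ((1 + gold) * Cmod (u + RtoC (1 + gold)))) with (gold * (1 + gold) * (Cmod z * Cmod (u + RtoC (1 + gold)))) in X by ring.
        rewrite gold_eq in X.
        replace (gold * Cmod z * (/ Cmod z * Cmod (RtoC (1 + gold) + z))) with (gold * Cmod (z + RtoC (1 + gold))) in X by (rewrite (Cplus_comm z); field; lra). lra. }
      assert (Hf := Cmod_ge_0 (cf_form m i z0)).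
      replace (Cmod z * Cmod (cf_form m i z0) * Cmod (u + RtoC (1 + gold))) with (Cmod (cf_form m i z0) * (Cmod z * Cmod (u + RtoC (1 + gold)))) by ring.
      eapply Rle_trans. apply Rmult_le_compat_l; [exact Hf|exact Y]. simpl.
      apply (Rmult_le_compat_l gold) in IH; [|lra]. lra. }
  intros i Hi. specialize (G i Hi). destruct (D_set_facts _ (H1 i Hi)) as [_ [Hr _]].
  assert (P1 : 1 + gold <= Cmod (cf_orbit m z0 i + RtoC (1 + gold))).
  { apply Rle_trans with (Re (cf_orbit m z0 i + RtoC (1 + gold))%C). change (Re (cf_orbit m z0 i + RtoC (1 + gold))%C) with (Re (cf_orbit m z0 i) + (1 + gold)). lra. apply Re_le_Cmod. }
  assert (P2 : Cmod (z0 + RtoC (1 + gold)) <= 2 + gold).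
  { destruct (D_set_facts _ (H1 O ltac:(lia))) as [_ [_ Hc]]. simpl in Hc. eapply Rle_trans. apply Cmod_triangle. rewrite Cmod_R, Rabs_pos_eq by lra. lra. }
  assert (Hf := Cmod_ge_0 (cf_form m i z0)). assert (Hgi : 0 < gold ^ i) by (apply pow_lt; lra).
  assert (Cmod (cf_form m i z0) * (1 + gold) <= gold ^ i * (2 + gold)).
  { eapply Rle_trans. apply Rmult_le_compat_l; [exact Hf|exact P1]. eapply Rle_trans. exact G. apply Rmult_le_compat_l; lra. }
  nra.
Qed.

(** * Decomposition of the iterates along an orbit *)

Definition near3 (m1 m : nat) : bool := Nat.leb m (S m1) && Nat.leb m1 (S m).

Definition only1 (m : nat) : bool := Nat.eqb m 1.

Definition epsm (m1 : nat) : R := if Nat.eqb m1 1 then 0 else 1.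

Lemma near3_spec m1 m : near3 m1 m = true <-> (m <= S m1 /\ m1 <= S m)%nat.
Proof. unfold near3. rewrite Bool.andb_true_iff, !Nat.leb_le. reflexivity. Qed.

Lemma near3_false m1 m : near3 m1 m = false <-> (S m1 < m \/ S m < m1)%nat.
Proof. rewrite <- Bool.not_true_iff_false, near3_spec. lia. Qed.

Lemma csum_eq_zero a n : (forall i, (i < n)%nat -> a i = RtoC 0) -> csum a n = RtoC 0.
Proof. intros H. induction n as [|n IH]. reflexivity. rewrite csum_S, IH, H by (intros; try apply H; lia). ring. Qed.

Lemma csum_near3 (h : nat -> C) m1 : (1 <= m1)%nat ->
  csum (fun i => if near3 m1 (S i) then h (S i) else RtoC 0) (m1 + 2) = (h m1 + h (S m1) + epsm m1 * h (pred m1))%C.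
Proof.
  intros Hm. destruct m1 as [|[|p]]; [lia| |].
  - unfold epsm. simpl Nat.eqb. cbv iota. change (1 + 2)%nat with 3%nat. rewrite !csum_S.
    change (csum (fun i => if near3 1 (S i) then h (S i) else RtoC 0) 0) with (RtoC 0).
    replace (near3 1 3) with false by (symmetry; apply near3_false; lia).
    replace (near3 1 2) with true by (symmetry; apply near3_spec; lia).
    replace (near3 1 1) with true by (symmetry; apply near3_spec; lia). ring.
  - replace (S (S p) + 2)%nat with (S (S (S (S p)))) by lia. rewrite !csum_S.
    replace (near3 (S (S p)) (S (S (S (S p))))) with false by (symmetry; apply near3_false; lia).
    replace (near3 (S (S p)) (S (S (S p)))) with true by (symmetry; apply near3_spec; lia).
    replace (near3 (S (S p)) (S (S p))) with true by (symmetry; apply near3_spec; lia).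
    replace (near3 (S (S p)) (S p)) with true by (symmetry; apply near3_spec; lia).
    rewrite csum_eq_zero.
    + unfold epsm. replace (Nat.eqb (S (S p)) 1) with false by reflexivity. cbv iota. simpl pred. ring.
    + intros i Hi. replace (near3 (S (S p)) (S i)) with false by (symmetry; apply near3_false; lia); reflexivity.
Qed.

Lemma T_split_near3 k f A m1 z : (1 <= k)%nat -> decays f A -> z <> RtoC 0 -> (1 <= m1)%nat ->
  T_op k f z = (T_rest k f (near3 m1) z - z ^ k * (f (/ z - INR m1) + f (/ z - INR m1 - 1) + epsm m1 * f (/ z - INR m1 + 1)))%C.
Proof.
  intros Hk HA Hz Hm.
  rewrite (T_rest_eq k f A (near3 m1) (m1 + 2) z Hk HA Hz) by (intros m H; apply near3_false; lia).
  rewrite (csum_near3 (fun m => z ^ k * f (/ z - INR m))%C m1 Hm).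
  replace (/ z - INR (S m1))%C with (/ z - INR m1 - 1)%C by (rewrite S_INR, RtoC_plus; ring).
  replace (/ z - INR (pred m1))%C with (/ z - INR m1 + 1)%C. ring.
  destruct m1; [lia|]. rewrite S_INR, RtoC_plus. simpl pred. ring.
Qed.

(** For [z = w + 1] with [w] in [D], only the summand of index [1] is close to
    the singular segment. *)
Lemma T_split_only1 k f A z : (1 <= k)%nat -> decays f A -> z <> RtoC 0 ->
  T_op k f z = (T_rest k f only1 z - z ^ k * f (/ z - 1))%C.
Proof.
  intros Hk HA Hz.
  rewrite (T_rest_eq k f A only1 2 z Hk HA Hz) by (intros m H; apply Nat.eqb_neq; lia).
  rewrite !csum_S. simpl only1. simpl csum. cbv iota. change (RtoC (INR 1)) with (RtoC 1).
  change (only1 1) with true. change (only1 2) with false. cbv iota. change (RtoC (INR 1)) with (RtoC 1). ring.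
Qed.

Definition T_iter (k : nat) (phi : C -> C) (j : nat) : C -> C := Nat.iter j (T_op k) phi.
(** For [j = 1] the singular part of [T_k phi (w1 + 1)] is left out: it is the
    second explicit term of the decomposition. *)
Definition shifted (k : nat) (phi : C -> C) (j : nat) (w1 : C) : C :=
  if Nat.eqb j 1 then T_rest k phi only1 (w1 + 1) else T_iter k phi j (w1 + 1).
(** What one step of the orbit from [w] to [w1 = 1 / w - m1] adds to [- w ^ k]
    times the value of the [j]-th iterate at [w1]. *)
Definition transit (k : nat) (phi : C -> C) (j m1 : nat) (w w1 : C) : C :=
  (T_rest k (T_iter k phi j) (near3 m1) w - w ^ k * (T_iter k phi j (w1 - 1) + epsm m1 * shifted k phi j w1))%C.

Definition orbit_weight (k : nat) (m : nat -> nat) (z0 : C) (i : nat) : C :=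
  (RtoC (-1) ^ (i * (k + 1)) * cf_form m i z0 ^ k)%C.
(** The transits of the first [i] steps, each multiplied by the product of the
    factors [- z_l ^ k] of the previous steps. *)
Fixpoint transit_sum (k : nat) (phi : C -> C) (n : nat) (m : nat -> nat) (z0 : C) (i : nat) : C :=
  match i with
  | O => RtoC 0
  | S i' => (transit_sum k phi n m z0 i' + orbit_weight k m z0 i' * transit k phi (n - 1 - i') (m (S i')) (cf_orbit m z0 i') (cf_orbit m z0 (S i')))%C
  end.
(** The explicit form of the remainder. It makes sense at real points, where
    the iterates themselves do not. *)
Definition remainder_ext (k n : nat) (m : nat -> nat) (phi : C -> C) (z0 : C) : C :=
  (transit_sum k phi n m z0 (n - 1) + orbit_weight k m z0 (n - 1) * T_rest k phi (near3 (m n)) (cf_orbit m z0 (n - 1)))%C.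

Lemma orbit_weight_0 k m z0 : orbit_weight k m z0 0 = RtoC 1.
Proof.
  unfold orbit_weight, cf_form. change (RtoC (-1) ^ (0 * (k + 1)))%C with (RtoC 1). change (INR (cf_num m 0)) with 1. change (INR (cf_den m 0)) with 0.
  replace (1 - 0 * z0)%C with (RtoC 1) by ring. rewrite Cpow_1_l. ring.
Qed.

Lemma transit_sum_S k phi n m z0 i : transit_sum k phi n m z0 (S i) =
  (transit_sum k phi n m z0 i + orbit_weight k m z0 i * transit k phi (n - 1 - i) (m (S i)) (cf_orbit m z0 i) (cf_orbit m z0 (S i)))%C.
Proof. reflexivity. Qed.

Lemma orbit_weight_S k m z0 i : (forall l, (l < S i)%nat -> cf_orbit m z0 l <> RtoC 0) ->
  orbit_weight k m z0 (S i) = (- (orbit_weight k m z0 i * cf_orbit m z0 i ^ k))%C.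
Proof.
  intros H. unfold orbit_weight. rewrite cf_form_step by exact H.
  replace (S i * (k + 1))%nat with (i * (k + 1) + S k)%nat by lia. rewrite Cpow_add_r, Cpow_S.
  replace (- cf_orbit m z0 i * cf_form m i z0)%C with (RtoC (-1) * (cf_orbit m z0 i * cf_form m i z0))%C by ring.
  rewrite !Cpow_mult_l.
  assert (E : (RtoC (-1) ^ k * RtoC (-1) ^ k)%C = RtoC 1).
  { rewrite <- Cpow_mult_l. replace (RtoC (-1) * RtoC (-1))%C with (RtoC 1). apply Cpow_1_l. rewrite <- RtoC_mult. f_equal. ring. }
  set (s := (RtoC (-1) ^ k)%C) in *. set (a := (RtoC (-1) ^ (i * (k + 1)))%C). set (b := (cf_orbit m z0 i ^ k)%C). set (c := (cf_form m i z0 ^ k)%C).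
  replace (a * (RtoC (-1) * s) * (s * (b * c)))%C with (a * RtoC (-1) * (s * s) * (b * c))%C by ring. rewrite E.
  ring.
Qed.

Lemma T_iter_S k phi j : T_iter k phi (S j) = T_op k (T_iter k phi j).
Proof. reflexivity. Qed.

Lemma orbit_S m z0 i : cf_orbit m z0 (S i) = (/ cf_orbit m z0 i - INR (m (S i)))%C.
Proof. reflexivity. Qed.

Theorem remainder_eq k n m phi A z0 : (1 <= k)%nat -> (1 <= n)%nat -> decays phi A -> (forall i, (1 <= i <= n)%nat -> (1 <= m i)%nat) ->
  D_cyl n m z0 -> remainder k n m phi z0 = remainder_ext k n m phi z0.
Proof.
  intros Hk Hn HA Hm HD. destruct (decays_iter k Hk) as [K [HK HI]].
  assert (Hdec : forall j, exists B, decays (T_iter k phi j) B) by (intros j; eexists; apply HI, HA).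
  assert (H0 : forall l, (l < n)%nat -> cf_orbit m z0 l <> RtoC 0) by (intros l Hl; apply D_set_facts, HD, Hl).
  assert (Hp : forall i, (i < n)%nat -> orbit_weight k m z0 (S i) = (- (orbit_weight k m z0 i * cf_orbit m z0 i ^ k))%C).
  { intros i Hi. apply orbit_weight_S. intros l Hl. apply H0; lia. }
  (* Up to [z_(n-2)] the next iterate has order at least 2, and a step leaves
     no singular part behind. *)
  assert (C1 : forall i, (i + 2 <= n \/ i = 0)%nat -> T_iter k phi n z0 = (orbit_weight k m z0 i * T_iter k phi (n - i) (cf_orbit m z0 i) + transit_sum k phi n m z0 i)%C).
  { induction i as [|i IH]; intros Hi.
    - rewrite Nat.sub_0_r, orbit_weight_0. simpl. ring.
    - rewrite (IH ltac:(lia)). destruct (Hdec (n - S i)%nat) as [B HB].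
      replace (n - i)%nat with (S (n - S i)) by lia. rewrite T_iter_S.
      rewrite (T_split_near3 k _ B (m (S i)) (cf_orbit m z0 i) Hk HB) by (try apply H0; try apply Hm; lia).
      rewrite transit_sum_S, <- orbit_S. rewrite Hp by lia.
      replace (n - 1 - i)%nat with (n - S i)%nat by lia. unfold transit, shifted.
      replace (Nat.eqb (n - S i) 1) with false by (symmetry; apply Nat.eqb_neq; lia). ring. }
  (* The step to [z_(n-1)] leaves the second explicit term. *)
  assert (C2 : T_iter k phi n z0 = (orbit_weight k m z0 (n - 1) * T_iter k phi 1 (cf_orbit m z0 (n - 1)) + transit_sum k phi n m z0 (n - 1) - second_term k n m phi z0)%C).
  { destruct n as [|[|p]]; [lia| |].
    - unfold second_term. simpl (1 - 1)%nat. change (eps m 0) with 0. rewrite orbit_weight_0. simpl transit_sum. simpl cf_orbit. ring.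
    - replace (S (S p) - 1)%nat with (S p) by lia.
      rewrite (C1 p) by lia. replace (S (S p) - p)%nat with 2%nat by lia. rewrite (T_iter_S k phi 1).
      destruct (Hdec 1%nat) as [B HB].
      rewrite (T_split_near3 k _ B (m (S p)) (cf_orbit m z0 p) Hk HB) by (try apply H0; try apply Hm; lia).
      rewrite transit_sum_S, <- orbit_S. rewrite Hp by lia.
      replace (S (S p) - 1 - p)%nat with 1%nat by lia. unfold transit, shifted. simpl Nat.eqb. cbv iota.
      unfold second_term. replace (S (S p) - 1)%nat with (S p) by lia. change (eps m (S p)) with (epsm (m (S p))).
      set (w1 := cf_orbit m z0 (S p)). set (w := cf_orbit m z0 p).
      assert (Hw1 : (w1 + 1)%C <> RtoC 0).
      { destruct (D_set_facts w1) as [_ [Hr _]]. apply HD; lia. intros E. assert (Re (w1 + 1)%C = 0) by (rewrite E; reflexivity).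
        change (Re (w1 + 1)%C) with (Re w1 + 1) in H. lra. }
      change (T_iter k phi 1 (w1 + 1)%C) with (T_op k phi (w1 + 1)%C).
      rewrite (T_split_only1 k phi A (w1 + 1)%C Hk HA Hw1).
      replace (/ (w1 + 1) - 1)%C with (- (w1 / (1 + w1)))%C by (field; repeat split; first [exact Hw1 | rewrite Cplus_comm; exact Hw1]).
      rewrite (Cplus_comm 1 w1).
      fold (orbit_weight k m z0 (S p)). rewrite (Hp p) by lia. fold w. ring. }
  unfold remainder. change (Nat.iter n (T_op k) phi z0) with (T_iter k phi n z0). rewrite C2. rewrite (T_iter_S k phi 0).
  change (T_iter k phi 0) with phi.
  rewrite (T_split_near3 k phi A (m n) (cf_orbit m z0 (n - 1)) Hk HA) by (try apply H0; try apply Hm; lia).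
  unfold remainder_ext, main_term. fold (orbit_weight k m z0 n).
  destruct n as [|p]; [lia|]. replace (S p - 1)%nat with p by lia. rewrite <- orbit_S, (Hp p) by lia.
  change (eps m (S p)) with (epsm (m (S p))). ring.
Qed.

(** * Bound for the remainder *)

Lemma T_rest_false k f z : T_rest k f (fun _ => false) z = T_op k f z.
Proof. unfold T_rest, T_op. f_equal. apply functional_extensionality. intros i. unfold T_rest_term. ring. Qed.

Lemma near3_complement z m1 i : near3 m1 (S i) = false -> - (1/5) <= Re (/ z - INR m1)%C <= 1 ->
  Re (/ z - INR (S i))%C <= -1 \/ 2 + Re (/ z - INR m1)%C <= Re (/ z - INR (S i))%C.
Proof.
  rewrite near3_false, !Re_minus_INR. intros [H|H] Hr; [left|right].
  - assert (INR m1 + 2 <= INR (S i)) by (replace (INR m1 + 2) with (INR (S (S m1))) by (rewrite !S_INR; ring); apply le_INR; lia). lra.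
  - assert (INR (S i) + 2 <= INR m1) by (replace (INR (S i) + 2) with (INR (S (S (S i)))) by (rewrite !S_INR; ring); apply le_INR; lia). lra.
Qed.

Lemma near3_le z m1 i : z <> RtoC 0 -> (1 <= m1)%nat -> near3 m1 (S i) = true -> - (1/5) <= Re (/ z - INR m1)%C <= 1 ->
  INR (S i) * Cmod z < 5.
Proof.
  intros Hz Hm. rewrite near3_spec, Re_minus_INR. intros [H _] Hr.
  assert (Hm1 : 1 <= INR m1) by (apply (le_INR 1); exact Hm).
  assert (Hi : INR (S i) <= INR m1 + 1) by (rewrite <- S_INR; apply le_INR; exact H).
  assert (Hzm : 0 < Cmod z) by (apply Cmod_gt_0; exact Hz).
  assert (X := Re_le_Cmod (/ z)). rewrite Cmod_inv in X by exact Hz.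
  assert (Y : (INR m1 - 1/5) * Cmod z <= 1). { apply Rle_trans with (/ Cmod z * Cmod z). apply Rmult_le_compat_r; lra. rewrite Rinv_l; lra. }
  assert (INR (S i) * Cmod z <= (INR m1 + 1) * Cmod z) by (apply Rmult_le_compat_r; lra).
  assert (1 * Cmod z <= INR m1 * Cmod z) by (apply Rmult_le_compat_r; lra). lra.
Qed.

Lemma T_rest_near3_bound k : (1 <= k)%nat -> exists K, 0 <= K /\ forall f A A' m1 z, decays f A -> 0 <= A' -> z <> RtoC 0 -> (1 <= m1)%nat ->
  - (1/5) <= Re (/ z - INR m1)%C <= 1 -> (forall v, 2 + Re (/ z - INR m1)%C <= Re v -> Cmod (f v) <= A') ->
  Cmod (T_rest k f (near3 m1) z) <= K * (A + A').
Proof.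
  intros Hk. destruct (T_rest_bound k Hk) as [K [HK H]]. exists (2 * K). split. lra.
  intros f A A' m1 z HA HA' Hz Hm Hr Hf. assert (HA0 : 0 <= A) by apply HA.
  assert (X : Cmod (T_rest k f (near3 m1) z) <= K * (A + (A + A'))).
  { apply (H f A (A + A') (near3 m1) (m1 + 2)%nat z HA); [lra|exact Hz| | |].
    - intros m Hm'. apply near3_false. lia.
    - intros i Hi. apply (near3_le z m1); assumption.
    - intros i Hi _. destruct (near3_complement z m1 i Hi Hr) as [V|V].
      + apply Rle_trans with (A / 1). apply (decays_bound f A); auto; try lra. generalize (Re_neg_le_Cmod (/ z - INR (S i))%C). lra. lra.
      + apply Rle_trans with A'. apply Hf, V. lra. }
  assert (0 <= K * A') by (apply Rmult_le_pos; lra). lra.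
Qed.

Lemma T_rest_near3_diff k f A m1 z : (1 <= k)%nat -> decays f A -> hol_off01 f -> z <> RtoC 0 ->
  - (1/5) <= Re (/ z - INR m1)%C <= 1 -> C_differentiable (T_rest k f (near3 m1)) z.
Proof.
  intros Hk HA Hf Hz Hr. apply (T_rest_diff k f A (near3 m1) (m1 + 2)%nat z Hk HA Hz).
  - intros m Hm. apply near3_false. lia.
  - intros i Hi. apply Hf. destruct (near3_complement z m1 i Hi Hr) as [V|V].
    + apply not_segment_Re_neg; lra.
    + apply not_segment_Re_gt1; lra.
Qed.

(** For [Re v >= 2] every [1 / v - m] has real part at most [- 1/2]. *)
Lemma T_right_bound k : (1 <= k)%nat -> exists K, 0 <= K /\ forall f A v, decays f A -> 2 <= Re v -> Cmod (T_op k f v) <= K * A.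
Proof.
  intros Hk. destruct (T_rest_bound k Hk) as [K [HK H]]. exists (3 * K). split. lra.
  intros f A v HA Hv. assert (HA0 : 0 <= A) by apply HA. rewrite <- T_rest_false.
  assert (Hn : v <> RtoC 0) by (intros ->; simpl in Hv; lra).
  apply Rle_trans with (K * (A + 2 * A)); [|lra].
  apply (H f A (2 * A) (fun _ => false) 0%nat v HA); auto; try lra; try discriminate.
  intros i _ _. assert (Hm := INR_S_ge1 i).
  assert (X : Re (/ v)%C <= 1 / 2).
  { eapply Rle_trans. apply Re_le_Cmod. rewrite Cmod_inv by exact Hn. replace (1/2) with (/ 2) by field. apply Rinv_le_contravar; [lra|]. generalize (Re_le_Cmod v); lra. }
  apply Rle_trans with (A / (1/2)); [|lra]. apply (decays_bound f A); auto; try lra; try (rewrite Re_minus_INR; lra).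
  generalize (Re_neg_le_Cmod (/ v - INR (S i))%C). rewrite Re_minus_INR. lra.
Qed.

Lemma inv_shift_bounds w1 : 0 < Re w1 -> (w1 + 1)%C <> RtoC 0 /\ Re (/ (w1 + 1))%C <= 1 /\ 1 < Re (w1 + 1)%C.
Proof.
  intros Hr. assert (R1 : Re (w1 + 1)%C = Re w1 + 1) by reflexivity.
  assert (Hn : (w1 + 1)%C <> RtoC 0) by (intros E; rewrite E in R1; simpl in R1; lra). split; [exact Hn|]. split; [|lra].
  eapply Rle_trans. apply Re_le_Cmod. rewrite Cmod_inv by exact Hn. apply Rle_trans with (/ 1); [|lra]. apply Rinv_le_contravar; [lra|].
  generalize (Re_le_Cmod (w1 + 1)%C). lra.
Qed.

Lemma only1_false i : only1 (S i) = false -> 2 <= INR (S i).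
Proof. unfold only1. intros H. apply Nat.eqb_neq in H. apply (le_INR 2). lia. Qed.

Lemma T_rest_only1_bound k : (1 <= k)%nat -> exists K, 0 <= K /\ forall f A w1, decays f A -> 0 < Re w1 -> Cmod w1 <= 1 ->
  Cmod (T_rest k f only1 (w1 + 1)%C) <= K * A.
Proof.
  intros Hk. destruct (T_rest_bound k Hk) as [K [HK H]]. exists (2 * K). split. lra.
  intros f A w1 HA Hr Hc. assert (HA0 : 0 <= A) by apply HA. destruct (inv_shift_bounds w1 Hr) as [Hn [Hi _]].
  apply Rle_trans with (K * (A + A)); [|lra].
  apply (H f A A only1 2%nat (w1 + 1)%C HA); auto; try lra.
  - intros m Hm. apply Nat.eqb_neq. lia.
  - intros i Hi'. unfold only1 in Hi'. apply Nat.eqb_eq in Hi'. rewrite Hi'. change (INR 1) with 1.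
    assert (Cmod (w1 + 1) <= Cmod w1 + Cmod 1) by apply Cmod_triangle. rewrite Cmod_1 in H0. lra.
  - intros i Hi' _. apply only1_false in Hi'. apply Rle_trans with (A / 1); [|lra].
    apply (decays_bound f A); auto; try lra; try (rewrite Re_minus_INR; lra).
    generalize (Re_neg_le_Cmod (/ (w1 + 1) - INR (S i))%C). rewrite Re_minus_INR. lra.
Qed.

Lemma T_rest_only1_diff k f A w1 : (1 <= k)%nat -> decays f A -> 0 < Re w1 -> C_differentiable (T_rest k f only1) (w1 + 1)%C.
Proof.
  intros Hk HA Hr. destruct (inv_shift_bounds w1 Hr) as [Hn [Hi _]].
  apply (T_rest_diff k f A only1 2 _ Hk HA Hn).
  - intros m Hm. apply Nat.eqb_neq. lia.
  - intros i Hi'. apply only1_false in Hi'. apply HA. rewrite Re_minus_INR. lra.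
Qed.

(** The iterates of order [j - 1] and [j - 2] occur in a transit of order [j];
    their bounds differ from that of order [j] by a constant factor. *)
Lemma decays_T_iter k : (1 <= k)%nat -> exists L, 1 <= L /\ forall phi A, decays phi A ->
  (forall j, decays (T_iter k phi j) (L * gold ^ (j * k) * A)) /\ (forall j, decays (T_iter k phi (pred j)) (L * gold ^ (j * k) * A)) /\
  (forall j, decays (T_iter k phi (pred (pred j))) (L * gold ^ (j * k) * A)).
Proof.
  intros Hk. destruct (decays_iter k Hk) as [K [HK HI]]. assert (Hg := gold_bounds).
  assert (Hgk : 0 < gold ^ k <= 1). { split. apply pow_lt; lra. rewrite <- (pow1 k). apply pow_incr; lra. }
  set (q := / gold ^ k). assert (Hq : 1 <= q). { unfold q. rewrite <- Rinv_1. apply Rinv_le_contravar; lra. }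
  assert (Hqg : q * gold ^ k = 1) by (unfold q; apply Rinv_l; lra).
  exists ((1 + K) * (q * q)). assert (Hqq : 1 <= q * q) by nra. split. nra.
  intros phi A HA. assert (HA0 : 0 <= A) by apply HA.
  assert (S1 : forall j, gold ^ (pred j * k) <= q * gold ^ (j * k)).
  { intros [|j]. simpl. lra. simpl pred. replace (S j * k)%nat with (k + j * k)%nat by lia. rewrite pow_add.
    rewrite <- Rmult_assoc, Hqg. lra. }
  assert (Hpos : forall j, 0 < gold ^ (j * k)) by (intros; apply pow_lt; lra).
  assert (B0 : forall j x, x <= q * q * gold ^ (j * k) -> 0 <= x -> K * x * A <= (1 + K) * (q * q) * gold ^ (j * k) * A).
  { intros j x Hx Hx0. apply Rmult_le_compat_r; [exact HA0|]. rewrite (Rmult_assoc (1 + K)). apply Rmult_le_compat; lra. }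
  assert (Q1 : forall x, 0 <= x -> x <= q * x) by (intros; nra).
  split; [|split]; intros j.
  - apply (decays_mono _ _ _ (HI phi A j HA)). apply B0; [|apply Rlt_le, Hpos]. specialize (Hpos j). nra.
  - apply (decays_mono _ _ _ (HI phi A (pred j) HA)). apply B0; [|apply Rlt_le, Hpos]. specialize (S1 j). specialize (Hpos j).
    assert (q * gold ^ (j * k) <= q * (q * gold ^ (j * k))) by (apply Q1, Rmult_le_pos; lra). lra.
  - apply (decays_mono _ _ _ (HI phi A (pred (pred j)) HA)). apply B0; [|apply Rlt_le, Hpos].
    assert (X1 := S1 j). assert (X2 := S1 (pred j)).
    assert (q * gold ^ (pred j * k) <= q * (q * gold ^ (j * k))) by (apply Rmult_le_compat_l; lra). lra.
Qed.

(** The iterate of order [j] is evaluated at points of real part at most [-1],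
    where it decays; at points of real part at least [2]; at [w1 - 1] and at
    [w1 + 1]. In the last three cases it is expressed by iterates of lower
    order. *)
Lemma transit_bound k : (1 <= k)%nat -> exists K, 0 <= K /\ forall phi A j m1 w w1, decays phi A -> (1 <= j)%nat -> (1 <= m1)%nat ->
  w <> RtoC 0 -> Cmod w <= 1 -> w1 = (/ w - INR m1)%C -> 0 < Re w1 <= 1 -> Cmod w1 <= 1 ->
  Cmod (transit k phi j m1 w w1) <= K * (gold ^ (j * k) * A).
Proof.
  intros Hk. destruct (decays_T_iter k Hk) as [L [HL HD]]. destruct (T_rest_near3_bound k Hk) as [K1 [HK1 HR]].
  destruct (T_right_bound k Hk) as [K2 [HK2 HT]]. destruct (T_left_bound k Hk) as [K3 [HK3 HV]].
  destruct (T_rest_only1_bound k Hk) as [K4 [HK4 HO]].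
  assert (H2k : 1 <= 2 ^ k) by (apply pow_R1_Rle; lra).
  set (K := K1 * (1 + K2) + K3 + (K4 + 2 ^ k * K3)).
  assert (P1 : 0 <= K1 * (1 + K2)) by (apply Rmult_le_pos; lra). assert (P2 : 0 <= 2 ^ k * K3) by (apply Rmult_le_pos; lra).
  exists (K * L). split. apply Rmult_le_pos; [unfold K; lra|lra].
  intros phi A j m1 w w1 HA Hj Hm Hw Hwc Ew Hr Hc. assert (HA0 : 0 <= A) by apply HA. assert (Hg := gold_bounds).
  destruct (HD phi A HA) as [D0 [D1 D2]]. specialize (D0 j). specialize (D1 j). specialize (D2 j).
  set (a := L * gold ^ (j * k) * A) in *. assert (Ha : 0 <= a) by apply D0.
  replace (K * L * (gold ^ (j * k) * A)) with (K * a) by (unfold a; ring).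
  assert (EJ : T_iter k phi j = T_op k (T_iter k phi (pred j))) by (destruct j; [lia|reflexivity]).
  assert (B1 : Cmod (T_rest k (T_iter k phi j) (near3 m1) w) <= K1 * (a + K2 * a)).
  { apply HR; auto. apply Rmult_le_pos; lra. rewrite <- Ew; lra. rewrite <- Ew. intros v Hv. rewrite EJ. apply HT; [exact D1|lra]. }
  assert (B2 : Cmod (T_iter k phi j (w1 - 1)%C) <= K3 * a).
  { rewrite EJ. apply HV; [exact D1|]. apply Re_inv_neg. change (Re (w1 - 1)%C) with (Re w1 - 1). lra. }
  assert (B3 : Cmod (shifted k phi j w1) <= K4 * a + 2 ^ k * (K3 * a)).
  { assert (Q : 0 <= 2 ^ k * (K3 * a)) by (apply Rmult_le_pos; [lra|apply Rmult_le_pos; lra]).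
    unfold shifted. destruct (Nat.eqb j 1) eqn:Ej.
    - apply Nat.eqb_eq in Ej. subst j. simpl pred in D1. change (T_iter k phi 0) with phi in D1.
      apply Rle_trans with (K4 * a); [|lra]. apply HO; [exact D1|lra|exact Hc].
    - apply Nat.eqb_neq in Ej. destruct (inv_shift_bounds w1 (proj1 Hr)) as [Hn [Hi _]].
      rewrite EJ, (T_split_only1 k _ a (w1 + 1)%C Hk D1 Hn).
      eapply Rle_trans. apply Cmod_sub_le. rewrite Cmod_mult, Cmod_pow. apply Rplus_le_compat.
      + apply HO; [exact D1|lra|exact Hc].
      + apply Rmult_le_compat; [apply pow_le, Cmod_ge_0|apply Cmod_ge_0| |].
        * apply pow_incr. split; [apply Cmod_ge_0|]. assert (X : Cmod (w1 + 1) <= Cmod w1 + Cmod 1) by apply Cmod_triangle. rewrite Cmod_1 in X. lra.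
        * assert (EJ2 : T_iter k phi (pred j) = T_op k (T_iter k phi (pred (pred j)))) by (destruct j as [|[|j]]; [lia|lia|reflexivity]).
          rewrite EJ2. apply HV; [exact D2|]. apply Re_inv_neg. change (Re (/ (w1 + 1) - 1)%C) with (Re (/ (w1 + 1))%C - 1). lra. }
  unfold transit. eapply Rle_trans. apply Cmod_sub_le. rewrite Cmod_mult, Cmod_pow.
  assert (W : Cmod w ^ k <= 1). { rewrite <- (pow1 k). apply pow_incr. split; [apply Cmod_ge_0|exact Hwc]. }
  assert (B4 : Cmod (T_iter k phi j (w1 - 1) + epsm m1 * shifted k phi j w1)%C <= K3 * a + (K4 * a + 2 ^ k * (K3 * a))).
  { eapply Rle_trans. apply Cmod_triangle. apply Rplus_le_compat. exact B2. rewrite Cmod_mult, Cmod_R.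
    assert (E : Rabs (epsm m1) <= 1). { unfold epsm. destruct (Nat.eqb m1 1). rewrite Rabs_R0; lra. rewrite Rabs_R1; lra. }
    apply Rle_trans with (1 * Cmod (shifted k phi j w1)). apply Rmult_le_compat_r; [apply Cmod_ge_0|exact E]. lra. }
  assert (B5 : Cmod w ^ k * Cmod (T_iter k phi j (w1 - 1) + epsm m1 * shifted k phi j w1)%C <= 1 * (K3 * a + (K4 * a + 2 ^ k * (K3 * a)))).
  { apply Rmult_le_compat; auto. apply pow_le, Cmod_ge_0. apply Cmod_ge_0. }
  unfold K. lra.
Qed.

Lemma orbit_weight_bound n m k z0 : D_cyl n m z0 -> (forall i, (1 <= i <= n)%nat -> (1 <= m i)%nat) ->
  forall i, (i < n)%nat -> Cmod (orbit_weight k m z0 i) <= 2 ^ k * gold ^ (i * k).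
Proof.
  intros HD Hm i Hi. unfold orbit_weight. rewrite Cmod_mult, !Cmod_pow, Cmod_R. replace (Rabs (-1)) with 1 by (rewrite Rabs_left; lra).
  rewrite pow1, Rmult_1_l. rewrite pow_mult, <- Rpow_mult_distr. apply pow_incr. split. apply Cmod_ge_0. apply (cf_form_bound n); assumption.
Qed.

Theorem remainder_ext_bound k : (1 <= k)%nat -> exists K, 0 < K /\ forall phi A A' n m z0, decays phi A -> 0 <= A' -> (forall v, 9 / 5 <= Re v -> Cmod (phi v) <= A') ->
  (1 <= n)%nat -> (forall i, (1 <= i <= n)%nat -> (1 <= m i)%nat) -> D_cyl n m z0 ->
  Cmod (remainder_ext k n m phi z0) <= K * INR n * gold ^ (n * k) * (A + A').
Proof.
  intros Hk. destruct (transit_bound k Hk) as [K1 [HK1 HE]]. destruct (T_rest_near3_bound k Hk) as [K2 [HK2 HR]].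
  assert (Hg := gold_bounds). assert (Hgk : 0 < gold ^ k) by (apply pow_lt; lra). assert (H2k : 0 < 2 ^ k) by (apply pow_lt; lra).
  exists (2 ^ k * (1 + K1 + K2) / gold ^ k). split. apply Rdiv_lt_0_compat; [apply Rmult_lt_0_compat; lra|lra].
  intros phi A A' n m z0 HA HA' Hf Hn Hm HD. assert (HA0 : 0 <= A) by apply HA.
  assert (HO : forall i, (i < n)%nat -> cf_orbit m z0 i <> RtoC 0 /\ 0 < Re (cf_orbit m z0 i) <= 1 /\ Cmod (cf_orbit m z0 i) <= 1).
  { intros i Hi. apply D_set_facts, HD, Hi. }
  set (G := gold ^ ((n - 1) * k)). assert (HG : 0 < G) by (apply pow_lt; lra).
  assert (C1 : forall i, (i <= n - 1)%nat -> Cmod (transit_sum k phi n m z0 i) <= INR i * (2 ^ k * (K1 * (G * A)))).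
  { induction i as [|i IH]; intros Hi.
    - simpl. rewrite Cmod_0. lra.
    - rewrite transit_sum_S, S_INR, Rmult_plus_distr_r, Rmult_1_l. eapply Rle_trans. apply Cmod_triangle. apply Rplus_le_compat. apply IH; lia.
      rewrite Cmod_mult.
      assert (X1 := orbit_weight_bound n m k z0 HD Hm i ltac:(lia)).
      destruct (HO i ltac:(lia)) as [O1 [O2 O3]]. destruct (HO (S i) ltac:(lia)) as [O4 [O5 O6]].
      assert (X2 : Cmod (transit k phi (n - 1 - i) (m (S i)) (cf_orbit m z0 i) (cf_orbit m z0 (S i))) <= K1 * (gold ^ ((n - 1 - i) * k) * A)).
      { apply HE; auto; try lia. apply Hm; lia. }
      replace (2 ^ k * (K1 * (G * A))) with ((2 ^ k * gold ^ (i * k)) * (K1 * (gold ^ ((n - 1 - i) * k) * A))).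
      apply Rmult_le_compat; auto; apply Cmod_ge_0.
      unfold G. replace ((n - 1) * k)%nat with (i * k + (n - 1 - i) * k)%nat by nia. rewrite pow_add. ring. }
  assert (C2 : Cmod (T_rest k phi (near3 (m n)) (cf_orbit m z0 (n - 1))) <= K2 * (A + A')).
  { assert (EO : cf_orbit m z0 n = (/ cf_orbit m z0 (n - 1) - INR (m n))%C). { destruct n; [lia|]. replace (S n - 1)%nat with n by lia. reflexivity. }
    assert (Y := cyl_facts n m z0 n HD (le_n _)).
    apply HR; [exact HA|exact HA'|apply HO; lia|apply Hm; lia|rewrite <- EO; exact Y|]. rewrite <- EO. intros v Hv. apply Hf. lra. }
  specialize (C1 (n - 1)%nat (le_n _)).
  assert (X1 := orbit_weight_bound n m k z0 HD Hm (n - 1) ltac:(lia)). fold G in X1.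
  unfold remainder_ext. eapply Rle_trans. apply Cmod_triangle. rewrite Cmod_mult.
  assert (X2 : Cmod (orbit_weight k m z0 (n - 1)) * Cmod (T_rest k phi (near3 (m n)) (cf_orbit m z0 (n - 1))) <= (2 ^ k * G) * (K2 * (A + A'))).
  { apply Rmult_le_compat; auto; apply Cmod_ge_0. }
  assert (EG : gold ^ (n * k) = gold ^ k * G). { unfold G. rewrite <- pow_add. f_equal. nia. }
  assert (HN : 1 <= INR n) by (apply (le_INR 1); exact Hn).
  assert (HN1 : INR (n - 1) <= INR n) by (apply le_INR; lia).
  rewrite EG. replace (2 ^ k * (1 + K1 + K2) / gold ^ k * INR n * (gold ^ k * G) * (A + A')) with (INR n * (2 ^ k * G * ((1 + K1 + K2) * (A + A')))) by (field; lra).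
  assert (P0 : 0 <= 2 ^ k * G) by (apply Rmult_le_pos; lra).
  assert (P1 : 0 <= K1 * A) by (apply Rmult_le_pos; lra). assert (P1' : 0 <= K1 * A') by (apply Rmult_le_pos; lra).
  assert (P2 : 0 <= K2 * (A + A')) by (apply Rmult_le_pos; lra).
  apply Rle_trans with (INR n * (2 ^ k * G * (K1 * A)) + INR n * (2 ^ k * G * (K2 * (A + A')))).
  - apply Rplus_le_compat. eapply Rle_trans. exact C1. replace (2 ^ k * (K1 * (G * A))) with (2 ^ k * G * (K1 * A)) by ring.
    apply Rmult_le_compat_r; [apply Rmult_le_pos; lra|exact HN1].
    eapply Rle_trans. exact X2. rewrite <- (Rmult_1_l (2 ^ k * G * (K2 * (A + A')))) at 1. apply Rmult_le_compat_r; [apply Rmult_le_pos; lra|exact HN].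
  - rewrite <- Rmult_plus_distr_l. apply Rmult_le_compat_l; [lra|]. rewrite <- Rmult_plus_distr_l. apply Rmult_le_compat_l; [exact P0|]. lra.
Qed.

(** * Regularity of the remainder *)

Lemma orbit_diff m z0 i : (forall l, (l < i)%nat -> cf_orbit m z0 l <> RtoC 0) -> C_differentiable (fun z => cf_orbit m z i) z0.
Proof.
  induction i as [|i IH]; intros H. apply diff_id.
  apply (diff_minus (fun z => / cf_orbit m z i)%C (fun _ => RtoC (INR (m (S i))))).
  apply diff_inv. apply H; lia. apply IH. intros; apply H; lia. apply diff_const.
Qed.

Lemma orbit_deriv m z0 i : (forall l, (l < i)%nat -> cf_orbit m z0 l <> RtoC 0) ->
  exists l, l <> RtoC 0 /\ CD (fun z => cf_orbit m z i) z0 l.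
Proof.
  induction i as [|i IH]; intros H.
  - exists (RtoC 1). split. intros E; apply RtoC_inj in E; lra. apply CD_id.
  - destruct IH as [l [Hl Dl]]. intros; apply H; lia. assert (Hz := H i ltac:(lia)).
    exists (- (l / (cf_orbit m z0 i * cf_orbit m z0 i)) - 0)%C. split.
    + intros E. apply Hl.
      replace l with (- ((- (l / (cf_orbit m z0 i * cf_orbit m z0 i)) - 0) * (cf_orbit m z0 i * cf_orbit m z0 i)))%C by (field; exact Hz).
      rewrite E. ring.
    + apply (CD_minus (fun z => / cf_orbit m z i)%C (fun _ => RtoC (INR (m (S i))))). apply CD_inv. exact Hz. exact Dl. apply CD_const.
Qed.

(** Moving from [z0] in the direction [1 / l] increases the real part of
    [f]. *)
Lemma open_map_Re f z0 l d : CD f z0 l -> l <> RtoC 0 -> 0 < d -> (forall w, Cmod (w - z0) < d -> Re (f w) <= Re (f z0)) -> False.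
Proof.
  intros Hf Hl Hd H. assert (Hm : 0 < Cmod l) by (apply Cmod_gt_0; exact Hl).
  destruct (proj1 (CD_eps f z0 l) Hf (Cmod l / 2) ltac:(lra)) as [e [He H']].
  set (t := Rmin (d / 2) (e / 2) * Cmod l). assert (Ht : 0 < Rmin (d / 2) (e / 2)) by (apply Rmin_case; lra).
  assert (Htp : 0 < t) by (apply Rmult_lt_0_compat; lra).
  set (w := (z0 + RtoC t / l)%C). assert (E : (w - z0)%C = (RtoC t / l)%C) by (unfold w; ring).
  assert (Em : Cmod (w - z0) = Rmin (d / 2) (e / 2)). { rewrite E, Cmod_div, Cmod_R, Rabs_pos_eq by (lra || exact Hl). unfold t. field. lra. }
  assert (Hb : Rmin (d / 2) (e / 2) <= d / 2) by apply Rmin_l. assert (Hb' : Rmin (d / 2) (e / 2) <= e / 2) by apply Rmin_r.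
  specialize (H w ltac:(lra)). specialize (H' w ltac:(lra)).
  rewrite Em in H'. replace ((w - z0) * l)%C with (RtoC t) in H' by (rewrite E; field; exact Hl).
  assert (X := Re_neg_le_Cmod (f w - f z0 - RtoC t)%C).
  replace (Re (f w - f z0 - RtoC t)%C) with (Re (f w) - Re (f z0) - t) in X by reflexivity.
  unfold t in *. lra.
Qed.

(** The point [1] of [D] has the largest real part, so that the orbit cannot
    reach it from an interior point of the cylinder, where it depends on [z0]
    by an open map. *)
Lemma interior_orbit n m z0 d i : 0 < d -> (forall w, Cmod (w - z0) < d -> D_cyl n m w) -> (i < n)%nat -> cf_orbit m z0 i <> RtoC 1.
Proof.
  intros Hd H Hi E.
  assert (H0 : D_cyl n m z0). { apply H. rewrite Cmod_sub_diag. exact Hd. }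
  destruct (orbit_deriv m z0 i) as [l [Hl Dl]]. { intros j Hj. apply D_set_facts, H0. lia. }
  apply (open_map_Re _ z0 l d Dl Hl Hd). intros w Hw. rewrite E. change (Re (RtoC 1)) with 1.
  destruct (D_set_facts _ (proj1 (H w Hw) i Hi)) as [_ [X _]]. lra.
Qed.

Lemma hol_off01_T_iter k phi A j : (1 <= k)%nat -> decays phi A -> hol_off01 phi -> hol_off01 (T_iter k phi j).
Proof.
  intros Hk HA Hf. destruct (decays_iter k Hk) as [K [_ HI]].
  induction j as [|j IH]. exact Hf. rewrite T_iter_S. apply (hol_off01_T k _ _ Hk (HI phi A j HA)). exact IH.
Qed.

Lemma shifted_diff k phi A j w1 : (1 <= k)%nat -> decays phi A -> hol_off01 phi -> 0 < Re w1 -> C_differentiable (shifted k phi j) w1.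
Proof.
  intros Hk HA Hf Hr. unfold shifted. destruct (Nat.eqb j 1).
  - apply (diff_comp (T_rest k phi only1) (fun w => w + 1)%C). apply (T_rest_only1_diff k phi A); assumption. apply diff_plus. apply diff_id. apply diff_const.
  - apply (diff_comp (T_iter k phi j) (fun w => w + 1)%C). apply (hol_off01_T_iter k phi A); auto. apply not_segment_Re_gt1.
    apply (inv_shift_bounds w1 Hr). apply diff_plus. apply diff_id. apply diff_const.
Qed.

Lemma orbit_weight_diff k m z0 i : C_differentiable (fun z => orbit_weight k m z i) z0.
Proof.
  unfold orbit_weight. apply diff_mult. apply diff_const. apply diff_pow. unfold cf_form. apply diff_minus. apply diff_const.
  apply diff_mult. apply diff_const. apply diff_id.
Qed.

Definition near_in (D : C -> Prop) (z0 : C) (d : R) (w : C) : Prop := D w /\ Cmod (w - z0) < d.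

Lemma near_in_shrinks D z0 : shrinks (near_in D z0).
Proof. intros d d' x H [H1 H2]. split; [exact H1|lra]. Qed.

Lemma diff_tends D f z0 : C_differentiable f z0 -> tends (near_in D z0) f (f z0).
Proof.
  intros H eps He. destruct (diff_cont f z0 H eps He) as [d [Hd H']]. exists d. split; [exact Hd|]. intros x [_ Hx]. apply H', Hx.
Qed.

Lemma not_segment_sub_1 w1 : Re w1 <= 1 -> w1 <> RtoC 1 -> ~ segment 0 1 (w1 - 1)%C.
Proof.
  intros Hr Hn [H1 H2]. apply Hn. change (Re (w1 - 1)%C) with (Re w1 - 1) in H2.
  apply C_eq_parts; [lra|]. destruct w1 as [a b]. unfold Cminus, Cplus, Copp, RtoC, Im in *; simpl in *. lra.
Qed.

Section Regularity.
Variables (k n : nat) (m : nat -> nat) (phi : C -> C) (A : R) (z0 : C).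
Hypotheses (Hk : (1 <= k)%nat) (Hn : (1 <= n)%nat) (HA : decays phi A) (Hf : hol_off01 phi)
  (Hm : forall i, (1 <= i <= n)%nat -> (1 <= m i)%nat) (HD : D_cyl n m z0).

Let orb_n0 i : (i < n)%nat -> cf_orbit m z0 i <> RtoC 0.
Proof. intros Hi. apply D_set_facts, HD, Hi. Qed.

Let orb_diff i : (i <= n)%nat -> C_differentiable (fun z => cf_orbit m z i) z0.
Proof. intros Hi. apply orbit_diff. intros l Hl. apply orb_n0. lia. Qed.

Let rest_diff j i : (i < n)%nat -> C_differentiable (fun z => T_rest k (T_iter k phi j) (near3 (m (S i))) (cf_orbit m z i)) z0.
Proof.
  intros Hi. destruct (decays_iter k Hk) as [K [_ HI]].
  apply (diff_comp (T_rest k (T_iter k phi j) (near3 (m (S i)))) (fun z => cf_orbit m z i)).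
  - apply (T_rest_near3_diff k _ _ _ _ Hk (HI phi A j HA)). apply (hol_off01_T_iter k phi A); assumption. apply orb_n0, Hi.
    rewrite <- orbit_S. apply (cyl_facts n m z0); [exact HD|lia].
  - apply orb_diff; lia.
Qed.

Lemma transit_sum_diff i : (i <= n - 1)%nat -> (forall l, (l < n)%nat -> cf_orbit m z0 l <> RtoC 1) ->
  C_differentiable (fun z => transit_sum k phi n m z i) z0.
Proof.
  intros Hi H1. induction i as [|i IH]. exact (diff_const (RtoC 0) z0).
  apply (diff_plus (fun z => transit_sum k phi n m z i)
    (fun z => orbit_weight k m z i * transit k phi (n - 1 - i) (m (S i)) (cf_orbit m z i) (cf_orbit m z (S i)))%C).
  apply IH; lia. apply diff_mult. apply orbit_weight_diff. unfold transit. apply diff_minus. apply rest_diff; lia.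
  destruct (D_set_facts _ (proj1 HD (S i) ltac:(lia))) as [_ [Hr _]].
  apply diff_mult. apply diff_pow, orb_diff; lia. apply diff_plus.
  - apply (diff_comp (T_iter k phi (n - 1 - i)) (fun z => cf_orbit m z (S i) - 1)%C).
    apply (hol_off01_T_iter k phi A); auto. apply not_segment_sub_1; [lra|apply H1; lia].
    apply diff_minus. apply orb_diff; lia. apply diff_const.
  - apply diff_mult. apply diff_const. apply (diff_comp (shifted k phi (n - 1 - i)) (fun z => cf_orbit m z (S i))).
    apply (shifted_diff k phi A); auto. lra. apply orb_diff; lia.
Qed.

(** The only factor that may fail to be holomorphic is the value at [z_(i+1) -
    1] when [z_(i+1) = 1]; there [T_cont_0] applies, since the points [z_(i+1)
    - 1] have real part at most [0] on the cylinder. *)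
Lemma transit_sum_tends i : (i <= n - 1)%nat ->
  tends (near_in (D_cyl n m) z0) (fun z => transit_sum k phi n m z i) (transit_sum k phi n m z0 i).
Proof.
  set (N := near_in (D_cyl n m) z0). assert (HS : shrinks N) by apply near_in_shrinks.
  intros Hi. induction i as [|i IH]. exact (diff_tends _ _ _ (diff_const (RtoC 0) z0)).
  destruct (D_set_facts _ (proj1 HD (S i) ltac:(lia))) as [_ [Hr _]].
  assert (P : tends N (fun z => T_iter k phi (n - 1 - i) (cf_orbit m z (S i) - 1)%C) (T_iter k phi (n - 1 - i) (cf_orbit m z0 (S i) - 1)%C)).
  { destruct (excluded_middle_informative (cf_orbit m z0 (S i) = RtoC 1)) as [E|E].
    - rewrite E. replace (1 - 1)%C with (RtoC 0) by ring.
      destruct (decays_iter k Hk) as [K [_ HI]].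
      replace (n - 1 - i)%nat with (S (n - 2 - i)) by lia. rewrite T_iter_S.
      intros eps He. destruct (T_cont_0 k _ _ Hk (HI phi A (n - 2 - i)%nat HA) eps He) as [d [Hd H]].
      destruct (diff_cont _ _ (orb_diff (S i) ltac:(lia)) d Hd) as [d2 [Hd2 H2]].
      exists d2. split; [exact Hd2|]. intros w [Hw1 Hw2]. apply H.
      + apply Re_inv_neg. destruct (D_set_facts _ (proj1 Hw1 (S i) ltac:(lia))) as [_ [Hrw _]].
        change (Re (cf_orbit m w (S i) - 1)%C) with (Re (cf_orbit m w (S i)) - 1). lra.
      + specialize (H2 w Hw2). rewrite E in H2. exact H2.
    - apply (diff_tends _ (fun z => T_iter k phi (n - 1 - i) (cf_orbit m z (S i) - 1)%C)).
      apply (diff_comp (T_iter k phi (n - 1 - i)) (fun z => cf_orbit m z (S i) - 1)%C).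
      apply (hol_off01_T_iter k phi A); auto. apply not_segment_sub_1; [lra|exact E].
      apply diff_minus. apply orb_diff; lia. apply diff_const. }
  rewrite transit_sum_S. unfold transit.
  apply (tends_plus N (fun z => transit_sum k phi n m z i)
    (fun z => orbit_weight k m z i * (T_rest k (T_iter k phi (n - 1 - i)) (near3 (m (S i))) (cf_orbit m z i) - cf_orbit m z i ^ k *
      (T_iter k phi (n - 1 - i) (cf_orbit m z (S i) - 1) + epsm (m (S i)) * shifted k phi (n - 1 - i) (cf_orbit m z (S i)))))%C); [exact HS|apply IH; lia|].
  apply (tends_mult N (fun z => orbit_weight k m z i)); [exact HS|exact (diff_tends _ _ _ (orbit_weight_diff k m z0 i))|].
  apply (tends_plus N); [exact HS|exact (diff_tends _ _ _ (rest_diff (n - 1 - i) i ltac:(lia)))|].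
  apply tends_opp. apply (tends_mult N); [exact HS|exact (diff_tends _ _ _ (diff_pow _ _ k (orb_diff i ltac:(lia))))|].
  apply (tends_plus N); [exact HS|exact P|].
  apply (diff_tends _ (fun z => epsm (m (S i)) * shifted k phi (n - 1 - i) (cf_orbit m z (S i)))%C).
  apply diff_mult. apply diff_const. apply (diff_comp (shifted k phi (n - 1 - i)) (fun z => cf_orbit m z (S i))).
  apply (shifted_diff k phi A); auto. lra. apply orb_diff; lia.
Qed.

Let last_diff : C_differentiable (fun z => orbit_weight k m z (n - 1) * T_rest k phi (near3 (m n)) (cf_orbit m z (n - 1)))%C z0.
Proof.
  apply diff_mult. apply orbit_weight_diff. assert (X := rest_diff 0 (n - 1) ltac:(lia)). replace (S (n - 1)) with n in X by lia. exact X.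
Qed.

Lemma remainder_ext_tends : tends (near_in (D_cyl n m) z0) (remainder_ext k n m phi) (remainder_ext k n m phi z0).
Proof.
  apply (tends_plus _ (fun z => transit_sum k phi n m z (n - 1)) (fun z => orbit_weight k m z (n - 1) * T_rest k phi (near3 (m n)) (cf_orbit m z (n - 1)))%C).
  apply near_in_shrinks. apply transit_sum_tends; lia. exact (diff_tends _ _ _ last_diff).
Qed.

Lemma remainder_ext_diff d : 0 < d -> (forall w, Cmod (w - z0) < d -> D_cyl n m w) -> C_differentiable (remainder_ext k n m phi) z0.
Proof.
  intros Hd H. apply (diff_plus (fun z => transit_sum k phi n m z (n - 1))). 2: exact last_diff.
  apply transit_sum_diff. lia. intros l Hl. apply (interior_orbit n m z0 d); assumption.
Qed.

End Regularity.

(** The factor [sqrt 2] compares the balls of the product structure with the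
    discs. *)
Lemma continuous_on_tends D g : (forall z, D z -> tends (near_in D z) g (g z)) -> continuous_on D g.
Proof.
  intros H z Hz. apply filterlim_locally. intros eps.
  destruct (H z Hz eps (cond_pos eps)) as [d [Hd H']].
  assert (Hs : 0 < d / sqrt 2) by (apply Rdiv_lt_0_compat; [exact Hd|apply sqrt_lt_R0; lra]).
  exists (mkposreal _ Hs). intros w Hw HDw.
  apply C_NormedModule_mixin_compat1. apply (H' w). split; [exact HDw|].
  assert (X := C_NormedModule_mixin_compat2 z w (mkposreal _ Hs) Hw). simpl in X.
  replace (sqrt 2 * (d / sqrt 2)) with d in X by (field; apply Rgt_not_eq, sqrt_lt_R0; lra). exact X.
Qed.

Lemma locally_ball z (D : C -> Prop) : locally z D -> exists d, 0 < d /\ forall w, Cmod (w - z) < d -> D w.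
Proof.
  intros [d Hd]. exists d. split; [apply cond_pos|]. intros w Hw. apply Hd. apply C_NormedModule_mixin_compat1. exact Hw.
Qed.

Lemma Rbar_mult_pos_p_infty x : 0 < x -> Rbar_mult x p_infty = p_infty.
Proof. intros H. unfold Rbar_mult, Rbar_mult'. destruct (Rle_dec 0 x) as [H1|H1]; [|lra]. destruct (Rle_lt_or_eq_dec 0 x H1); [reflexivity|lra]. Qed.

Theorem proposition6p9 (k : nat) (hk : (1 <= k)%nat) :
  exists Ck : R, 0 < Ck /\
    forall (phi : C -> C) (n : nat) (m : nat -> nat),
      O_space k (segment 0 1) phi ->
      (1 <= n)%nat ->
      (forall i : nat, (1 <= i <= n)%nat -> (1 <= m i)%nat) ->
      exists g : C -> C,
        (forall z0 : C, D_cyl n m z0 -> Im z0 <> 0 ->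
           g z0 = remainder k n m phi z0)
        /\ continuous_on (D_cyl n m) g
        /\ (forall z0 : C, locally z0 (D_cyl n m) -> C_differentiable g z0)
        /\ (forall z0 : C, D_cyl n m z0 ->
              Rbar_le (Cmod (g z0))
                (Rbar_mult (Ck * INR n * ((sqrt 5 - 1) / 2) ^ (n * k))
                   (sup_Dinf phi))).
Proof.
  (* 81 = 80 + 1: 80 from [decays_of_sup_Dinf], 1 for the values of [phi] at
     real part at least [9 / 5]. *)
  destruct (remainder_ext_bound k hk) as [K [HK HB]]. exists (K * 81). split. lra.
  intros phi n m Hphi Hn Hm. destruct (decays_of_O_space k phi hk Hphi) as [A HA].
  exists (remainder_ext k n m phi). split; [|split; [|split]].
  - intros z0 HD _. symmetry. apply (remainder_eq k n m phi A); assumption.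
  - apply continuous_on_tends. intros z HD. apply (remainder_ext_tends k n m phi A); auto. exact (proj1 Hphi).
  - intros z0 HL. destruct (locally_ball z0 _ HL) as [d [Hd H]].
    apply (remainder_ext_diff k n m phi A z0 hk Hn HA) with (d := d); auto. exact (proj1 Hphi).
    apply H. rewrite Cmod_sub_diag. exact Hd.
  - intros z0 HD. fold gold.
    assert (HN : 1 <= INR n) by (apply (le_INR 1); exact Hn).
    assert (Hg : 0 < gold ^ (n * k)) by (apply pow_lt; generalize gold_bounds; lra).
    assert (Hp : 0 < K * 81 * INR n * gold ^ (n * k)) by (repeat apply Rmult_lt_0_compat; lra).
    destruct (sup_Dinf_cases phi) as [E|[M [E [HM HMb]]]]; rewrite E.
    + rewrite Rbar_mult_pos_p_infty by exact Hp. exact I.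
    + simpl. eapply Rle_trans. apply (HB phi (80 * M) M n m z0); auto.
      * apply (decays_of_sup_Dinf k); assumption.
      * intros v Hv. apply HMb, Dinf_right, Hv.
      * apply Req_le. ring.
Qed.
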